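(* Let $(a:b:c:d)\in\mathbb{P}_3(\mathbb{Q})$ with $ab=cd$, let $x,y,z$ be complex roots of unity with common order $n$, and suppose that $(a,b,c,d,x,y,z)$ is a solution of $$(d-b)xyz+(b-c)xy+(a-d)xz+(c-a)yz+(c-a)x+(a-d)y+(b-c)z+(d-b)=0.\qquad(\ast)$$ Then one of the following holds: (1) the solution belongs to an unbounded family; (2) two of the variables $a,b,c,d$ are equal to zero; (3) $x=y=z=-1$; (4) $n=10$, and the solution is symmetry-equivalent to $\left(3,\frac12,\frac32,1,\zeta_{10},\zeta_{10}^2,\zeta_{10}^3\right)$; (5) $n=12$, and the solution is symmetry-equivalent to one of the two solutions $\left(2,\frac23,\frac43,1,\zeta_{12},\zeta_{12}^3,\zeta_{12}^5\right)$, $\left(\frac43,\frac23,\frac89,1,\zeta_{12},\zeta_{12}^4,\zeta_{12}^5\right)$; (6) $n=6$, and the solution is symmetry-equivalent to one of the following: (a) $\left(\frac{3cd}{c+2d},\frac{c+2d}{3},c,d,\zeta_6,\zeta_6,\zeta_6^2\right)$ for some $(c,d)\in\mathbb{Q}^2$ with $c+2d\neq 0$; (b) $\left(2d,\frac12 c,c,d,\zeta_6,\zeta_6^2,\zeta_6^2\right)$ for some $(c,d)\in\mathbb{Q}^2$; (c) $\left(\frac{3d^2-4bd}{2d-3b},b,\frac{3bd-4b^2}{2d-3b},d,\zeta_6,\zeta_6^2,\zeta_6^3\right)$ for some $(b,d)\in\mathbb{Q}^2$ with $2d-3b\neq 0$.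
   Context: $\zeta_n$ denotes a primitive $n$-th root of unity. The common order of $x,y,z$ is the least common multiple of their multiplicative orders. The quadruple $(a,b,c,d)$ is regarded as homogeneous coordinates of a point of $\mathbb{P}_3(\mathbb{Q})$, i.e. up to multiplication by a nonzero rational number. A solution $(a,b,c,d,x,y,z)$ of $(\ast)$ belongs to an unbounded family if there exist $\alpha_1,\alpha_2,\alpha_3\in\mathbb{Z}$, not all zero, such that $(a,b,c,d,xt^{\alpha_1},yt^{\alpha_2},zt^{\alpha_3})$ satisfies $(\ast)$ for all $t\in\mathbb{C}^\times$. Two solutions are symmetry-equivalent if one is obtained from the other by a finite composition of (i) the Galois action $(a,b,c,d,x,y,z)\mapsto(a,b,c,d,\sigma(x),\sigma(y),\sigma(z))$, $\sigma\in\operatorname{Gal}(\overline{\mathbb{Q}}/\mathbb{Q})$, and (ii) the following transformations of $(a,b,c,d,x,y,z)$ and their inverses: $(b,a,c,d,x,y^{-1},z)$; $(a,b,d,c,x,y,z^{-1})$; $(\frac1a,\frac1b,\frac1c,\frac1d,x^{-1},y,z)$; $(c,d,a,b,x,z,y)$; $\bigl(b(b-c)(b-d),\,a(b-c)(b-d),\,b(a-c)(d-b),\,b(a-d)(c-b),\,y,x,z\bigr)$. (These induce on $(x,y,z)$ the group of signed $3\times 3$ permutation matrices, acting by permutations and inversions.)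
   Formalization: The fifth symmetry as printed does not send solutions of (∗) to solutions; it is replaced by (a(b-c)(b-d), b(b-c)(b-d), b(b-c)(a-d), b(a-c)(b-d), y, x, z), the map that exchanges x and y and preserves (∗) and ab=cd. *)

(* Defs.v *)
From HB Require Import structures.
From Stdlib Require Import Relation_Operators.
From mathcomp Require Import all_boot all_order all_algebra ring.
From mathcomp Require Import all_classical reals.
From mathcomp Require Export complex.
Set Implicit Arguments.
Unset Strict Implicit.
Unset Printing Implicit Defensive.
Import GRing.Theory.
Local Open Scope ring_scope.
Local Open Scope complex_scope.

Definition star_lhs (F : comNzRingType) (a b c d x y z : F) : F :=
  (d - b) * x * y * z + (b - c) * x * y + (a - d) * x * z + (c - a) * y * z
  + (c - a) * x + (a - d) * y + (b - c) * z + (d - b).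

(* The field of complex numbers is R[i], for R the real numbers. *)
Record septuple (R : realType) := Septuple {
  sa : rat; sb : rat; sc : rat; sd : rat;
  sx : R[i]; sy : R[i]; sz : R[i] }.

Definition star (R : realType) (s : septuple R) : Prop :=
  star_lhs (ratr (sa s)) (ratr (sb s)) (ratr (sc s)) (ratr (sd s))
    (sx s) (sy s) (sz s) = 0.

Definition common_order (R : realType) (x y z : R[i]) (n : nat) : Prop :=
  exists nx ny nz : nat,
    [/\ nx.-primitive_root x, ny.-primitive_root y, nz.-primitive_root z
      & n = lcmn nx (lcmn ny nz)].

(* The first clause says that (a : b : c : d) is a point of P_3(Q); points are
   handled through their coordinates, and rescaling is one of the symmetries
   below. *)
Definition solution (R : realType) (s : septuple R) : Prop :=
  [/\ [|| sa s != 0, sb s != 0, sc s != 0 | sd s != 0],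
      sa s * sb s = sc s * sd s,
      exists n, common_order (sx s) (sy s) (sz s) n
    & star s].

Definition in_unbounded_family (R : realType) (s : septuple R) : Prop :=
  exists al1 al2 al3 : int,
    [|| al1 != 0, al2 != 0 | al3 != 0] /\
    forall t : R[i], t != 0 ->
      star (Septuple (sa s) (sb s) (sc s) (sd s)
              (sx s * t ^ al1) (sy s * t ^ al2) (sz s * t ^ al3)).

Definition Qbar (R : realType) : set R[i] :=
  [set u | algebraicOver (ratr : rat -> R[i]) u]%classic.
Arguments Qbar R : clear implicits.

(* Elements of Gal(Qbar/Q); the values of sigma outside Qbar are irrelevant. *)
Definition galois_aut (R : realType) (sigma : R[i] -> R[i]) : Prop :=
  [/\ set_bij (Qbar R) (Qbar R) sigma,
      forall q : rat, sigma (ratr q) = ratr q,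
      forall u v, Qbar R u -> Qbar R v -> sigma (u + v) = sigma u + sigma v
    & forall u v, Qbar R u -> Qbar R v -> sigma (u * v) = sigma u * sigma v].

(* [swap_xy] has to exchange the coefficients a - d and c - a of the equation
   up to a common factor, while preserving ab = cd; this determines the point
   (a : b : c : d) it produces.  The variant
     (b(b-c)(b-d), a(b-c)(b-d), b(a-c)(d-b), b(a-d)(c-b), y, x, z)
   does not have this property: it sends the solution
   (3, 1/2, 3/2, 1, u, u^2, u^3), with u a primitive 10th root of unity, to
   (1/4, 3/2, 3/8, 1, u^2, u, u^3), which is not a solution.
   [swap_xyE] and [swap_xy_quadric] check the formula used here. *)
Inductive symmetry (R : realType) : septuple R -> septuple R -> Prop :=
| rescale (q a b c d : rat) (x y z : R[i]) : q != 0 ->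
    symmetry (Septuple a b c d x y z)
             (Septuple (q * a) (q * b) (q * c) (q * d) x y z)
| galois_action (sigma : R[i] -> R[i]) (a b c d : rat) (x y z : R[i]) :
    galois_aut sigma ->
    symmetry (Septuple a b c d x y z)
             (Septuple a b c d (sigma x) (sigma y) (sigma z))
| invert_y (a b c d : rat) (x y z : R[i]) :
    symmetry (Septuple a b c d x y z) (Septuple b a c d x y^-1 z)
| invert_z (a b c d : rat) (x y z : R[i]) :
    symmetry (Septuple a b c d x y z) (Septuple a b d c x y z^-1)
| invert_x (a b c d : rat) (x y z : R[i]) :
    (* elsewhere the transformation is undefined *)
    [&& a != 0, b != 0, c != 0 & d != 0] ->
    symmetry (Septuple a b c d x y z)
             (Septuple a^-1 b^-1 c^-1 d^-1 x^-1 y z)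
| swap_yz (a b c d : rat) (x y z : R[i]) :
    symmetry (Septuple a b c d x y z) (Septuple c d a b x z y)
| swap_xy (a b c d : rat) (x y z : R[i]) :
    symmetry (Septuple a b c d x y z)
             (Septuple (a * (b - c) * (b - d)) (b * (b - c) * (b - d))
                       (b * (b - c) * (a - d)) (b * (a - c) * (b - d)) y x z).

Lemma swap_xyE (F : comNzRingType) (a b c d x y z : F) : a * b = c * d ->
  star_lhs (a * (b - c) * (b - d)) (b * (b - c) * (b - d))
           (b * (b - c) * (a - d)) (b * (a - c) * (b - d)) y x z =
  b * (b - a) * star_lhs a b c d x y z.
Proof. by rewrite /star_lhs => abcd; ring: abcd. Qed.

Lemma swap_xy_quadric (F : comNzRingType) (a b c d : F) : a * b = c * d ->
  (a * (b - c) * (b - d)) * (b * (b - c) * (b - d)) =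
  (b * (b - c) * (a - d)) * (b * (a - c) * (b - d)).
Proof. by move=> abcd; ring: abcd. Qed.

Definition solution_symmetry (R : realType) (s s' : septuple R) : Prop :=
  [/\ solution s, solution s' & symmetry s s'].

Definition symmetry_equivalent (R : realType) : septuple R -> septuple R -> Prop :=
  clos_refl_sym_trans (septuple R) (@solution_symmetry R).

(* Main.v *)
From HB Require Import structures.
From Stdlib Require Import Relation_Operators.
Require Import Defs.
From mathcomp Require Import all_boot all_order all_algebra all_field.
From mathcomp Require Import reals ring lra zify.
From mathcomp Require Import boolp classical_sets functions.
(** With x = w1 w2, y = w1 w3, z = w2 w3 and w0 w1 w2 w3 = 1, the equation becomes
    a relation c0 (w0 + 1/w0) + ... + c3 (w3 + 1/w3) = 0 between four cosines, with
    rational coefficients c = (d - b, b - c, a - d, c - a) of sum zero, on which the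
    symmetries of the equation act as permutations of the four points (c_i, w_i)
    (equivalent_swap01, equivalent_swap12, equivalent_swap23).  On the quadric
    ab = cd the coefficients determine (a : b : c : d).  If two of a, b, c, d are
    equal, the equation factors and the solution is in an unbounded family; if
    one is zero, two are.  Otherwise no c_i and no c_i + c_j is zero.

    The relation is studied through its Galois conjugates, which amount to raising
    the w_i to powers prime to their common order N (unity_relation_pow); this is
    the irreducibility of the cyclotomic polynomials.  For an odd prime p dividing
    N, the conjugates that move the p-part only are inverted by a finite Fourier
    transform (class_sumE): the terms fall into classes indexed by p-th roots of
    unity, and the sums over the classes are equal, and are zero if p^2 divides N.
    When they are zero, the relation breaks up so much that the solution is in
    an unbounded family, or its order divides 12 (special_of_vanishing).  When they
    are not, every p-th root of unity is a class, so p is at most 7, because the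
    eight terms w_i, 1/w_i meet at most eight classes, two of them coinciding
    at the trivial class.  For p = 7 some trace would be 1/3 or -1/3; for p = 5
    there is one solution (special_five), that of order 10; the prime 3 with
    exponent one is left.

    So N divides 2^j 3.  Here conjugation by 1 + N/2 changes signs only: the
    relation splits into two halves, or its order can be lowered, and finally all
    w_i lie in one coset of the sixth roots of unity, where the equation is linear
    algebra over the rationals for a short list of exponents (special_order_2j3).
    The halves are relations between two cosines; cosines of the form 0, 1/2, 1 and
    the square root of 3 over 2 account for all of them (two_trace_relation).

    Each solution found is brought to the form of the statement by a permutation of
    the four points, a rescaling, and an automorphism of the algebraic numbers
    that carries the primitive root found to the prescribed one; its existence is
    proved by Zorn's lemma (algebraic_automorphism). *)

Set Implicit Arguments.
Unset Strict Implicit.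
Unset Printing Implicit Defensive.
Import Order.TTheory GRing.Theory Num.Theory.
Local Open Scope ring_scope.
Local Open Scope complex_scope.

(** * Rational relations between roots of unity *)

Lemma root_Cyclotomic_poly (F : numFieldType) (n : nat) (g : F) :
  n.-primitive_root g -> root (map_poly intr ('Phi_n : {poly int})) g.
Proof.
move=> prim_g; have n_gt0 := prim_order_gt0 prim_g.
have rootX d : (0 < d)%N -> root (map_poly intr ('Phi_d : {poly int})) g ->
    g ^+ d = 1.
  move=> d_gt0 rd; apply/eqP; rewrite -subr_eq0.
  have: root (map_poly intr (\prod_(k <- divisors d) 'Phi_k : {poly int})) g.
    rewrite (big_rem d) -?dvdn_divisors ?dvdnn //= rmorphM /= rootM.
    by apply/orP; left.
  by rewrite prod_Cyclotomic // rmorphB rmorph1 /= map_polyXn rootE !hornerE.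
have: root (map_poly intr (\prod_(k <- divisors n) 'Phi_k : {poly int})) g.
  rewrite prod_Cyclotomic // rmorphB rmorph1 /= map_polyXn rootE !hornerE.
  by rewrite prim_expr_order // subrr.
rewrite rmorph_prod /= /root horner_prod prodf_seq_eq0 => /hasP [d].
rewrite -dvdn_divisors // => d_n /= rd.
have d_gt0 := dvdn_gt0 n_gt0 d_n.
have: (n %| d)%N by rewrite (prim_order_dvd prim_g) rootX.
by move=> n_d; have /eqP -> : n == d by rewrite eqn_dvd n_d d_n.
Qed.

(** The cyclotomic polynomial is irreducible over the rationals, as the minimal
    polynomial of a root of unity among the algebraic numbers.  Coprimality of
    rational polynomials does not depend on the field in which the roots are
    taken, so the same holds for primitive roots of unity in any F. *)
Lemma Cyclotomic_dvdP (F : numFieldType) (n : nat) (g : F) (f : {poly rat}) :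
  n.-primitive_root g ->
  root (map_poly ratr f) g = (map_poly intr 'Phi_n %| f).
Proof.
move=> prim_g; have n_gt0 := prim_order_gt0 prim_g.
set P : {poly rat} := map_poly intr 'Phi_n.
have map_P (K : numFieldType) : map_poly (ratr : rat -> K) P
    = map_poly intr ('Phi_n : {poly int}).
  by rewrite -map_poly_comp; apply: eq_map_poly => k /=; rewrite rmorph_int.
have mapC : map_poly (ratr : rat -> algC) P = map_poly intr 'Phi_n := map_P _.
have rPg : root (map_poly ratr P) g by rewrite map_P root_Cyclotomic_poly.
apply/idP/idP => [rf|/dvdpP [q ->]]; last first.
  by rewrite rmorphM /= rootM rPg orbT.
apply: contraTT rf => P'f.
suff /Bezout_eq1_coprimepP [[u v] /= uv] : coprimep P f.
  apply/negP => rf; move/(congr1 (fun q => (map_poly (ratr : rat -> F) q).[g])): uv.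
  rewrite rmorphD !rmorphM /= hornerD !hornerM (eqP rf) (eqP rPg) !mulr0 addr0.
  by move=> /esym; rewrite rmorph1 hornerC => /eqP; rewrite oner_eq0.
rewrite /coprimep; apply: contraNT P'f => gcd1.
have gcd0 : gcdp P f != 0.
  by rewrite gcdp_eq0 negb_and -size_poly_eq0 /P size_map_inj_poly ?size_Cyclotomic //;
     exact: intr_inj.
have [z rz] : exists z : algC, root (map_poly ratr (gcdp P f)) z.
  by apply/closed_rootP; rewrite size_map_poly.
have rz_dv (q : {poly rat}) : gcdp P f %| q -> root (map_poly ratr q) z.
  by move=> /dvdpP [u ->]; rewrite rmorphM /= rootM rz orbT.
have rzP := rz_dv _ (dvdp_gcdl P f); have rzf := rz_dv _ (dvdp_gcdr P f).
have [y prim_y] := C_prim_root_exists n_gt0.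
have prim_z : n.-primitive_root z.
  by move: rzP; rewrite mapC (Cintr_Cyclotomic prim_y) root_cyclotomic.
have [m [mE _] mP] := minCpolyP z.
have Pm : map_poly (ratr : rat -> algC) P = map_poly ratr m.
  by rewrite mapC (Cintr_Cyclotomic prim_z) -(minCpoly_cyclotomic prim_z) mE.
by rewrite (map_poly_inj _ Pm) -mP.
Qed.

Lemma root_primitive_conj (F G : numFieldType) (n : nat) (g : F) (h : G)
    (f : {poly rat}) :
  n.-primitive_root g -> n.-primitive_root h ->
  root (map_poly ratr f) g = root (map_poly ratr f) h.
Proof. by move=> pg ph; rewrite (Cyclotomic_dvdP f pg) (Cyclotomic_dvdP f ph). Qed.

Definition unity_log (F : fieldType) (m : nat) (g w : F) : nat :=
  index w [seq g ^+ i | i <- iota 0 m].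

Lemma unity_logP (F : fieldType) (m : nat) (g w : F) :
  m.-primitive_root g -> w ^+ m = 1 ->
  (unity_log m g w < m)%N /\ w = g ^+ unity_log m g w.
Proof.
move=> pg /(prim_rootP pg) [i wE].
have win : w \in [seq g ^+ i | i <- iota 0 m].
  by apply/mapP; exists (val i); rewrite // mem_iota ltn_ord.
have lt_m : (unity_log m g w < m)%N by move: win; rewrite -index_mem size_map size_iota.
split=> //; have := nth_index 0 win.
by rewrite (nth_map 0%N) ?size_iota // nth_iota // add0n => ->.
Qed.

(** Galois conjugation, without automorphisms: write the relation as f(g) = 0 with
    f rational; f also vanishes at the primitive root g^k. *)
Lemma unity_relation_pow (F : numFieldType) (m k : nat) (g : F)
    (s : seq (rat * F)) :
  m.-primitive_root g -> coprime k m -> (forall t, t \in s -> t.2 ^+ m = 1) ->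
  \sum_(t <- s) ratr t.1 * t.2 = 0 -> \sum_(t <- s) ratr t.1 * t.2 ^+ k = 0.
Proof.
move=> pg co unit rel.
pose e (w : F) := unity_log m g w.
have eP w : w ^+ m = 1 -> w = g ^+ e w by case/(unity_logP pg).
pose f := \sum_(t <- s) t.1 *: 'X^(e t.2) : {poly rat}.
have fE (z : F) : (map_poly ratr f).[z] = \sum_(t <- s) ratr t.1 * z ^+ e t.2.
  rewrite /f raddf_sum /= horner_sum; apply: eq_bigr => t _.
  by rewrite map_polyZ /= map_polyXn hornerZ hornerXn.
have pgk : m.-primitive_root (g ^+ k) by rewrite prim_root_exp_coprime.
have: root (map_poly ratr f) (g ^+ k).
  rewrite (root_primitive_conj f pgk pg) rootE fE -{2}rel; apply/eqP.
  by apply: eq_big_seq => t ts; rewrite -eP // unit.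
rewrite rootE fE => /eqP; apply: etrans.
by apply: eq_big_seq => t ts; rewrite exprAC -eP // unit.
Qed.

Lemma unity_neq0 (F : fieldType) (m : nat) (w : F) :
  (0 < m)%N -> w ^+ m = 1 -> w != 0.
Proof.
move=> m0; apply: contra_eq_neq => ->.
by rewrite expr0n gtn_eqF // eq_sym oner_eq0.
Qed.

(** The conjugate by -1, that is by m - 1 modulo m. *)
Lemma unity_relation_inv (F : numFieldType) (m : nat) (g : F)
    (s : seq (rat * F)) :
  m.-primitive_root g -> (forall t, t \in s -> t.2 ^+ m = 1) ->
  \sum_(t <- s) ratr t.1 * t.2 = 0 -> \sum_(t <- s) ratr t.1 * t.2^-1 = 0.
Proof.
move=> pg unit rel; have m0 := prim_order_gt0 pg.
have co : coprime m.-1 m by rewrite -{2}(prednK m0) coprimenS.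
have := unity_relation_pow pg co unit rel; apply: etrans.
apply: eq_big_seq => t ts; congr (_ * _).
have tm := unit _ ts.
have t0 := unity_neq0 m0 tm.
by apply: (mulfI t0); rewrite mulfV // -exprS prednK.
Qed.

(** Niven: w + 1/w is an algebraic integer of absolute value at most 2, so it is
    an integer as soon as it is rational.  The integrality is read off a root
    of unity of the same order among the algebraic numbers, where
    z + 1/z = q holds as well by conjugation. *)
Lemma rational_trace (F : numFieldType) (n : nat) (w : F) (q : rat) :
  (0 < n)%N -> w ^+ n = 1 -> w + w^-1 = ratr q ->
  q \in [:: 0; 1; -1; 2; -2].
Proof.
move=> n_gt0 wn wq.
have [m pw _] := prim_order_exists n_gt0 wn.
have m_gt0 := prim_order_gt0 pw.
have [z pz] := C_prim_root_exists m_gt0.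
have w0 : w != 0 by rewrite (prim_root_eq0 pw) -lt0n.
have z0 : z != 0 by rewrite (prim_root_eq0 pz) -lt0n.
pose f : {poly rat} := 'X^2 - q *: 'X + 1.
have fE (K : numFieldType) (y : K) : y != 0 ->
    root (map_poly ratr f) y = (y + y^-1 == ratr q).
  move=> y0; rewrite /f !rmorphD rmorphN /= map_polyZ /= map_polyXn map_polyX rmorph1.
  rewrite rootE !hornerE -[RHS](inj_eq (mulfI y0)) mulrDr mulfV //.
  by rewrite -[RHS]subr_eq0; congr (_ == 0); ring.
have zq : z + z^-1 = ratr q.
  by apply/eqP; rewrite -fE // (root_primitive_conj f pz pw) fE // wq.
have zm : z ^+ m = 1 := prim_expr_order pz.
have Az : z \in Aint := Aint_unity_root m_gt0 (introT unity_rootP zm).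
have Aq : ratr q \in Aint.
  rewrite -zq rpredD // (Aint_unity_root m_gt0) //; apply/unity_rootP.
  by rewrite exprVn zm invr1.
have /intrP [k kE] : (ratr q : algC) \in Num.int.
  by apply: Cint_rat_Aint => //; apply/CratP; exists q.
have nz : `|z| = 1 by apply/eqP; rewrite -(pexpr_eq1 m_gt0) // -normrX zm normr1.
have k2 : `|k| <= 2.
  rewrite -(ler_int algC) intr_norm -kE -zq (le_trans (ler_normD _ _)) //.
  by rewrite normfV nz invr1.
have kE' : ratr q = ratr k%:~R :> algC by rewrite rmorph_int.
rewrite (fmorph_inj _ kE').
by move: k2; case: k {kE kE'} => [[|[|[|k]]]|[|[|k]]].
Qed.

(** * Configurations of four roots of unity *)

(** In terms of (a, b, c, d) the four coefficients are d - b, b - c, a - d, c - a.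
    The conditions say that a, b, c, d are distinct and nonzero when ab = cd;
    they are symmetric in the four coefficients because the sum is zero. *)
Definition generic (c0 c1 c2 c3 : rat) : Prop :=
  [/\ [&& c0 != 0, c1 != 0, c2 != 0 & c3 != 0], c0 + c1 + c2 + c3 = 0
    & [&& c0 + c1 != 0, c0 + c2 != 0 & c0 + c3 != 0]].

(** Twice the cosine of the argument of w. *)
Definition trace (F : fieldType) (w : F) : F := w + w^-1.

(** The equation in its symmetric form.  A point is a coefficient together with a
    root of unity; when x = w1 w2, y = w1 w3, z = w2 w3 and w0 w1 w2 w3 = 1, the
    left-hand side of the equation is w0^-1 times the sum of c_i (w_i + 1/w_i). *)
Definition config (F : numFieldType) (t0 t1 t2 t3 : rat * F) : Prop :=
  [/\ generic t0.1 t1.1 t2.1 t3.1,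
      exists2 m, (0 < m)%N &
        [/\ t0.2 ^+ m = 1, t1.2 ^+ m = 1, t2.2 ^+ m = 1 & t3.2 ^+ m = 1],
      t0.2 * t1.2 * t2.2 * t3.2 = 1
    & ratr t0.1 * trace t0.2 + ratr t1.1 * trace t1.2
      + ratr t2.1 * trace t2.2 + ratr t3.1 * trace t3.2 = 0].

(** The conclusion of the classification.  The base cases are normal forms, in
    which only the products w1 w2, w1 w3, w2 w3 are prescribed: they are the x, y,
    z of the statement and determine the w_i up to a common sign.  The swaps close
    the list under permutation of the four points. *)
Inductive special (F : numFieldType) :
    rat * F -> rat * F -> rat * F -> rat * F -> Prop :=
| special_unbounded t0 t1 t2 t3 (l0 l1 l2 l3 : int) :
    [|| l0 != 0, l1 != 0, l2 != 0 | l3 != 0] -> l0 + l1 + l2 + l3 = 0 ->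
    (forall u : F, u != 0 ->
       ratr t0.1 * trace (t0.2 * u ^ l0) + ratr t1.1 * trace (t1.2 * u ^ l1)
       + ratr t2.1 * trace (t2.2 * u ^ l2) + ratr t3.1 * trace (t3.2 * u ^ l3)
       = 0) ->
    special t0 t1 t2 t3
| special_aligned t0 t1 t2 t3 :
    t1.2 = t0.2 -> t2.2 = t0.2 -> t3.2 = t0.2 -> t0.2 ^+ 2 = -1 ->
    special t0 t1 t2 t3
| special10 t0 t1 t2 t3 (g : F) (k : rat) : 10.-primitive_root g ->
    t1.2 * t2.2 = g -> t1.2 * t3.2 = g ^+ 2 -> t2.2 * t3.2 = g ^+ 3 ->
    t0.1 = k -> t1.1 = - 2 * k -> t2.1 = 4 * k -> t3.1 = - 3 * k ->
    special t0 t1 t2 t3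
| special12a t0 t1 t2 t3 (g : F) (k : rat) : 12.-primitive_root g ->
    t1.2 * t2.2 = g -> t1.2 * t3.2 = g ^+ 3 -> t2.2 * t3.2 = g ^+ 5 ->
    t0.1 = k -> t1.1 = - 2 * k -> t2.1 = 3 * k -> t3.1 = - 2 * k ->
    special t0 t1 t2 t3
| special12b t0 t1 t2 t3 (g : F) (k : rat) : 12.-primitive_root g ->
    t1.2 * t2.2 = g -> t1.2 * t3.2 = g ^+ 4 -> t2.2 * t3.2 = g ^+ 5 ->
    t0.1 = 3 * k -> t1.1 = - 2 * k -> t2.1 = 3 * k -> t3.1 = - 4 * k ->
    special t0 t1 t2 t3
| special6a t0 t1 t2 t3 (g : F) : 6.-primitive_root g ->
    t1.2 * t2.2 = g -> t1.2 * t3.2 = g -> t2.2 * t3.2 = g ^+ 2 ->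
    t1.1 = 2 * t0.1 -> special t0 t1 t2 t3
| special6b t0 t1 t2 t3 (g : F) : 6.-primitive_root g ->
    t1.2 * t2.2 = g -> t1.2 * t3.2 = g ^+ 2 -> t2.2 * t3.2 = g ^+ 2 ->
    t3.1 = - 2 * t0.1 -> special t0 t1 t2 t3
| special6c t0 t1 t2 t3 (g : F) : 6.-primitive_root g ->
    t1.2 * t2.2 = g -> t1.2 * t3.2 = g ^+ 2 -> t2.2 * t3.2 = g ^+ 3 ->
    2 * t2.1 = t0.1 - 3 * t1.1 -> special t0 t1 t2 t3
| special_swap01 t0 t1 t2 t3 : special t1 t0 t2 t3 -> special t0 t1 t2 t3
| special_swap12 t0 t1 t2 t3 : special t0 t2 t1 t3 -> special t0 t1 t2 t3
| special_swap23 t0 t1 t2 t3 : special t0 t1 t3 t2 -> special t0 t1 t2 t3.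

Lemma config_swap01 (F : numFieldType) (t0 t1 t2 t3 : rat * F) :
  config t0 t1 t2 t3 -> config t1 t0 t2 t3.
Proof.
move=> [[/and4P [n0 n1 n2 n3] s /and3P [s1 s2 s3]] [m m0 [r0 r1 r2 r3]] pr rel].
split; last 1 first.
- by rewrite -rel; ring.
- split; first by rewrite n0 n1 n2 n3.
    by rewrite -s; ring.
  apply/and3P; split; first by rewrite addrC.
    by apply: contra_neq s3 => h; lra.
  by apply: contra_neq s2 => h; lra.
- by exists m.
- by rewrite -pr; ring.
Qed.

Lemma config_swap12 (F : numFieldType) (t0 t1 t2 t3 : rat * F) :
  config t0 t1 t2 t3 -> config t0 t2 t1 t3.
Proof.
move=> [[/and4P [n0 n1 n2 n3] s /and3P [s1 s2 s3]] [m m0 [r0 r1 r2 r3]] pr rel].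
split; last 1 first.
- by rewrite -rel; ring.
- split; first by rewrite n0 n1 n2 n3.
    by rewrite -s; ring.
  by rewrite s1 s2 s3.
- by exists m.
- by rewrite -pr; ring.
Qed.

Lemma config_swap23 (F : numFieldType) (t0 t1 t2 t3 : rat * F) :
  config t0 t1 t2 t3 -> config t0 t1 t3 t2.
Proof.
move=> [[/and4P [n0 n1 n2 n3] s /and3P [s1 s2 s3]] [m m0 [r0 r1 r2 r3]] pr rel].
split; last 1 first.
- by rewrite -rel; ring.
- split; first by rewrite n0 n1 n2 n3.
    by rewrite -s; ring.
  by rewrite s1 s2 s3.
- by exists m.
- by rewrite -pr; ring.
Qed.

(** Adjacent transpositions generate all permutations of four arguments. *)
Lemma wlog_sorted (T : Type) (key : T -> nat) (P : T -> T -> T -> T -> Prop) :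
  (forall t0 t1 t2 t3, P t1 t0 t2 t3 -> P t0 t1 t2 t3) ->
  (forall t0 t1 t2 t3, P t0 t2 t1 t3 -> P t0 t1 t2 t3) ->
  (forall t0 t1 t2 t3, P t0 t1 t3 t2 -> P t0 t1 t2 t3) ->
  (forall t0 t1 t2 t3, (key t0 <= key t1)%N -> (key t1 <= key t2)%N ->
     (key t2 <= key t3)%N -> P t0 t1 t2 t3) ->
  forall t0 t1 t2 t3, P t0 t1 t2 t3.
Proof.
move=> s01 s12 s23 srt.
have P3 t0 t1 t2 t3 : (key t1 <= key t2)%N -> (key t2 <= key t3)%N ->
    P t0 t1 t2 t3.
  move=> le12 le23; have [le01|/ltnW le10] := leqP (key t0) (key t1).
    exact: srt.
  apply: s01; have [le02|/ltnW le20] := leqP (key t0) (key t2).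
    exact: srt.
  apply: s12; have [le03|/ltnW le30] := leqP (key t0) (key t3).
    exact: srt.
  by apply: s23; exact: srt.
have P2 t0 t1 t2 t3 : (key t2 <= key t3)%N -> P t0 t1 t2 t3.
  move=> le23; have [le12|/ltnW le21] := leqP (key t1) (key t2).
    exact: P3.
  apply: s12; have [le13|/ltnW le31] := leqP (key t1) (key t3).
    exact: P3.
  by apply: s23; exact: P3.
move=> t0 t1 t2 t3; have [le23|/ltnW le32] := leqP (key t2) (key t3).
  exact: P2.
by apply: s23; exact: P2.
Qed.

Lemma config_neq0 (F : numFieldType) (t0 t1 t2 t3 : rat * F) :
  config t0 t1 t2 t3 -> [/\ t0.2 != 0, t1.2 != 0, t2.2 != 0 & t3.2 != 0].
Proof.
case=> _ [m m0 [r0 r1 r2 r3]] _ _.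
by split; apply: unity_neq0 m0 _.
Qed.

(** A relation c0 w0 + c1 w1 + c2/w2 + c3/w3 = 0 makes the whole family
    (w0 u, w1 u, w2/u, w3/u) satisfy the equation: the complementary half of the
    equation is the inverse relation, and the two halves are multiplied by u
    and 1/u. *)
Lemma special_of_inverted_pair (F : numFieldType) (t0 t1 t2 t3 : rat * F) :
  config t0 t1 t2 t3 ->
  ratr t0.1 * t0.2 + ratr t1.1 * t1.2 + ratr t2.1 * t2.2^-1
    + ratr t3.1 * t3.2^-1 = 0 ->
  special t0 t1 t2 t3.
Proof.
move=> cfg bal; have [w0 w1 w2 w3] := config_neq0 cfg.
have [_ _ _ rel] := cfg.
apply: (@special_unbounded _ _ _ _ _ 1 1 (-1) (-1)) => // u u0.
rewrite !expr1z !exprN1 /trace !invfM invrK.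
transitivity (u * (ratr t0.1 * t0.2 + ratr t1.1 * t1.2 + ratr t2.1 * t2.2^-1
    + ratr t3.1 * t3.2^-1) + u^-1 * ((ratr t0.1 * trace t0.2
      + ratr t1.1 * trace t1.2 + ratr t2.1 * trace t2.2 + ratr t3.1 * trace t3.2)
    - (ratr t0.1 * t0.2 + ratr t1.1 * t1.2 + ratr t2.1 * t2.2^-1
    + ratr t3.1 * t3.2^-1))); last by rewrite rel bal; ring.
by rewrite /trace; field; rewrite u0 w0 w1 w2 w3.
Qed.

(** Here 1/w1 = - w0 lets the first two terms cancel along (w0 u, w1/u), while the
    last two traces are zero. *)
Lemma special_of_opposite_pair (F : numFieldType) (t0 t1 t2 t3 : rat * F) :
  config t0 t1 t2 t3 -> t0.1 = t1.1 -> t0.2 * t1.2 = -1 ->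
  t2.2 ^+ 2 = -1 -> t3.2 ^+ 2 = -1 -> special t0 t1 t2 t3.
Proof.
move=> cfg c01 w01 w2 w3; have [w0n w1n w2n w3n] := config_neq0 cfg.
have tr0 (w : F) : w != 0 -> w ^+ 2 = -1 -> trace w = 0.
  move=> wn ww; apply: (mulfI wn).
  by rewrite mulrDr mulfV // -expr2 ww mulr0 addNr.
apply: (@special_unbounded _ _ _ _ _ 1 (-1) 0 0) => // u u0.
rewrite expr1z exprN1 expr0z !mulr1 (tr0 _ w2n w2) (tr0 _ w3n w3).
rewrite !mulr0 !addr0 c01 /trace.
have -> : t0.2 = - t1.2^-1 by rewrite -mulN1r -w01 mulfK.
by field; rewrite u0 w1n.
Qed.

(** * Configurations in a coset of the sixth roots of unity *)

Lemma prim6_sqr (F : fieldType) (h : F) : 6.-primitive_root h -> h ^+ 2 = h - 1.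
Proof.
move=> ph; have h6 := prim_expr_order ph.
have n3 : h ^+ 3 - 1 != 0 by rewrite subr_eq0 -(prim_order_dvd ph).
have n2 : h ^+ 2 - 1 != 0 by rewrite subr_eq0 -(prim_order_dvd ph).
have n1 : h + 1 != 0.
  by apply: contra_neq n2 => h1; rewrite (_ : _ - 1 = (h + 1) * (h - 1));
    [rewrite h1 mul0r | ring].
apply/eqP; rewrite -subr_eq0.
have /eqP : (h ^+ 3 - 1) * ((h + 1) * (h ^+ 2 - (h - 1))) = 0.
  by transitivity (h ^+ 6 - 1); [ring | rewrite h6 subrr].
by rewrite !mulf_eq0 (negPf n3) (negPf n1).
Qed.

(** Up to a factor independent of k, the next four tables are the values at
    h^k, for h = exp(i pi / 3), of w + 1/w, of w - 1/w, and of the two coordinates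
    in the basis (1, h). *)
Definition cos_pi3 (k : nat) : rat := nth 0 [:: 2; 1; -1; -2; -1; 1] k.
Definition sin_pi3 (k : nat) : rat := nth 0 [:: 0; 1; 1; 0; -1; -1] k.
Definition re_pi3 (k : nat) : rat := nth 0 [:: 1; 0; -1; -1; 0; 1] k.
Definition im_pi3 (k : nat) : rat := nth 0 [:: 0; 1; 1; 0; -1; -1] k.

Lemma generic_contra c0 c1 c2 c3 : generic c0 c1 c2 c3 ->
  [|| c0 == 0, c1 == 0, c2 == 0, c3 == 0, c0 + c1 == 0, c0 + c2 == 0 | c0 + c3 == 0]
  -> False.
Proof.
move=> [/and4P [/negPf -> /negPf -> /negPf -> /negPf ->] _].
by case/and3P => [/negPf -> /negPf -> /negPf ->].
Qed.

Ltac degenerate gen :=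
  exfalso; apply: (generic_contra gen); rewrite -?orbA;
  first [ by apply/or4P; apply: Or41; apply/eqP; lra
        | by apply/or4P; apply: Or42; apply/eqP; lra
        | by apply/or4P; apply: Or43; apply/eqP; lra
        | by do 3 (apply/orP; right); apply/or4P; apply: Or41; apply/eqP; lra
        | by do 3 (apply/orP; right); apply/or4P; apply: Or42; apply/eqP; lra
        | by do 3 (apply/orP; right); apply/or4P; apply: Or43; apply/eqP; lra
        | by do 3 (apply/orP; right); apply/or4P; apply: Or44; apply/eqP; lra ].

Definition sorted_exponents (s : nat) (k0 k1 k2 k3 : nat) : bool :=
  [&& k0 <= k1, k1 <= k2, k2 <= k3, k3 < 6 & k0 + k1 + k2 + k3 == s %[mod 6]]%N.

(** In each remaining pattern of exponents the linear relation forces a coefficient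
    or a sum of two coefficients to vanish. *)
Lemma cos_patterns c0 c1 c2 c3 k0 k1 k2 k3 :
  generic c0 c1 c2 c3 -> sorted_exponents 0 k0 k1 k2 k3 ->
  c0 * cos_pi3 k0 + c1 * cos_pi3 k1 + c2 * cos_pi3 k2 + c3 * cos_pi3 k3 = 0 ->
  [:: k0; k1; k2; k3] \in
    [:: [:: 0; 0; 0; 0]; [:: 3; 3; 3; 3]; [:: 1; 1; 5; 5]; [:: 2; 2; 4; 4];
        [:: 0; 1; 1; 4]; [:: 0; 2; 5; 5]; [:: 1; 3; 4; 4]; [:: 2; 2; 3; 5];
        [:: 0; 1; 2; 3]; [:: 0; 3; 4; 5]]%N.
Proof.
move=> gen; have [_ sum0 _] := gen; case/and5P.
case: k3 => [|[|[|[|[|[|k3]]]]]]; case: k2 => [|[|[|[|[|[|k2]]]]]] //;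
case: k1 => [|[|[|[|[|[|k1]]]]]] //; case: k0 => [|[|[|[|[|[|k0]]]]]] //;
rewrite /cos_pi3 /= => _ _ _ _ _ rel //; degenerate gen.
Qed.

Lemma sin_patterns c0 c1 c2 c3 k0 k1 k2 k3 :
  generic c0 c1 c2 c3 -> sorted_exponents 0 k0 k1 k2 k3 ->
  c0 * sin_pi3 k0 + c1 * sin_pi3 k1 + c2 * sin_pi3 k2 + c3 * sin_pi3 k3 = 0 ->
  [:: k0; k1; k2; k3] \in
    [:: [:: 0; 0; 0; 0]; [:: 3; 3; 3; 3]; [:: 0; 0; 3; 3]; [:: 1; 1; 2; 2];
        [:: 4; 4; 5; 5]; [:: 0; 0; 1; 5]; [:: 0; 0; 2; 4]; [:: 1; 3; 3; 5];
        [:: 2; 3; 3; 4]; [:: 0; 1; 1; 4]; [:: 0; 2; 5; 5]; [:: 1; 3; 4; 4];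
        [:: 2; 2; 3; 5]]%N.
Proof.
move=> gen; have [_ sum0 _] := gen; case/and5P.
case: k3 => [|[|[|[|[|[|k3]]]]]]; case: k2 => [|[|[|[|[|[|k2]]]]]] //;
case: k1 => [|[|[|[|[|[|k1]]]]]] //; case: k0 => [|[|[|[|[|[|k0]]]]]] //;
rewrite /sin_pi3 /= => _ _ _ _ _ rel //; degenerate gen.
Qed.

Lemma pi3_patterns c0 c1 c2 c3 k0 k1 k2 k3 :
  generic c0 c1 c2 c3 -> sorted_exponents 3 k0 k1 k2 k3 ->
  c0 * re_pi3 k0 + c1 * re_pi3 k1 + c2 * re_pi3 k2 + c3 * re_pi3 k3 = 0 ->
  c0 * im_pi3 k0 + c1 * im_pi3 k1 + c2 * im_pi3 k2 + c3 * im_pi3 k3 = 0 ->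
  [:: k0; k1; k2; k3] \in [:: [:: 0; 1; 3; 5]; [:: 0; 2; 3; 4]]%N.
Proof.
move=> gen; have [_ sum0 _] := gen; case/and5P.
case: k3 => [|[|[|[|[|[|k3]]]]]]; case: k2 => [|[|[|[|[|[|k2]]]]]] //;
case: k1 => [|[|[|[|[|[|k1]]]]]] //; case: k0 => [|[|[|[|[|[|k0]]]]]] //;
rewrite /re_pi3 /im_pi3 /= => _ _ _ _ _ re im //; degenerate gen.
Qed.

(** Permuting the four points, their exponents in the coset zeta h^k may be taken
    in increasing order.  The predicate Q carries a further symmetric hypothesis
    through the permutation. *)
Lemma special_of_coset6 (F : numFieldType) (h zeta : F) (s : nat)
    (Q : rat * F -> rat * F -> rat * F -> rat * F -> Prop) :
  6.-primitive_root h -> zeta != 0 -> zeta ^+ 4 = h ^+ (5 * s) ->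
  (forall t0 t1 t2 t3, Q t0 t1 t2 t3 -> Q t1 t0 t2 t3) ->
  (forall t0 t1 t2 t3, Q t0 t1 t2 t3 -> Q t0 t2 t1 t3) ->
  (forall t0 t1 t2 t3, Q t0 t1 t2 t3 -> Q t0 t1 t3 t2) ->
  (forall t0 t1 t2 t3 k0 k1 k2 k3,
     config t0 t1 t2 t3 -> Q t0 t1 t2 t3 -> sorted_exponents s k0 k1 k2 k3 ->
     [/\ t0.2 = zeta * h ^+ k0, t1.2 = zeta * h ^+ k1,
         t2.2 = zeta * h ^+ k2 & t3.2 = zeta * h ^+ k3] ->
     special t0 t1 t2 t3) ->
  forall t0 t1 t2 t3, config t0 t1 t2 t3 -> Q t0 t1 t2 t3 ->
  [/\ (t0.2 / zeta) ^+ 6 = 1, (t1.2 / zeta) ^+ 6 = 1,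
      (t2.2 / zeta) ^+ 6 = 1 & (t3.2 / zeta) ^+ 6 = 1] ->
  special t0 t1 t2 t3.
Proof.
move=> ph z0 z4 q01 q12 q23 srt.
pose key (t : rat * F) := unity_log 6 h (t.2 / zeta).
have keyP t : (t.2 / zeta) ^+ 6 = 1 ->
    (key t < 6)%N /\ t.2 = zeta * h ^+ key t.
  case/(unity_logP ph) => key6 tE; split=> //.
  by rewrite -tE mulrCA mulfV // mulr1.
apply: (@wlog_sorted _ key (fun t0 t1 t2 t3 => config t0 t1 t2 t3 ->
  Q t0 t1 t2 t3 -> [/\ (t0.2 / zeta) ^+ 6 = 1, (t1.2 / zeta) ^+ 6 = 1,
    (t2.2 / zeta) ^+ 6 = 1 & (t3.2 / zeta) ^+ 6 = 1] ->
  special t0 t1 t2 t3)) => t0 t1 t2 t3.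
- move=> IH cfg q [? ? ? ?].
  by apply: special_swap01; apply: IH; [exact: config_swap01 | exact: q01 |].
- move=> IH cfg q [? ? ? ?].
  by apply: special_swap12; apply: IH; [exact: config_swap12 | exact: q12 |].
- move=> IH cfg q [? ? ? ?].
  by apply: special_swap23; apply: IH; [exact: config_swap23 | exact: q23 |].
move=> le01 le12 le23 cfg q.
case=> /keyP [lt0 e0] /keyP [lt1 e1] /keyP [lt2 e2] /keyP [lt3 e3].
apply: (srt _ _ _ _ (key t0) (key t1) (key t2) (key t3)) => //.
rewrite /sorted_exponents le01 le12 le23 lt3 /=.
have [_ _ pr _] := cfg.
rewrite -(eqn_modDr (5 * s)) -mulSn; apply/eqP.
transitivity (0 %% 6)%N; last by rewrite modnMr mod0n.
apply/eqP; rewrite -(eq_prim_root_expr ph) expr0 -pr e0 e1 e2 e3.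
by rewrite exprD -z4 !exprD; apply/eqP; ring.
Qed.

(** The traces of sixth roots of unity are rational, so the equation is one rational
    linear relation, which has solutions for the patterns of cos_patterns. *)
Lemma special_mu6 (F : numFieldType) (h : F) (t0 t1 t2 t3 : rat * F) :
  6.-primitive_root h -> config t0 t1 t2 t3 ->
  [/\ t0.2 ^+ 6 = 1, t1.2 ^+ 6 = 1, t2.2 ^+ 6 = 1 & t3.2 ^+ 6 = 1] ->
  special t0 t1 t2 t3.
Proof.
move=> ph cfg; rewrite -[t0.2]divr1 -[t1.2]divr1 -[t2.2]divr1 -[t3.2]divr1.
have h2 := prim6_sqr ph.
have hV : h^-1 = 1 - h.
  have h0 : h != 0 by rewrite (prim_root_eq0 ph).
  by apply: (mulfI h0); rewrite mulfV //; ring: h2.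
have p5 : 6.-primitive_root (h ^+ 5) by rewrite prim_root_exp_coprime.
have tr k : (k < 6)%N -> trace (1 * h ^+ k) = ratr (cos_pi3 k).
  rewrite mul1r /trace -exprVn hV.
  by case: k => [|[|[|[|[|[|k]]]]]] // _;
    rewrite /cos_pi3 /= ?rmorphN ?rmorph_nat ?rmorph1; ring: h2.
apply: (@special_of_coset6 _ h 1 0 (fun _ _ _ _ => True)) => //.
- exact: oner_neq0.
- by rewrite expr1n muln0 expr0.
move=> {}t0 {}t1 {}t2 {}t3 k0 k1 k2 k3 {}cfg _ srt [e0 e1 e2 e3].
have [gen _ _ rel] := cfg; have [_ sum0 _] := gen.
have /and5P [l01 l12 l23 l3 _] := srt.
have l2 := leq_ltn_trans l23 l3; have l1 := leq_ltn_trans l12 l2.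
have l0 := leq_ltn_trans l01 l1.
rewrite e0 e1 e2 e3 !tr // -!rmorphM -!rmorphD /= in rel.
have {}rel : t0.1 * cos_pi3 k0 + t1.1 * cos_pi3 k1 + t2.1 * cos_pi3 k2
    + t3.1 * cos_pi3 k3 = 0 
  by apply/eqP; move/eqP: rel; rewrite fmorph_eq0.
have sum0F : ratr t0.1 + ratr t1.1 + ratr t2.1 + ratr t3.1 = 0 :> F.
  by have := congr1 (ratr : rat -> F) sum0; rewrite !rmorphD rmorph0.
have := cos_patterns gen srt rel; rewrite !inE.
have bal (w : F) : t0.2 = w -> t1.2 = w -> t2.2^-1 = w -> t3.2^-1 = w ->
    special t0 t1 t2 t3.
  move=> i0 i1 i2 i3; apply: special_of_inverted_pair => //.
  by rewrite i0 i1 i2 i3 -!mulrDl sum0F mul0r.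
have inv k : (k <= 6)%N -> (1 * h ^+ k)^-1 = h ^+ (6 - k).
  move=> k6; rewrite mul1r -[LHS]mul1r -(prim_expr_order ph) -{1}(subnK k6) exprD.
  by rewrite mulfK // expf_neq0 // (prim_root_eq0 ph).
do ?case/orP; move=> /eqP [? ? ? ?]; subst k0 k1 k2 k3;
  rewrite /cos_pi3 /= in rel.
- by apply: (bal 1); rewrite ?e0 ?e1 ?e2 ?e3 ?inv //; ring: h2.
- by apply: (bal (-1)); rewrite ?e0 ?e1 ?e2 ?e3 ?inv //; ring: h2.
- by apply: (bal h); rewrite ?e0 ?e1 ?e2 ?e3 ?inv //; ring: h2.
- by apply: (bal (h ^+ 2)); rewrite ?e0 ?e1 ?e2 ?e3 ?inv //; ring: h2.
- do [apply: special_swap23; apply: special_swap12; apply: special_swap01].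
  by apply: (special6a (g := h)) => //; rewrite ?e0 ?e1 ?e2 ?e3; [ring: h2..|lra].
- apply: special_swap01.
  by apply: (special6a (g := h ^+ 5)) => //; rewrite ?e0 ?e1 ?e2 ?e3; [ring: h2..|lra].
- by apply: (special6a (g := h)) => //; rewrite ?e0 ?e1 ?e2 ?e3; [ring: h2..|lra].
- do [apply: special_swap23; apply: special_swap12; apply: special_swap01;
    apply: special_swap23; apply: special_swap12].
  by apply: (special6a (g := h ^+ 5)) => //; rewrite ?e0 ?e1 ?e2 ?e3; [ring: h2..|lra].
- do [apply: special_swap23; apply: special_swap12; apply: special_swap01].
  by apply: (special6c (g := h)) => //; rewrite ?e0 ?e1 ?e2 ?e3; [ring: h2..|lra].
- do [apply: special_swap01; apply: special_swap23].
  by apply: (special6c (g := h ^+ 5)) => //; rewrite ?e0 ?e1 ?e2 ?e3; [ring: h2..|lra].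
Qed.

(** The traces of i h^k are rational multiples of the square root of 3, and again
    the equation is one rational linear relation. *)
Lemma special_imu6 (F : numFieldType) (h i : F) (t0 t1 t2 t3 : rat * F) :
  6.-primitive_root h -> i ^+ 2 = -1 -> config t0 t1 t2 t3 ->
  [/\ t0.2 ^+ 6 = -1, t1.2 ^+ 6 = -1, t2.2 ^+ 6 = -1 & t3.2 ^+ 6 = -1] ->
  special t0 t1 t2 t3.
Proof.
move=> ph i2 cfg [r0 r1 r2 r3].
have h2 := prim6_sqr ph.
have h0 : h != 0 by rewrite (prim_root_eq0 ph).
have hV : h^-1 = 1 - h by apply: (mulfI h0); rewrite mulfV //; ring: h2.
have i0 : i != 0 by apply: contra_eq_neq i2 => ->;
  rewrite expr0n eq_sym oppr_eq0 oner_eq0.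
have iV : i^-1 = - i by apply: (mulfI i0); rewrite mulfV //; ring: i2.
have s3 : i * (2 * h - 1) != 0.
  have: (i * (2 * h - 1)) ^+ 2 = 3 by ring: h2 i2.
  by apply: contra_eq_neq => ->; rewrite expr0n eq_sym pnatr_eq0.
have p5 : 6.-primitive_root (h ^+ 5) by rewrite prim_root_exp_coprime.
have tr k : (k < 6)%N ->
    trace (i * h ^+ k) = ratr (sin_pi3 k) * (i * (2 * h - 1)).
  rewrite /trace invfM -exprVn hV iV.
  by case: k => [|[|[|[|[|[|k]]]]]] // _;
    rewrite /sin_pi3 /= ?rmorphN ?rmorph_nat ?rmorph1 ?rmorph0; ring: h2.
have {}tr c k : (k < 6)%N ->
    ratr c * trace (i * h ^+ k) = ratr (c * sin_pi3 k) * (i * (2 * h - 1)).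
  by move=> k6; rewrite tr // (mulrA (ratr c)) -rmorphM.
have quot (w : F) : w ^+ 6 = -1 -> (w / i) ^+ 6 = 1.
  by move=> w6; rewrite exprMn w6 iV; ring: i2.
apply: (@special_of_coset6 _ h i 0 (fun _ _ _ _ => True)) => //;
  last by split; apply: quot.
  by rewrite muln0 expr0; ring: i2.
move=> {r0 r1 r2 r3} {}t0 {}t1 {}t2 {}t3 k0 k1 k2 k3 {}cfg _ srt [e0 e1 e2 e3].
have [gen _ _ rel] := cfg; have [_ sum0 _] := gen.
have /and5P [l01 l12 l23 l3 _] := srt.
have l2 := leq_ltn_trans l23 l3; have l1 := leq_ltn_trans l12 l2.
have l0 := leq_ltn_trans l01 l1.
rewrite e0 e1 e2 e3 !tr // -!mulrDl -!rmorphD /= in rel.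
have {}rel : t0.1 * sin_pi3 k0 + t1.1 * sin_pi3 k1 + t2.1 * sin_pi3 k2
    + t3.1 * sin_pi3 k3 = 0.
  move/eqP: rel; rewrite mulf_eq0 (negPf s3) orbF fmorph_eq0.
  by move/eqP.
have sum0F : ratr t0.1 + ratr t1.1 + ratr t2.1 + ratr t3.1 = 0 :> F.
  by have := congr1 (ratr : rat -> F) sum0; rewrite !rmorphD rmorph0.
have := sin_patterns gen srt rel; rewrite !inE.
have bal (w : F) : t0.2 = w -> t1.2 = w -> t2.2^-1 = w -> t3.2^-1 = w ->
    special t0 t1 t2 t3.
  move=> i0' i1 i2' i3; apply: special_of_inverted_pair => //.
  by rewrite i0' i1 i2' i3 -!mulrDl sum0F mul0r.
have inv k : (k <= 6)%N -> (i * h ^+ k)^-1 = - i * h ^+ (6 - k).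
  move=> k6; rewrite invfM iV -[(h ^+ k)^-1]mul1r -(prim_expr_order ph).
  by rewrite -{1}(subnK k6) exprD mulfK // expf_neq0.
do ?case/orP; move=> /eqP [? ? ? ?]; subst k0 k1 k2 k3;
  rewrite /sin_pi3 /= in rel.
- by apply: special_aligned; rewrite ?e0 ?e1 ?e2 ?e3 //; ring: i2.
- by apply: special_aligned; rewrite ?e0 ?e1 ?e2 ?e3 //; ring: i2 h2.
- by apply: (bal i); rewrite ?e0 ?e1 ?e2 ?e3 ?inv //; ring: h2.
- by apply: (bal (i * h)); rewrite ?e0 ?e1 ?e2 ?e3 ?inv //; ring: h2.
- by apply: (bal (i * h ^+ 4)); rewrite ?e0 ?e1 ?e2 ?e3 ?inv //; ring: h2.
- do [apply: special_swap12; apply: special_swap01; apply: special_swap23;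
    apply: special_swap12].
  apply: special_of_opposite_pair; rewrite ?e0 ?e1 ?e2 ?e3; [|lra|ring: h2 i2..].
  by do [apply: config_swap12; apply: config_swap23; apply: config_swap01;
    apply: config_swap12].
- do [apply: special_swap12; apply: special_swap01; apply: special_swap23;
    apply: special_swap12].
  apply: special_of_opposite_pair; rewrite ?e0 ?e1 ?e2 ?e3; [|lra|ring: h2 i2..].
  by do [apply: config_swap12; apply: config_swap23; apply: config_swap01;
    apply: config_swap12].
- do [apply: special_swap23; apply: special_swap12].
  apply: special_of_opposite_pair; rewrite ?e0 ?e1 ?e2 ?e3; [|lra|ring: h2 i2..].
  by do [apply: config_swap12; apply: config_swap23].
- do [apply: special_swap23; apply: special_swap12].
  apply: special_of_opposite_pair; rewrite ?e0 ?e1 ?e2 ?e3; [|lra|ring: h2 i2..].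
  by do [apply: config_swap12; apply: config_swap23].
- do [apply: special_swap23; apply: special_swap12; apply: special_swap01;
    apply: special_swap12; apply: special_swap23].
  by apply: (special6b (g := h ^+ 5)) => //; rewrite ?e0 ?e1 ?e2 ?e3;
    [ring: h2 i2..|lra].
- do [apply: special_swap01; apply: special_swap12; apply: special_swap23].
  by apply: (special6b (g := h)) => //; rewrite ?e0 ?e1 ?e2 ?e3; [ring: h2 i2..|lra].
- do [apply: special_swap12; apply: special_swap23].
  by apply: (special6b (g := h ^+ 5)) => //; rewrite ?e0 ?e1 ?e2 ?e3;
    [ring: h2 i2..|lra].
- do [apply: special_swap23; apply: special_swap12; apply: special_swap01].
  by apply: (special6b (g := h)) => //; rewrite ?e0 ?e1 ?e2 ?e3; [ring: h2 i2..|lra].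
Qed.

Lemma prim12_root (F : fieldType) (g : F) :
  g ^+ 6 = -1 -> g ^+ 4 != 1 -> (-1 : F) != 1 -> 12.-primitive_root g.
Proof.
move=> g6 g4 n1; have g12 : g ^+ 12 = 1 by ring: g6.
have [m pm m12] := prim_order_exists (isT : 0 < 12)%N g12.
have : ~~ (m %| 4)%N by rewrite (prim_order_dvd pm).
have : ~~ (m %| 6)%N by rewrite (prim_order_dvd pm) g6.
move: m12 pm; rewrite dvdn_divisors // => m12.
by move: m12; rewrite !inE => /or4P [||| /or3P []] /eqP ->.
Qed.

(** The square of zeta is a primitive fourth root of unity: this is the coset that
    produces the solutions of order 12 with exponents 1, 3, 5. *)
Lemma special_zeta8 (F : numFieldType) (h zeta : F) (t0 t1 t2 t3 : rat * F) :
  6.-primitive_root h -> zeta ^+ 4 = -1 -> config t0 t1 t2 t3 ->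
  ratr t0.1 * t0.2 + ratr t1.1 * t1.2 + ratr t2.1 * t2.2 + ratr t3.1 * t3.2 = 0 ->
  [/\ (t0.2 / zeta) ^+ 6 = 1, (t1.2 / zeta) ^+ 6 = 1,
      (t2.2 / zeta) ^+ 6 = 1 & (t3.2 / zeta) ^+ 6 = 1] ->
  special t0 t1 t2 t3.
Proof.
move=> ph z4 cfg rel6; have h2 := prim6_sqr ph.
have z0 : zeta != 0.
  by apply: contra_eq_neq z4 => ->; rewrite expr0n eq_sym oppr_eq0 oner_eq0.
have h_irr (q : rat) : h != ratr q.
  apply/eqP => hq; have : q ^+ 2 = q - 1.
    apply: (fmorph_inj (ratr : {rmorphism rat -> F})).
    by rewrite rmorphXn rmorphB rmorph1 /= -hq.
  by move=> q2; have := sqr_ge0 (2 * q - 1); rewrite (_ : _ ^+ 2 = -3) //; ring: q2.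
pose Q (t0 t1 t2 t3 : rat * F) := ratr t0.1 * t0.2 + ratr t1.1 * t1.2
   + ratr t2.1 * t2.2 + ratr t3.1 * t3.2 = 0.
apply: (@special_of_coset6 _ h zeta 3 Q) => //.
- by rewrite z4; ring: h2.
- by move=> s0 s1 s2 s3; rewrite /Q => <-; ring.
- by move=> s0 s1 s2 s3; rewrite /Q => <-; ring.
- by move=> s0 s1 s2 s3; rewrite /Q => <-; ring.
move=> {rel6} {}t0 {}t1 {}t2 {}t3 k0 k1 k2 k3 {}cfg;
  rewrite /Q => rel srt [e0 e1 e2 e3].
have [gen _ _ _] := cfg; have [_ sum0 _] := gen.
have /and5P [l01 l12 l23 l3 _] := srt.
have l2 := leq_ltn_trans l23 l3; have l1 := leq_ltn_trans l12 l2.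
have l0 := leq_ltn_trans l01 l1.
have hE k : (k < 6)%N -> h ^+ k = ratr (re_pi3 k) + ratr (im_pi3 k) * h.
  by case: k => [|[|[|[|[|[|k]]]]]] // _;
    rewrite /re_pi3 /im_pi3 /= ?rmorphN ?rmorph1 ?rmorph0; ring: h2.
pose re := t0.1 * re_pi3 k0 + t1.1 * re_pi3 k1 + t2.1 * re_pi3 k2 + t3.1 * re_pi3 k3.
pose im := t0.1 * im_pi3 k0 + t1.1 * im_pi3 k1 + t2.1 * im_pi3 k2 + t3.1 * im_pi3 k3.
have reim : ratr re + ratr im * h = 0.
  apply: (mulfI z0); rewrite mulr0 -rel e0 e1 e2 e3 !hE //.
  by rewrite /re /im !rmorphD !rmorphM /=; ring.
have im0 : im = 0.
  apply/eqP/negPn/negP => imn.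
  have imF : ratr im != 0 :> F by rewrite fmorph_eq0.
  have /eqP := h_irr (- re / im); apply; apply: (mulfI imF).
  rewrite rmorphM rmorphN fmorphV /= mulrCA mulfV // mulr1.
  by apply/eqP; rewrite -addr_eq0 addrC reim.
have re0 : re = 0.
  by move/eqP: reim; rewrite im0 rmorph0 mul0r addr0 fmorph_eq0 => /eqP.
have g12 : 12.-primitive_root (zeta ^+ 2 * h).
  apply: prim12_root; first by ring: h2 z4.
  have h4 : h ^+ 4 != 1 by rewrite -(prim_order_dvd ph).
  by apply: contra_neq h4 => <-; ring: z4.
  by rewrite eq_sym -subr_eq0 opprK -(natrD _ 1 1) pnatr_eq0.
have := pi3_patterns gen srt re0 im0; rewrite !inE.
do ?case/orP; move=> /eqP [? ? ? ?]; subst k0 k1 k2 k3;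
  rewrite /re /im /re_pi3 /im_pi3 /= in re0 im0.
- do [apply: special_swap01; apply: special_swap12; apply: special_swap01].
  by apply: (special12a (g := zeta ^+ 2 * h) (k := t2.1)) => //;
    rewrite ?e0 ?e1 ?e2 ?e3; [ring: h2 z4..|lra|lra|lra].
- do [apply: special_swap12; apply: special_swap23; apply: special_swap12].
  by apply: (special12a (g := zeta ^+ 2 * h) (k := t0.1)) => //;
    rewrite ?e0 ?e1 ?e2 ?e3; [ring: h2 z4..|lra|lra|lra].
Qed.

(** * Relations with three or four terms *)

(** A vanishing sum a + b u + c v is a triangle with sides |a|, |b|, |c|, and
    trace u is twice the cosine of one of its exterior angles. *)
Lemma law_of_cosines (F : numFieldType) (a b c : rat) (u v : F) :
  a != 0 -> b != 0 -> u != 0 -> v != 0 ->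
  ratr a + ratr b * u + ratr c * v = 0 ->
  ratr a + ratr b * u^-1 + ratr c * v^-1 = 0 ->
  trace u = ratr ((c ^+ 2 - a ^+ 2 - b ^+ 2) / (a * b)).
Proof.
move=> a0 b0 u0 v0 rel rel'.
have aF : ratr a != 0 :> F by rewrite fmorph_eq0.
have bF : ratr b != 0 :> F by rewrite fmorph_eq0.
have cE : ratr c ^+ 2 = (ratr a + ratr b * u) * (ratr a + ratr b * u^-1).
  move/eqP: rel; rewrite addr_eq0 => /eqP ->.
  move/eqP: rel'; rewrite addr_eq0 => /eqP ->.
  by field; rewrite v0.
rewrite fmorph_div rmorphM !rmorphB !rmorphXn /= cE /trace.
by field; rewrite aF bF u0.
Qed.

(** The three linear equations are the projections of the triangle onto its sides;
    q, r, s stand for twice the cosines. *)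
Lemma angles_of_rational_triangle (a b c q r s : rat) : a != 0 ->
  [|| q == 0, q == 1 | q == -1] -> [|| r == 0, r == 1 | r == -1] ->
  [|| s == 0, s == 1 | s == -1] ->
  2 * a + b * q + c * r = 0 -> 2 * b + a * q + c * s = 0 ->
  2 * c + a * r + b * s = 0 ->
  [/\ b = - q * a, c = - r * a, q ^+ 2 = 1 & r ^+ 2 = 1].
Proof.
move=> a0; case/or3P => /eqP ->; case/or3P => /eqP ->; case/or3P => /eqP -> e1 e2 e3.
all: first [by case/eqP: a0; lra | by split; lra].
Qed.

(** By the law of cosines the three angles have rational cosine, so each trace is
    0, 1, -1, 2 or -2.  A flat triangle gives signs; otherwise a linear system
    for the sides leaves the equilateral triangle only. *)
Lemma three_term_relation (F : numFieldType) (m : nat) (g : F)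
    (a b c : rat) (u v : F) :
  m.-primitive_root g -> a != 0 -> b != 0 -> c != 0 ->
  u ^+ m = 1 -> v ^+ m = 1 -> ratr a + ratr b * u + ratr c * v = 0 ->
  [/\ u ^+ 6 = 1, v ^+ 6 = 1, (u * v) ^+ 2 = 1
    & (u ^+ 2 = 1 /\ v ^+ 2 = 1) \/ (b ^+ 2 = a ^+ 2 /\ c ^+ 2 = a ^+ 2)].
Proof.
move=> pg a0 b0 c0 um vm rel.
have m0 := prim_order_gt0 pg.
have u0 := unity_neq0 m0 um; have v0 := unity_neq0 m0 vm.
have rel' : ratr a + ratr b * u^-1 + ratr c * v^-1 = 0.
  have := @unity_relation_inv _ m g [:: (a, 1); (b, u); (c, v)] pg.
  rewrite !big_cons !big_nil /= invr1 !mulr1 !addr0 !addrA; apply=> // t.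
  by rewrite !inE => /or3P [] /eqP -> //=; rewrite expr1n.
set q := (c ^+ 2 - a ^+ 2 - b ^+ 2) / (a * b).
have qE : trace u = ratr q := law_of_cosines a0 b0 u0 v0 rel rel'.
set r := (b ^+ 2 - a ^+ 2 - c ^+ 2) / (a * c).
have rE : trace v = ratr r.
  by apply: law_of_cosines v0 u0 _ _ => //; rewrite addrAC.
set s := (a ^+ 2 - c ^+ 2 - b ^+ 2) / (c * b).
have sE : trace (u / v) = ratr s.
  apply: (@law_of_cosines _ _ _ _ _ v^-1) => //.
  - exact: mulf_neq0 u0 (invr_neq0 v0).
  - exact: invr_neq0 v0.
  - by apply: (mulIf v0); rewrite mul0r -rel; field; rewrite v0.
  - by apply: (mulIf (invr_neq0 v0)); rewrite mul0r -rel'; field; rewrite u0 v0.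
have uvm : (u / v) ^+ m = 1 by rewrite exprMn exprVn um vm divr1.
have qs := rational_trace m0 um qE; have rs := rational_trace m0 vm rE.
have ss := rational_trace m0 uvm sE.
have l1 : 2 * a + b * q + c * r = 0 by rewrite /q /r; field; rewrite a0 b0 c0.
have l2 : 2 * b + a * q + c * s = 0 by rewrite /q /s; field; rewrite a0 b0 c0.
have l3 : 2 * c + a * r + b * s = 0 by rewrite /r /s; field; rewrite a0 b0 c0.
have cF : ratr c != 0 :> F by rewrite fmorph_eq0.
have bF : ratr b != 0 :> F by rewrite fmorph_eq0.
have aF : ratr a != 0 :> F by rewrite fmorph_eq0.
have sqV (w : F) : w != 0 -> w = w^-1 -> w ^+ 2 = 1.
  by move=> w0 wV; rewrite expr2 {2}wV mulfV.
have sqE (w : F) : w != 0 -> w ^+ 2 = 1 -> w^-1 = w.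
  by move=> w0 w2; apply: (mulfI w0); rewrite mulfV // -expr2.
have real : u ^+ 2 = 1 -> v ^+ 2 = 1 -> [/\ u ^+ 6 = 1, v ^+ 6 = 1,
    (u * v) ^+ 2 = 1
    & (u ^+ 2 = 1 /\ v ^+ 2 = 1) \/ (b ^+ 2 = a ^+ 2 /\ c ^+ 2 = a ^+ 2)].
  by move=> u2 v2; split; [ring: u2|ring: v2|ring: u2 v2|left].
have tr2 (w : F) (k : rat) : w != 0 -> k ^+ 2 = 4 -> trace w = ratr k ->
    w ^+ 2 = 1.
  move=> w0 k4 wk; have k4F : (ratr k) ^+ 2 = 4 :> F.
    by rewrite -rmorphXn k4 rmorph_nat.
  have : (w - w^-1) ^+ 2 = 0.
    have -> : (w - w^-1) ^+ 2 = trace w ^+ 2 - 4 by rewrite /trace; field.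
    by rewrite wk k4F subrr.
  by move/eqP; rewrite expf_eq0 /= subr_eq0 => /eqP; apply: sqV.
have u_real : u ^+ 2 = 1 -> v ^+ 2 = 1.
  move=> u2; apply: sqV => //; apply: (mulfI cF).
  by apply: (addrI (ratr a + ratr b * u)); rewrite rel -{1}(sqE u).
have v_real : v ^+ 2 = 1 -> u ^+ 2 = 1.
  move=> v2; apply: sqV => //; apply: (mulfI bF).
  by apply: (addrI (ratr a)); apply: (addIr (ratr c * v)); rewrite rel -{1}(sqE v).
have w_real : (u / v) ^+ 2 = 1 -> v ^+ 2 = 1.
  move=> w2; have wV := sqE _ (mulf_neq0 u0 (invr_neq0 v0)) w2.
  apply: sqV => //; apply: (mulfI aF).
  have e1 : ratr a * v^-1 = - (ratr b * (u / v) + ratr c).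
    apply: (mulIf v0); apply/eqP; rewrite -subr_eq0 -rel; apply/eqP; field.
    by rewrite v0.
  have e2 : ratr a * v = - (ratr b * (u / v)^-1 + ratr c).
    apply: (mulIf (invr_neq0 v0)); apply/eqP; rewrite -subr_eq0 -rel'.
    by apply/eqP; field; rewrite v0 u0.
  by rewrite e1 e2 wV.
have [/eqP q2|qn] := boolP (q ^+ 2 == 4).
  by have u2 := tr2 _ _ u0 q2 qE; apply: real (u_real u2).
have [/eqP r2|rn] := boolP (r ^+ 2 == 4).
  by have v2 := tr2 _ _ v0 r2 rE; apply: real => //; apply: v_real.
have [/eqP s2|sn] := boolP (s ^+ 2 == 4).
  have v2 := w_real (tr2 _ _ (mulf_neq0 u0 (invr_neq0 v0)) s2 sE).
  by apply: real => //; apply: v_real.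
have relU (w : F) (k : rat) : w != 0 -> trace w = ratr k -> w ^+ 2 = ratr k * w - 1.
  by move=> w0 <-; rewrite /trace; field.
have uR := relU _ _ u0 qE; have vR := relU _ _ v0 rE.
clearbody q r s.
have small (k : rat) : k \in [:: 0; 1; -1; 2; -2] -> k ^+ 2 != 4 ->
    [|| k == 0, k == 1 | k == -1].
  by rewrite !inE => /or4P [->|->|->|/orP [] /eqP ->]; rewrite ?orbT.
have [bq cr q2 r2] : [/\ b = - q * a, c = - r * a, q ^+ 2 = 1 & r ^+ 2 = 1].
  by apply: (angles_of_rational_triangle a0) (small _ qs qn) (small _ rs rn)
    (small _ ss sn) l1 l2 l3.
have qF : (ratr q) ^+ 2 = 1 :> F by rewrite -rmorphXn q2 rmorph1.
have rF : (ratr r) ^+ 2 = 1 :> F by rewrite -rmorphXn r2 rmorph1.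
have uvE : u * v = ratr q * ratr r.
  have e : ratr r * v = 1 - ratr q * u.
    apply: (mulfI aF); move: rel; rewrite bq cr !rmorphM !rmorphN /= => rel.
    apply/eqP; rewrite -subr_eq0; apply/eqP.
    by rewrite -[RHS]oppr0 -[in RHS]rel; ring.
  transitivity (ratr q ^+ 2 * ratr r * u * (ratr r * v)); first by ring: qF rF.
  by rewrite e; ring: uR qF.
split; [ring: uR qF|ring: vR rF|rewrite uvE; ring: qF rF|right].
by rewrite bq cr; split; ring: q2 r2.
Qed.

(** If every prime factor of N divides L then 1 + L is prime to N, so w -> w^(1+L)
    is a conjugation; it multiplies w by the root of unity w^L. *)
Lemma unity_relation_shift (F : numFieldType) (N L e : nat) (g : F)
    (s : seq (rat * F)) :
  N.-primitive_root g -> (N %| L ^ e)%N -> (forall t, t \in s -> t.2 ^+ N = 1) ->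
  \sum_(t <- s) ratr t.1 * t.2 = 0 ->
  \sum_(t <- s) ratr t.1 * (t.2 * t.2 ^+ L) = 0.
Proof.
move=> pg NL unit rel.
have co : coprime L.+1 N.
  by apply: coprime_dvdr NL _; apply: coprimeXr; rewrite coprimeSn.
have := unity_relation_pow pg co unit rel.
by under eq_bigr => t _ do rewrite exprS.
Qed.

Lemma sum4 (F : numFieldType) (k0 k1 k2 k3 : rat) (u0 u1 u2 u3 : F)
    (f : F -> F) :
  \sum_(t <- [:: (k0, u0); (k1, u1); (k2, u2); (k3, u3)]) ratr t.1 * f t.2
  = ratr k0 * f u0 + ratr k1 * f u1 + ratr k2 * f u2 + ratr k3 * f u3.
Proof. by rewrite !big_cons big_nil /= addr0 !addrA. Qed.

(** Half the sum and half the difference of the two relations are the subsums over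
    the terms of either sign.  A subsum with a single term cannot vanish. *)
Lemma signed_sums (F : numFieldType) (a0 a1 a2 a3 e0 e1 e2 e3 : F) :
  [/\ a0 != 0, a1 != 0, a2 != 0 & a3 != 0] ->
  [/\ e0 ^+ 2 = 1, e1 ^+ 2 = 1, e2 ^+ 2 = 1 & e3 ^+ 2 = 1] ->
  a0 + a1 + a2 + a3 = 0 -> a0 * e0 + a1 * e1 + a2 * e2 + a3 * e3 = 0 ->
  [\/ [/\ e1 = e0, e2 = e0 & e3 = e0], a0 + a1 = 0 /\ a2 + a3 = 0,
      a0 + a2 = 0 /\ a1 + a3 = 0 | a0 + a3 = 0 /\ a1 + a2 = 0].
Proof.
move=> [/eqP n0 /eqP n1 /eqP n2 /eqP n3] [q0 q1 q2 q3] sum0 rel.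
have half (x y : F) : x + y = a0 + a1 + a2 + a3 ->
    e0 * (x - y) = a0 * e0 + a1 * e1 + a2 * e2 + a3 * e3 -> x = 0 /\ y = 0.
  rewrite sum0 rel => e /eqP; have e0n : e0 != 0 by apply: (@unity_neq0 _ 2).
  rewrite mulf_eq0 (negPf e0n) subr_eq0 /= => /eqP xy.
  move: e; rewrite xy -mulr2n => /eqP; rewrite mulrn_eq0 => /eqP.
  by [].
have sgn e : e ^+ 2 = 1 -> e = e0 \/ e = - e0.
  by rewrite -q0 => /eqP; rewrite eqf_sqr => /orP [] /eqP; [left|right].
case: (sgn _ q1) => e1E; case: (sgn _ q2) => e2E; case: (sgn _ q3) => e3E;
  rewrite {}e1E {}e2E {}e3E in rel half *.
- by constructor 1.
- by case: (half (a0 + a1 + a2) a3); [ring | ring | move=> _ /n3].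
- by case: (half (a0 + a1 + a3) a2); [ring | ring | move=> _ /n2].
- by constructor 2; apply: half; ring.
- by case: (half (a0 + a2 + a3) a1); [ring | ring | move=> _ /n1].
- by constructor 3; apply: half; ring.
- by constructor 4; apply: half; ring.
- by case: (half a0 (a1 + a2 + a3)); [ring | ring | move=> /n0].
Qed.

(** For N divisible by 4, conjugation by 1 + N/2 multiplies each term by a sign.
    Either the signs separate the relation into two pairs, or they agree, and the
    ratios of the terms are roots of unity of half the order; the descent stops at
    order 6. *)
Lemma four_term_relation (F : numFieldType) (zeta : nat -> F) (j : nat)
    (k0 k1 k2 k3 : rat) (u0 u1 u2 u3 : F) :
  (forall m, (0 < m)%N -> m.-primitive_root (zeta m)) ->
  [&& k0 != 0, k1 != 0, k2 != 0 & k3 != 0] ->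
  let N := (2 ^ j * 3)%N in
  [/\ u0 ^+ N = 1, u1 ^+ N = 1, u2 ^+ N = 1 & u3 ^+ N = 1] ->
  ratr k0 * u0 + ratr k1 * u1 + ratr k2 * u2 + ratr k3 * u3 = 0 ->
  [\/ ratr k0 * u0 + ratr k1 * u1 = 0 /\ ratr k2 * u2 + ratr k3 * u3 = 0,
      ratr k0 * u0 + ratr k2 * u2 = 0 /\ ratr k1 * u1 + ratr k3 * u3 = 0,
      ratr k0 * u0 + ratr k3 * u3 = 0 /\ ratr k1 * u1 + ratr k2 * u2 = 0
    | [/\ (u1 / u0) ^+ 6 = 1, (u2 / u0) ^+ 6 = 1 & (u3 / u0) ^+ 6 = 1]].
Proof.
move=> hz kn; elim: j u0 u1 u2 u3 => [|j IH] u0 u1 u2 u3 N [r0 r1 r2 r3] rel.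
  have p6 (u : F) : u ^+ N = 1 -> u ^+ 6 = 1.
    by rewrite /N mul1n => u3'; ring: u3'.
  by constructor 4; rewrite !exprMn !exprVn !p6 // !divr1.
have N0 : (0 < N)%N by rewrite muln_gt0 expn_gt0.
have [n0 n1 n2 n3] : [/\ u0 != 0, u1 != 0, u2 != 0 & u3 != 0].
  by split; apply: unity_neq0 N0 _.
have NE : N = (2 ^ j.+1 * 3)%N by [].
clearbody N; case: j IH NE => [|j] IH NE.
  have e6 : 6%N = N by rewrite NE expn1.
  by constructor 4; rewrite e6 !exprMn !exprVn r0 r1 r2 r3 !divr1.
pose M := (2 ^ j.+1 * 3)%N.
have NM : N = (2 * M)%N by rewrite NE expnS -mulnA.
have NdvdM : (N %| M ^ 2)%N.
  by rewrite NM -mulnn dvdn_mul // /M expnS -mulnA dvdn_mulr.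
have unit t : t \in [:: (k0, u0); (k1, u1); (k2, u2); (k3, u3)] -> t.2 ^+ N = 1.
  by rewrite !inE => /or4P [] /eqP ->.
have rel' := unity_relation_shift (hz _ N0) NdvdM unit.
rewrite (sum4 _ _ _ _ _ _ _ _ id) (sum4 _ _ _ _ _ _ _ _ (fun u => u * u ^+ M)) in rel'.
have {}rel' := rel' rel.
have same : u1 ^+ M = u0 ^+ M -> u2 ^+ M = u0 ^+ M -> u3 ^+ M = u0 ^+ M ->
  [\/ ratr k0 * u0 + ratr k1 * u1 = 0 /\ ratr k2 * u2 + ratr k3 * u3 = 0,
      ratr k0 * u0 + ratr k2 * u2 = 0 /\ ratr k1 * u1 + ratr k3 * u3 = 0,
      ratr k0 * u0 + ratr k3 * u3 = 0 /\ ratr k1 * u1 + ratr k2 * u2 = 0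
    | [/\ (u1 / u0) ^+ 6 = 1, (u2 / u0) ^+ 6 = 1 & (u3 / u0) ^+ 6 = 1]].
  move=> e1 e2 e3; have u0M : u0 ^+ M != 0 by rewrite expf_neq0.
  have mulu0 (k l : rat) (u v : F) :
      ratr k * (u / u0) + ratr l * (v / u0) = 0 -> ratr k * u + ratr l * v = 0.
    by move=> e; apply: (mulIf (invr_neq0 n0)); rewrite mul0r -e; ring.
  have := IH (u0 / u0) (u1 / u0) (u2 / u0) (u3 / u0).
  case.
  - by rewrite -/M !exprMn !exprVn e1 e2 e3 mulfV.
  - by apply: (mulIf n0); rewrite mul0r -rel; field; rewrite n0.
  - by case=> /mulu0 ? /mulu0 ?; constructor 1.
  - by case=> /mulu0 ? /mulu0 ?; constructor 2.
  - by case=> /mulu0 ? /mulu0 ?; constructor 3.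
  - by rewrite !divff // !divr1; constructor 4.
have nzk (k : rat) (u : F) : k != 0 -> u != 0 -> ratr k * u != 0.
  by move=> kk uu; rewrite mulf_neq0 // fmorph_eq0.
have /and4P [m0 m1 m2 m3] := kn.
have sq (u : F) : u ^+ N = 1 -> (u ^+ M) ^+ 2 = 1 by rewrite -exprM mulnC -NM.
rewrite !mulrA in rel'.
have [] := signed_sums _ _ rel rel'.
- by split; apply: nzk.
- by split; apply: sq.
- by case; exact: same.
- by constructor 1.
- by constructor 2.
- by constructor 3.
Qed.

(** The four terms c u, c/u, d v, d/v are an instance of four_term_relation.  The
    pairings give the first two cases; otherwise u and v lie in the twelfth roots
    of unity, on which the square of the trace takes the values 0, 1, 3, 4 only. *)
Lemma two_trace_relation (F : numFieldType) (zeta : nat -> F) (j : nat)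
    (c d : rat) (u v : F) :
  (forall m, (0 < m)%N -> m.-primitive_root (zeta m)) ->
  c != 0 -> d != 0 -> c + d != 0 ->
  u ^+ (2 ^ j * 3) = 1 -> v ^+ (2 ^ j * 3) = 1 ->
  ratr c * trace u + ratr d * trace v = 0 ->
  [\/ u ^+ 2 = -1 /\ v ^+ 2 = -1,
      c = d /\ (v = - u \/ u * v = -1),
      u ^+ 2 = 1 /\ exists2 q : rat, q ^+ 2 = 1 & v ^+ 2 = ratr q * v - 1
    | v ^+ 2 = 1 /\ exists2 q : rat, q ^+ 2 = 1 & u ^+ 2 = ratr q * u - 1].
Proof.
move=> hz c0 d0 cd0 uN vN rel.
have N0 : (0 < 2 ^ j * 3)%N by rewrite muln_gt0 expn_gt0.
have u0 := unity_neq0 N0 uN; have v0 := unity_neq0 N0 vN.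
have cF : ratr c != 0 :> F by rewrite fmorph_eq0.
have dF : ratr d != 0 :> F by rewrite fmorph_eq0.
have sq_eq : c ^+ 2 = d ^+ 2 -> c = d.
  by move/eqP; rewrite eqf_sqr -[c == - d]addr_eq0 (negPf cd0) orbF => /eqP.
(* trace v = - trace u says that v is a root of (X + u)(X + 1/u) *)
have opp : c = d -> v = - u \/ u * v = -1.
  move=> cd; move: rel; rewrite cd -mulrDr => /eqP.
  rewrite mulf_eq0 (negPf dF) /= => /eqP tr0.
  have /eqP : (v + u) * (u * v + 1) = 0.
    by transitivity (u * v * (trace u + trace v));
      [rewrite /trace; field; rewrite u0 v0|rewrite tr0 mulr0].
  by rewrite mulf_eq0 !addr_eq0 => /orP [] /eqP; [left|right].
have sgnF (k : F) (e : rat) : e ^+ 2 = 1 -> (ratr e : F) ^+ 2 = 1.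
  by move=> e2; rewrite -rmorphXn e2 rmorph1.
have sq_eqF : (ratr c : F) ^+ 2 = (ratr d) ^+ 2 -> c = d.
  rewrite -!rmorphXn /= => /fmorph_inj; exact: sq_eq.
have tr_sq (w : F) : w != 0 -> trace w ^+ 2 = w ^+ 2 + w ^- 2 + 2.
  by move=> w0; rewrite /trace; field.
have isZ (w : F) : w != 0 -> trace w = 0 -> w ^+ 2 = -1.
  move=> w0 tr0; apply/eqP; rewrite -addr_eq0 -(mulr0 w) -tr0 /trace.
  by apply/eqP; field.
have trZ (w : F) : w != 0 -> w ^+ 2 = -1 -> trace w = 0.
  move=> w0 w2; apply: (mulfI w0); rewrite mulr0 /trace mulrDr mulfV //.
  by rewrite -expr2 w2 addNr.
have kn : [&& c != 0, c != 0, d != 0 & d != 0] by rewrite c0 d0.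
have rel4 : ratr c * u + ratr c * u^-1 + ratr d * v + ratr d * v^-1 = 0.
  by rewrite -rel /trace; ring.
have rN : [/\ u ^+ (2 ^ j * 3) = 1, u^-1 ^+ (2 ^ j * 3) = 1,
  v ^+ (2 ^ j * 3) = 1 & v^-1 ^+ (2 ^ j * 3) = 1].
  by rewrite !exprVn uN vN invr1.
case: (four_term_relation hz kn rN rel4).
- rewrite -!mulrDr => -[/eqP e1 /eqP e2]; constructor 1; split; apply: isZ => //.
    by move: e1; rewrite mulf_eq0 (negPf cF) => /eqP.
  by move: e2; rewrite mulf_eq0 (negPf dF) => /eqP.
- move=> [e1 e2]; constructor 2; suff cd : c = d by split=> //; apply: opp.
  apply: sq_eqF; transitivity ((ratr c * u) * (ratr c * u^-1)).
    by field.
  move/eqP: e1; rewrite addr_eq0 => /eqP ->.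
  by move/eqP: e2; rewrite addr_eq0 => /eqP ->; field.
- move=> [e1 e2]; constructor 2; suff cd : c = d by split=> //; apply: opp.
  apply: sq_eqF; transitivity ((ratr c * u) * (ratr c * u^-1)).
    by field.
  move/eqP: e1; rewrite addr_eq0 => /eqP ->.
  by move/eqP: e2; rewrite addr_eq0 => /eqP ->; field.
case=> e12 vu6 _.
have u12 : u ^+ 12 = 1.
  have : u ^+ 12 * (u^-1 / u) ^+ 6 = 1 by field.
  by rewrite e12 mulr1.
have vu : v ^+ 6 = u ^+ 6.
  have u60 : u ^+ 6 != 0 by rewrite expf_neq0.
  by move: vu6; rewrite exprMn exprVn => /(congr1 (fun x => x * u ^+ 6));
    rewrite mulfVK // mul1r.
have /eqP : (u ^+ 6) ^+ 2 = 1 by rewrite -exprM.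
rewrite sqrf_eq1 => /orP [] /eqP u6; rewrite u6 in vu.
- have cases6 (w : F) : w ^+ 6 = 1 -> w ^+ 2 = 1 \/
      exists2 q : rat, q ^+ 2 = 1 & w ^+ 2 = ratr q * w - 1.
    move=> w6; have /eqP : (w ^+ 2 - 1) * ((w ^+ 2 - (w - 1)) * (w ^+ 2 - (- w - 1))) = 0.
      by ring: w6.
    rewrite !mulf_eq0 !subr_eq0 => /or3P [] /eqP e; [by left|right..].
      by exists 1; rewrite ?expr1n // rmorph1 mul1r.
    by exists (-1); rewrite ?sqrrN ?expr1n // rmorphN rmorph1 mulN1r.
  have tr1 (w : F) : w != 0 -> w ^+ 2 = 1 -> trace w = 2 * w.
    by move=> w0 w2; apply: (mulfI w0); rewrite /trace mulrDr mulfV //; ring: w2.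
  have trq (w q : F) : w != 0 -> w ^+ 2 = q * w - 1 -> trace w = q.
    move=> w0 w2; apply: (mulfI w0); rewrite /trace mulrDr mulfV //.
    by rewrite -expr2 w2; ring.
  have two0 : (2 : F) != 0 by rewrite pnatr_eq0.
  case: (cases6 _ u6) => [u2|[q q2 uq]]; case: (cases6 _ vu) => [v2|[r r2 vr]].
  + constructor 2; suff cd : c = d by split=> //; apply: opp.
    apply: sq_eqF; move: rel; rewrite !tr1 // => /eqP.
    rewrite addr_eq0 => /eqP e; apply: (mulfI (expf_neq0 2 two0)).
    by transitivity ((ratr c * (2 * u)) ^+ 2); [ring: u2|rewrite e; ring: v2].
  + by constructor 3; split=> //; exists r.
  + by constructor 4; split=> //; exists q.
  + constructor 2; suff cd : c = d by split=> //; apply: opp.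
    move: rel; rewrite (trq _ _ u0 uq) (trq _ _ v0 vr) -!rmorphM -rmorphD => /eqP.
    rewrite fmorph_eq0 addr_eq0 => /eqP e; apply: sq_eq.
    by transitivity ((c * q) ^+ 2); [ring: q2|rewrite e; ring: r2].
have cases12 (w : F) : w != 0 -> w ^+ 6 = -1 -> w ^+ 2 = -1 \/ trace w ^+ 2 = 3.
  move=> w0 w6; have /eqP : (w ^+ 2 + 1) * (w ^+ 4 - w ^+ 2 + 1) = 0 by ring: w6.
  rewrite mulf_eq0 addr_eq0 => /orP [] /eqP e; [by left|right].
  rewrite tr_sq //; apply/eqP; rewrite -subr_eq0.
  rewrite (_ : _ - 3 = w ^- 2 * (w ^+ 4 - w ^+ 2 + 1)); last by field.
  by rewrite e mulr0.
have three0 : (3 : F) != 0 by rewrite pnatr_eq0.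
case: (cases12 _ u0 u6) => [u2|u3]; case: (cases12 _ v0 vu) => [v2|v3].
- by constructor 1.
- constructor 1; split=> //; apply: isZ => //; move/eqP: rel.
  by rewrite trZ // mulr0 add0r mulf_eq0 (negPf dF) => /eqP.
- constructor 1; split=> //; apply: isZ => //; move/eqP: rel.
  by rewrite (trZ v) // mulr0 addr0 mulf_eq0 (negPf cF) => /eqP.
constructor 2; suff cd : c = d by split=> //; apply: opp.
apply: sq_eqF; move/eqP: rel; rewrite addr_eq0 => /eqP.
move=> e; apply: (mulfI three0).
by transitivity ((ratr c * trace u) ^+ 2); [ring: u3|rewrite e; ring: v3].
Qed.

(** * Orders without a prime factor greater than 3 *)

Lemma config_pow (F : numFieldType) (N k : nat) (g : F) (t0 t1 t2 t3 : rat * F) :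
  N.-primitive_root g -> coprime k N -> config t0 t1 t2 t3 ->
  [/\ t0.2 ^+ N = 1, t1.2 ^+ N = 1, t2.2 ^+ N = 1 & t3.2 ^+ N = 1] ->
  config (t0.1, t0.2 ^+ k) (t1.1, t1.2 ^+ k) (t2.1, t2.2 ^+ k) (t3.1, t3.2 ^+ k).
Proof.
move=> pg co [gen _ pr rel] [r0 r1 r2 r3]; split=> //=.
- exists N; first exact: prim_order_gt0 pg.
  by split; rewrite exprAC (r0, r1, r2, r3) expr1n.
- by rewrite -!exprMn pr expr1n.
pose s := [:: t0; t1; t2; t3; (t0.1, t0.2^-1); (t1.1, t1.2^-1);
  (t2.1, t2.2^-1); (t3.1, t3.2^-1)].
have unit t : t \in s -> t.2 ^+ N = 1.
  rewrite !inE; do 7?[case/orP]; move=> /eqP -> //=;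
  by rewrite exprVn (r0, r1, r2, r3) invr1.
have rel8 : \sum_(t <- s) ratr t.1 * t.2 = 0.
  by rewrite !big_cons big_nil /= addr0 -rel /trace; ring.
have := unity_relation_pow pg co unit rel8.
by rewrite !big_cons big_nil /= !exprVn addr0 => <-; rewrite /trace; ring.
Qed.

Lemma config_shift (F : numFieldType) (N L e : nat) (g : F)
    (t0 t1 t2 t3 : rat * F) :
  N.-primitive_root g -> (N %| L ^ e)%N -> config t0 t1 t2 t3 ->
  [/\ t0.2 ^+ N = 1, t1.2 ^+ N = 1, t2.2 ^+ N = 1 & t3.2 ^+ N = 1] ->
  config (t0.1, t0.2 ^+ L.+1) (t1.1, t1.2 ^+ L.+1)
         (t2.1, t2.2 ^+ L.+1) (t3.1, t3.2 ^+ L.+1).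
Proof.
move=> pg NL; apply: config_pow pg _.
by apply: coprime_dvdr NL _; apply: coprimeXr; rewrite coprimeSn.
Qed.

Section Pairs.

Variables (F : numFieldType) (h i : F).
Hypotheses (ph : 6.-primitive_root h) (i2 : i ^+ 2 = -1).
Implicit Types t : rat * F.

Lemma cube_sqrN1 (w : F) : w ^+ 2 = -1 -> w ^+ 6 = -1.
Proof. by move=> w2; ring: w2. Qed.

Lemma special_zero_opposite t0 t1 t2 t3 : config t0 t1 t2 t3 ->
  t0.2 ^+ 2 = -1 -> t1.2 ^+ 2 = -1 ->
  t2.1 = t3.1 -> t3.2 = - t2.2 \/ t2.2 * t3.2 = -1 -> special t0 t1 t2 t3.
Proof.
move=> cfg w0 w1 c23 e.
have opp : t2.2 * t3.2 = -1 -> special t0 t1 t2 t3.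
  move=> w23; do [apply: special_swap12; apply: special_swap01;
    apply: special_swap23; apply: special_swap12].
  apply: special_of_opposite_pair => //.
  by do [apply: config_swap12; apply: config_swap23; apply: config_swap01;
    apply: config_swap12].
case: e => [w3|]; last exact: opp.
have [_ _ pr _] := cfg.
have /eqP : (t2.2 ^+ 2) ^+ 2 = 1.
  have : (t0.2 * t1.2 * t2.2 * t3.2) ^+ 2 = 1 by rewrite pr expr1n.
  by rewrite w3 => <-; ring: w0 w1.
rewrite sqrf_eq1 => /orP [] /eqP w2.
  by apply: opp; rewrite w3; ring: w2.
apply: (special_imu6 ph i2 cfg); split; apply: cube_sqrN1 => //.
by rewrite w3 sqrrN.
Qed.

(** The product of the four points being 1, the last point would be both real and
    of order 3 or 6. *)
Lemma zero_real_contra t0 t1 t2 t3 (q : rat) : config t0 t1 t2 t3 ->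
  (t0.2 * t1.2) ^+ 2 = 1 -> t2.2 ^+ 2 = 1 -> q ^+ 2 = 1 ->
  t3.2 ^+ 2 = ratr q * t3.2 - 1 -> False.
Proof.
move=> [_ _ pr _] w01 w2 q2 w3.
have qF : (ratr q : F) ^+ 2 = 1 by rewrite -rmorphXn q2 rmorph1.
have e : t3.2 ^+ 2 = 1.
  have : (t0.2 * t1.2 * t2.2 * t3.2) ^+ 2 = 1 by rewrite pr expr1n.
  by rewrite exprMn -mulrA => <-; ring: w01 w2.
have e2 : ratr q * t3.2 = 2 by rewrite -[LHS](subrK 1) -w3 e.
have /eqP : (3 : F) = 0.
  have : (ratr q * t3.2) ^+ 2 = 4 by rewrite e2; ring.
  rewrite exprMn qF e mulr1 => e4.
  by transitivity (4 - 1 : F); [ring | rewrite -e4 subrr].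
by rewrite pnatr_eq0.
Qed.

(** The trace relation gives t3.1 = 2 t2.1 or t3.1 = -2 t2.1, and the product
    of the points gives the sixth power of w0.  One sign puts all points among the
    sixth roots of unity; the other is the solution of order 12 with exponents
    1, 4, 5. *)
Lemma special_opposite_real t0 t1 t2 t3 (q : rat) : config t0 t1 t2 t3 ->
  ratr t2.1 * trace t2.2 + ratr t3.1 * trace t3.2 = 0 ->
  t0.1 = t1.1 -> t1.2 = - t0.2 \/ t0.2 * t1.2 = -1 ->
  t2.2 ^+ 2 = 1 -> q ^+ 2 = 1 -> t3.2 ^+ 2 = ratr q * t3.2 - 1 ->
  special t0 t1 t2 t3.
Proof.
move=> cfg rel c01 e w2 q2 w3.
case: e => [w1|w01]; last first.
  by case: (zero_real_contra cfg _ w2 q2 w3); rewrite w01 sqrrN expr1n.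
have [[/and4P [c0n c1n c2n c3n] sum0 _] _ pr _] := cfg.
have [w0n w1n w2n w3n] := config_neq0 cfg.
have qF : (ratr q : F) ^+ 2 = 1 by rewrite -rmorphXn q2 rmorph1.
have [e e2 w2E] : exists2 e : rat, e ^+ 2 = 1 & t2.2 = ratr e.
  move/eqP: w2; rewrite sqrf_eq1 => /orP [] /eqP ->.
    by exists 1; rewrite ?expr1n ?rmorph1.
  by exists (-1); rewrite ?sqrrN ?expr1n ?rmorphN ?rmorph1.
have eF : (ratr e : F) ^+ 2 = 1 by rewrite -rmorphXn e2 rmorph1.
have c3 : t3.1 = - 2 * e * q * t2.1.
  have tr2 : trace t2.2 = 2 * ratr e.
    by apply: (mulfI w2n); rewrite /trace mulrDr mulfV // w2E; ring: eF.
  have tr3 : trace t3.2 = ratr q.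
    by apply: (mulfI w3n); rewrite /trace mulrDr mulfV // -expr2 w3; ring.
  apply: (fmorph_inj (ratr : {rmorphism rat -> F})); apply/eqP; rewrite -subr_eq0.
  rewrite !rmorphM rmorphN rmorph_nat /=.
  have -> : ratr t3.1 - - 2 * ratr e * ratr q * ratr t2.1
      = ratr q * (ratr t2.1 * trace t2.2 + ratr t3.1 * trace t3.2).
    by rewrite tr2 tr3; ring: qF.
  by rewrite rel mulr0.
have pr' : - t0.2 ^+ 2 * ratr e * t3.2 = 1 by rewrite -pr w1 w2E; ring.
have w3c : t3.2 ^+ 3 = - ratr q by rewrite exprS w3; ring: w3 qF.
have w06 : t0.2 ^+ 6 = ratr e * ratr q.
  have : (- t0.2 ^+ 2 * ratr e * t3.2) ^+ 3 = 1 by rewrite pr' expr1n.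
  move=> E; transitivity (t0.2 ^+ 6 * 1); first by rewrite mulr1.
  rewrite -[in LHS](_ : t3.2 ^+ 3 * (- ratr q) = 1); last by rewrite w3c; ring: qF.
  by rewrite -[RHS]mulr1 -E; ring: eF qF.
have [eq1|eqN1] : e * q = 1 \/ e * q = -1.
  have /eqP : (e * q) ^+ 2 = 1 by rewrite exprMn e2 q2 mulr1.
  by rewrite sqrf_eq1 => /orP [] /eqP; [left|right].
  have w06' : t0.2 ^+ 6 = 1 by rewrite w06 -rmorphM eq1 rmorph1.
  apply: (special_mu6 ph cfg); split=> //.
  - by rewrite w1 -w06'; ring.
  - by ring: w2.
  - by transitivity ((t3.2 ^+ 3) ^+ 2); [ring | rewrite w3c sqrrN].
have qE : q = - e.
  by rewrite -[LHS]mul1r -e2 expr2 -mulrA eqN1 mulrN1.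
have c3' : t3.1 = 2 * t2.1 by rewrite c3 qE; ring: e2.
have c0 : t0.1 = - (3 / 2) * t2.1 by lra.
have qFE : ratr q = - ratr e :> F by rewrite qE rmorphN.
have w0w3 : t0.2 ^+ 2 * t3.2 = - ratr e.
  transitivity (- ratr e * (- t0.2 ^+ 2 * ratr e * t3.2)); first by ring: eF.
  by rewrite pr' mulr1.
have w04 : t0.2 ^+ 4 = ratr e * t3.2.
  transitivity ((t0.2 ^+ 2 * t3.2) ^+ 2 * (ratr e * t3.2)); last first.
    by rewrite w0w3 sqrrN eF mul1r.
  transitivity (t0.2 ^+ 4 * (ratr e * t3.2 ^+ 3)); last by ring.
  by rewrite w3c qFE; ring: eF.
have n1 : (-1 : F) != 1.
  by rewrite eq_sym -subr_eq0 opprK -(natrD _ 1 1) pnatr_eq0.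
have g12 : 12.-primitive_root (- (ratr e * t0.2)).
  apply: prim12_root n1.
    transitivity (t0.2 ^+ 6); first by ring: eF.
    by rewrite w06 qFE; ring: eF.
  rewrite (_ : _ ^+ 4 = ratr e * t3.2); last by rewrite -w04; ring: eF.
  apply/negP => /eqP ew3; have /eqP : (3 : F) = 0.
    have w3e : t3.2 = ratr e by rewrite -[LHS]mul1r -eF expr2 -mulrA ew3 mulr1.
    move: w3; rewrite w3e qFE eF => w3'.
    by transitivity (1 - (- ratr e * ratr e - 1) : F);
      [ring: eF | rewrite -w3' subrr].
  by rewrite pnatr_eq0.
apply: special_swap12.
apply: (special12b (k := - t2.1 / 2) g12) => //=; last first.
- by rewrite c3'; field.
- by rewrite -c01 c0; field.
- by field.
- by rewrite c0; field.
- rewrite w1; transitivity (- (ratr e * t0.2) * t0.2 ^+ 4); last by ring: eF.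
  by rewrite w04; ring: eF.
- by rewrite w2E -w04; ring: eF.
- by rewrite w2E w1; ring.
Qed.

End Pairs.

Lemma prim4_sqr (F : fieldType) (i : F) : 4.-primitive_root i -> i ^+ 2 = -1.
Proof.
move=> pi; have /eqP : (i ^+ 2) ^+ 2 = 1 by rewrite -exprM (prim_expr_order pi).
by rewrite sqrf_eq1 -(prim_order_dvd pi) => /eqP.
Qed.

(** Each half is described by two_trace_relation: both points are i or -i (zero),
    or they are opposite with equal coefficients, or one is 1 or -1 and the
    other has order 3 or 6 (real). *)
Lemma special_two_two (F : numFieldType) (zeta : nat -> F) (j : nat)
    (t0 t1 t2 t3 : rat * F) :
  (forall m, (0 < m)%N -> m.-primitive_root (zeta m)) ->
  config t0 t1 t2 t3 ->
  let N := (2 ^ j * 3)%N in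
  [/\ t0.2 ^+ N = 1, t1.2 ^+ N = 1, t2.2 ^+ N = 1 & t3.2 ^+ N = 1] ->
  ratr t0.1 * trace t0.2 + ratr t1.1 * trace t1.2 = 0 ->
  ratr t2.1 * trace t2.2 + ratr t3.1 * trace t3.2 = 0 -> special t0 t1 t2 t3.
Proof.
move=> hz cfg N [r0 r1 r2 r3] rel01 rel23.
have ph := hz 6 isT; have i2 := prim4_sqr (hz 4 isT).
have [[/and4P [c0 c1 c2 c3] sum0 /and3P [s01 s02 s03]] _ pr _] := cfg.
have s23 : t2.1 + t3.1 != 0 by apply: contra_neq s01 => e; lra.
have cfg2 : config t2 t3 t0 t1.
  by do [apply: config_swap12; apply: config_swap23; apply: config_swap01;
    apply: config_swap12].
have swap2 : special t2 t3 t0 t1 -> special t0 t1 t2 t3.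
  by move=> ?; do [apply: special_swap12; apply: special_swap01;
    apply: special_swap23; apply: special_swap12].
have cfgr := config_swap23 cfg; have cfgl := config_swap01 cfg.
have cfg2r := config_swap23 cfg2; have cfg2l := config_swap01 cfg2.
have rel10 := rel01; rewrite addrC in rel10.
have rel32 := rel23; rewrite addrC in rel32.
have real6 (w : F) (q : rat) : q ^+ 2 = 1 -> w ^+ 2 = ratr q * w - 1 -> w ^+ 6 = 1.
  move=> q2 w2; have qF : (ratr q : F) ^+ 2 = 1 by rewrite -rmorphXn q2 rmorph1.
  by ring: w2 qF.
have one6 (w : F) : w ^+ 2 = 1 -> w ^+ 6 = 1 by move=> w2; ring: w2.
have sqZ (u v : F) : u ^+ 2 = -1 -> v ^+ 2 = -1 -> (u * v) ^+ 2 = 1.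
  by move=> u2 v2; ring: u2 v2.
have two01 := two_trace_relation hz c0 c1 s01 r0 r1 rel01.
have two23 := two_trace_relation hz c2 c3 s23 r2 r3 rel23.
case: two01 => [[w0 w1]|[c01 e01]|[w0 [q q2 w1]]|[w1 [q q2 w0]]];
case: two23 => [[w2 w3]|[c23 e23]|[w2 [r rr w3]]|[w3 [r rr w2]]].
- by apply: (special_imu6 ph i2 cfg); split; apply: cube_sqrN1.
- exact: (special_zero_opposite ph i2 cfg).
- by case: (zero_real_contra cfg (sqZ _ _ w0 w1) w2 rr w3).
- by case: (zero_real_contra cfgr (sqZ _ _ w0 w1) w3 rr w2).
- by apply: swap2; exact: (special_zero_opposite ph i2 cfg2).
- by case/negP: s02; apply/eqP; lra.
- exact: (special_opposite_real ph cfg rel23 c01 e01 w2 rr w3).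
- apply: special_swap23.
  exact: (special_opposite_real ph cfgr rel32 c01 e01 w3 rr w2).
- by case: (zero_real_contra cfg2 (sqZ _ _ w2 w3) w0 q2 w1).
- apply: swap2.
  exact: (special_opposite_real ph cfg2 rel01 c23 e23 w0 q2 w1).
- apply: (special_mu6 ph cfg); split; [exact: one6|exact: real6 w1|exact: one6|exact: real6 w3].
- apply: (special_mu6 ph cfg); split; [exact: one6|exact: real6 w1|exact: real6 w2|exact: one6].
- by case: (zero_real_contra cfg2r (sqZ _ _ w2 w3) w1 q2 w0).
- apply: swap2; apply: special_swap23.
  exact: (special_opposite_real ph cfg2r rel10 c23 e23 w1 q2 w0).
- apply: (special_mu6 ph cfg); split; [exact: real6 w0|exact: one6|exact: one6|exact: real6 w3].
- apply: (special_mu6 ph cfg); split; [exact: real6 w0|exact: one6|exact: real6 w2|exact: one6].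
Qed.

(** Compare absolute values. *)
Lemma opposite_coef (F : numFieldType) (N : nat) (c d : rat) (u v : F) :
  (0 < N)%N -> u ^+ N = 1 -> v ^+ N = 1 -> ratr c * u + ratr d * v = 0 ->
  c = d \/ c = - d.
Proof.
move=> N0 uN vN /eqP; rewrite addr_eq0 => /eqP.
have n1 (w : F) : w ^+ N = 1 -> `|w| = 1.
  by move=> wN; apply/eqP; rewrite -(pexpr_eq1 N0) // -normrX wN normr1.
move=> e; have {}e : `|ratr c * u| = `|ratr d * v| by rewrite e normrN.
have sq (x : rat) : `|ratr x : F| ^+ 2 = ratr x ^+ 2.
  by apply: real_normK; apply: rpred_rat.
have /eqP : ratr c ^+ 2 = ratr d ^+ 2 :> F.
  move: e; rewrite (normrM (ratr c)) (normrM (ratr d)) (n1 u uN) (n1 v vN).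
  by rewrite !mulr1 -!sq => ->.
rewrite -!rmorphXn (inj_eq (fmorph_inj _)).
by rewrite eqf_sqr => /orP [] /eqP; [left|right].
Qed.

(** A splitting of the relation into two pairs would make two coefficients equal and
    the other two equal, against genericity.  So by four_term_relation all points
    lie in one coset of the sixth roots of unity, and the order is exactly 24. *)
Lemma special_sum0 (F : numFieldType) (zeta : nat -> F) (j : nat)
    (t0 t1 t2 t3 : rat * F) :
  (forall m, (0 < m)%N -> m.-primitive_root (zeta m)) ->
  config t0 t1 t2 t3 -> (2 < j)%N ->
  let N := (2 ^ j * 3)%N in
  [/\ t0.2 ^+ N = 1, t1.2 ^+ N = 1, t2.2 ^+ N = 1 & t3.2 ^+ N = 1] ->
  t0.2 ^+ (2 ^ j.-1 * 3) = -1 ->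
  ratr t0.1 * t0.2 + ratr t1.1 * t1.2 + ratr t2.1 * t2.2 + ratr t3.1 * t3.2 = 0 ->
  special t0 t1 t2 t3.
Proof.
move=> hz cfg j2 N rN w0M rel; have [r0 r1 r2 r3] := rN.
have N0 : (0 < N)%N by rewrite muln_gt0 expn_gt0.
have [[kn sum0 /and3P [s01 s02 s03]] _ pr _] := cfg.
have [w0 w1 w2 w3] := config_neq0 cfg.
case: (four_term_relation hz kn rN rel).
- move=> [/(opposite_coef N0 r0 r1) e1 /(opposite_coef N0 r2 r3) e2]; exfalso.
  move/eqP: s01; move/eqP: s02; case: e1 => [e1|e1]; last by lra.
  by case: e2 => e2; lra.
- move=> [/(opposite_coef N0 r0 r2) e1 /(opposite_coef N0 r1 r3) e2]; exfalso.
  move/eqP: s01; move/eqP: s02; case: e1 => [e1|e1]; last by lra.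
  by case: e2 => e2; lra.
- move=> [/(opposite_coef N0 r0 r3) e1 /(opposite_coef N0 r1 r2) e2]; exfalso.
  move/eqP: s01; move/eqP: s03; case: e1 => [e1|e1]; last by lra.
  by case: e2 => e2; lra.
move=> [v1 v2 v3].
have w24 : t0.2 ^+ 24 = 1.
  transitivity ((t0.2 * t1.2 * t2.2 * t3.2) ^+ 6); last by rewrite pr expr1n.
  transitivity (t0.2 ^+ 24 * ((t1.2 / t0.2) ^+ 6 * (t2.2 / t0.2) ^+ 6 * (t3.2 / t0.2) ^+ 6)).
    by rewrite v1 v2 v3 !mulr1.
  by field.
have j3 : j = 3%N.
  apply/eqP; rewrite eqn_leq j2 andbT leqNgt; apply/negP => j4.
  have : (24 %| 2 ^ j.-1 * 3)%N.
    by rewrite (_ : 24 = 2 ^ 3 * 3)%N // dvdn_pmul2r // dvdn_exp2l // -ltnS prednK //;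
      apply: ltn_trans j4.
  case/dvdnP => m mE; move: w0M; rewrite mE mulnC exprM w24 expr1n => /eqP.
  by rewrite -subr_eq0 opprK -(natrD _ 1 1) pnatr_eq0.
have w12 : t0.2 ^+ 12 = -1 by move: w0M; rewrite j3.
have quot (w : F) : (w / t0.2) ^+ 6 = 1 -> (w / t0.2 ^+ 9) ^+ 6 = 1.
  move=> e; transitivity ((w / t0.2) ^+ 6 * (t0.2 ^+ 24 ^- 2)).
    by field.
  by rewrite e w24 expr1n invr1 mulr1.
apply: (special_zeta8 (hz 6 isT) (zeta := t0.2 ^+ 9)) => //.
  by rewrite -exprM (exprM _ 12 3) w12; ring.
by split; apply: quot => //; rewrite mulfV ?expr1n.
Qed.

Section TwoThree.

Variables (F : numFieldType) (zeta : nat -> F).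
Hypothesis hz : forall m, (0 < m)%N -> m.-primitive_root (zeta m).
Implicit Types t : rat * F.

(** Conjugation by 1 + N/4 multiplies w_i by a fourth root of unity, i or -i.  Added
    to the original equation it leaves one of w_i and 1/w_i for each i.  The
    product of the four signs is 1, so the number of inverted points is even. *)
Lemma special_all_odd (j : nat) t0 t1 t2 t3 : config t0 t1 t2 t3 ->
  let N := (2 ^ j.+3 * 3)%N in let M := (2 ^ j.+2 * 3)%N in
  [/\ t0.2 ^+ N = 1, t1.2 ^+ N = 1, t2.2 ^+ N = 1 & t3.2 ^+ N = 1] ->
  [/\ t0.2 ^+ M = -1, t1.2 ^+ M = -1, t2.2 ^+ M = -1 & t3.2 ^+ M = -1] ->
  special t0 t1 t2 t3.
Proof.
move=> cfg N M rN [m0 m1 m2 m3].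
have N0 : (0 < N)%N by rewrite muln_gt0 expn_gt0.
pose L := (2 ^ j.+1 * 3)%N.
have ML : M = (L * 2)%N by rewrite /M /L expnS -mulnA mulnC.
have NL : (N %| L ^ 3)%N.
  rewrite /N /L expnMn dvdn_mul // -expnM dvdn_exp2l //.
  by rewrite mulnC !mulSn mul0n addn0; lia.
have [w0 w1 w2 w3] := config_neq0 cfg.
have [_ _ pr rel] := cfg.
have [_ _ _ /= relL] := config_shift (hz N0) NL cfg rN.
pose i := t0.2 ^+ L.
have i2 : i ^+ 2 = -1 by rewrite -exprM -ML.
have i0 : i != 0 by rewrite expf_neq0.
have sgn (w : F) : w ^+ M = -1 -> w ^+ L = i \/ w ^+ L = - i.
  rewrite ML exprM -i2 => /eqP; rewrite eqf_sqr.
  by case/orP => /eqP; [left|right].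
have trL (w e : F) : w != 0 -> e ^+ 2 = 1 -> w ^+ L = e * i ->
    trace (w ^+ L.+1) = i * (e * (w - w^-1)).
  move=> wn e2 wL; rewrite exprS wL /trace.
  have e0 : e != 0 by apply: contra_eq_neq e2 => ->; rewrite expr0n eq_sym oner_eq0.
  apply: (mulfI (mulf_neq0 wn (mulf_neq0 e0 i0))).
  transitivity (w ^+ 2 * (e * i) ^+ 2 + 1); first by field; rewrite wn e0 i0.
  by transitivity (e ^+ 2 * i ^+ 2 * (w ^+ 2 - 1)); [ring: e2 i2 | field].
have prL : t0.2 ^+ L * t1.2 ^+ L * t2.2 ^+ L * t3.2 ^+ L = 1.
  by rewrite -!exprMn pr expr1n.
have half (e1 e2 e3 : F) : e1 ^+ 2 = 1 -> e2 ^+ 2 = 1 -> e3 ^+ 2 = 1 ->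
    t1.2 ^+ L = e1 * i -> t2.2 ^+ L = e2 * i -> t3.2 ^+ L = e3 * i ->
    ratr t0.1 * (t0.2 - t0.2^-1) + ratr t1.1 * (e1 * (t1.2 - t1.2^-1))
    + ratr t2.1 * (e2 * (t2.2 - t2.2^-1)) + ratr t3.1 * (e3 * (t3.2 - t3.2^-1))
    = 0.
  move=> s1 s2 s3 L1 L2 L3; apply: (mulfI i0); rewrite mulr0 -relL.
  rewrite (trL _ 1) ?expr1n ?mul1r // (trL _ e1) // (trL _ e2) // (trL _ e3) //.
  by ring.
have two0 : (2 : F) != 0 by rewrite pnatr_eq0.
have n11 : (-1 : F) ^+ 2 = 1 by rewrite sqrrN expr1n.
have p11 : (1 : F) ^+ 2 = 1 by rewrite expr1n.
have odd_contra : (-1 : F) = 1 -> False.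
  move/eqP; rewrite eq_sym -subr_eq0 opprK -(natrD _ 1 1).
  by rewrite pnatr_eq0.
case: (sgn _ m1) => e1; case: (sgn _ m2) => e2; case: (sgn _ m3) => e3;
  rewrite -/i e1 e2 e3 in prL.
- have E := half 1 1 1 p11 p11 p11; rewrite !mul1r in E.
  have {}E := E e1 e2 e3.
  apply: (special_sum0 hz cfg (j := j.+3)) => //.
  apply: (mulfI two0); rewrite mulr0 -[RHS]addr0 -{1}rel -E /trace.
  by ring.
- by case: odd_contra; rewrite -[RHS]prL; ring: i2.
- by case: odd_contra; rewrite -[RHS]prL; ring: i2.
- have E := half 1 (-1) (-1) p11 n11 n11; rewrite !mul1r !mulN1r in E.
  have {}E := E e1 e2 e3.
  apply: special_of_inverted_pair => //.
  apply: (mulfI two0); rewrite mulr0 -[RHS]addr0 -{1}rel -E /trace.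
  by ring.
- by case: odd_contra; rewrite -[RHS]prL; ring: i2.
- have E := half (-1) 1 (-1) n11 p11 n11; rewrite !mul1r !mulN1r in E.
  have {}E := E e1 e2 e3.
  apply: special_swap12; apply: special_of_inverted_pair; first exact: config_swap12.
  apply: (mulfI two0); rewrite mulr0 -[RHS]addr0 -{1}rel -E /trace.
  by ring.
- have E := half (-1) (-1) 1 n11 n11 p11; rewrite !mul1r !mulN1r in E.
  have {}E := E e1 e2 e3.
  apply: special_swap23; apply: special_swap12; apply: special_of_inverted_pair.
    by apply: config_swap12; apply: config_swap23.
  apply: (mulfI two0); rewrite mulr0 -[RHS]addr0 -{1}rel -E /trace.
  by ring.
- by case: odd_contra; rewrite -[RHS]prL; ring: i2.
Qed.

(** Conjugation by 1 + N/2 multiplies w_i by a sign.  With all signs 1 the order is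
    halved; with two signs of each kind the equation splits into two halves; with
    all signs -1 it is special_all_odd, or special_imu6 when N = 12. *)
Lemma special_order_2j3 (j : nat) t0 t1 t2 t3 : config t0 t1 t2 t3 ->
  let N := (2 ^ j * 3)%N in
  [/\ t0.2 ^+ N = 1, t1.2 ^+ N = 1, t2.2 ^+ N = 1 & t3.2 ^+ N = 1] ->
  special t0 t1 t2 t3.
Proof.
elim: j t0 t1 t2 t3 => [|j IH] t0 t1 t2 t3 cfg N rN.
  have [r0 r1 r2 r3] := rN; apply: (special_mu6 (hz (isT : 0 < 6)%N) cfg).
  by rewrite /N mul1n in r0 r1 r2 r3; split;
    [ring: r0 | ring: r1 | ring: r2 | ring: r3].
have NE : N = (2 ^ j.+1 * 3)%N by [].
have N0 : (0 < N)%N by rewrite muln_gt0 expn_gt0.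
clearbody N; case: j IH NE => [|j] IH NE.
  have e6 : 6%N = N by rewrite NE expn1.
  by apply: (special_mu6 (hz (isT : 0 < 6)%N) cfg); rewrite e6.
pose M := (2 ^ j.+1 * 3)%N.
have NM : N = (M * 2)%N by rewrite NE /M expnS -mulnA mulnC.
have NdvdM : (N %| M ^ 2)%N.
  by rewrite NM -mulnn dvdn_mul // /M expnS -mulnA dvdn_mulr.
have [r0 r1 r2 r3] := rN.
have [_ _ pr rel] := cfg.
have [_ _ _ /= relM] := config_shift (hz N0) NdvdM cfg rN.
have sgn (w : F) : w ^+ N = 1 -> w ^+ M = 1 \/ w ^+ M = -1.
  rewrite NM exprM => /eqP; rewrite sqrf_eq1.
  by case/orP => /eqP; [left | right].
have trM (w e : F) : w ^+ M = e -> e ^+ 2 = 1 -> trace (w ^+ M.+1) = e * trace w.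
  move=> wM e2; rewrite exprS wM /trace invfM mulrDr [w * e]mulrC; congr (_ + _).
  rewrite mulrC; congr (_ * _).
  have e0 : e != 0 by apply: contra_eq_neq e2 => ->; rewrite expr0n eq_sym oner_eq0.
  by apply: (mulfI e0); rewrite mulfV // -expr2.
have prM : t0.2 ^+ M * t1.2 ^+ M * t2.2 ^+ M * t3.2 ^+ M = 1.
  by rewrite -!exprMn pr expr1n.
have half (e0 e1 e2 e3 : F) : t0.2 ^+ M = e0 ->
    t1.2 ^+ M = e1 -> t2.2 ^+ M = e2 -> t3.2 ^+ M = e3 ->
    e0 * (ratr t0.1 * trace t0.2) + e1 * (ratr t1.1 * trace t1.2)
    + e2 * (ratr t2.1 * trace t2.2) + e3 * (ratr t3.1 * trace t3.2) = 0.
  move=> L0 L1 L2 L3; rewrite -relM (trM _ e0) -?L0 -?exprM -?NM //.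
  rewrite (trM _ e1) -?L1 -?exprM -?NM // (trM _ e2) -?L2 -?exprM -?NM //.
  by rewrite (trM _ e3) -?L3 -?exprM -?NM //; ring.
have two0 : (2 : F) != 0 by rewrite pnatr_eq0.
have odd_contra : (-1 : F) = 1 -> False.
  move/eqP; rewrite eq_sym -subr_eq0 opprK -(natrD _ 1 1).
  by rewrite pnatr_eq0.
have h2 (x y : F) : x + y = 0 -> x - y = 0 -> x = 0 /\ y = 0.
  move=> e1 e2; split; apply: (mulfI two0); rewrite mulr0.
    by transitivity ((x + y) + (x - y)); [ring | rewrite e1 e2 addr0].
  by transitivity ((x + y) - (x - y)); [ring | rewrite e1 e2 subr0].
pose x0 := ratr t0.1 * trace t0.2; pose x1 := ratr t1.1 * trace t1.2.
pose x2 := ratr t2.1 * trace t2.2; pose x3 := ratr t3.1 * trace t3.2.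
case: (sgn _ r0) => e0; case: (sgn _ r1) => e1; case: (sgn _ r2) => e2;
  case: (sgn _ r3) => e3;
  try (by case: odd_contra; rewrite -[RHS]prM e0 e1 e2 e3; ring);
  have := half _ _ _ _ e0 e1 e2 e3; rewrite ?mul1r ?mulN1r => E.
- exact: IH cfg _.
- have [] := h2 (x0 + x1) (x2 + x3).
  + by rewrite -rel; rewrite /x0 /x1 /x2 /x3; ring.
  + by rewrite -E; rewrite /x0 /x1 /x2 /x3; ring.
  by apply: (special_two_two hz cfg (j := j.+2)); rewrite -?NE.
- have [] := h2 (x0 + x2) (x1 + x3).
  + by rewrite -rel; rewrite /x0 /x1 /x2 /x3; ring.
  + by rewrite -E; rewrite /x0 /x1 /x2 /x3; ring.
  move=> E02 E13; apply: special_swap12.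
  by apply: (special_two_two hz (config_swap12 cfg) (j := j.+2)); rewrite -?NE.
- have [] := h2 (x0 + x3) (x1 + x2).
  + by rewrite -rel; rewrite /x0 /x1 /x2 /x3; ring.
  + by rewrite -E; rewrite /x0 /x1 /x2 /x3; ring.
  move=> E03 E12; apply: special_swap23; apply: special_swap12.
  by apply: (special_two_two hz (config_swap12 (config_swap23 cfg)) (j := j.+2));
    rewrite -?NE.
- have [] := h2 (x1 + x2) (x0 + x3).
  + by rewrite -rel; rewrite /x0 /x1 /x2 /x3; ring.
  + by rewrite -E; rewrite /x0 /x1 /x2 /x3; ring.
  move=> E12 E03; apply: special_swap23; apply: special_swap12.
  by apply: (special_two_two hz (config_swap12 (config_swap23 cfg)) (j := j.+2));
    rewrite -?NE.
- have [] := h2 (x1 + x3) (x0 + x2).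
  + by rewrite -rel; rewrite /x0 /x1 /x2 /x3; ring.
  + by rewrite -E; rewrite /x0 /x1 /x2 /x3; ring.
  move=> E13 E02; apply: special_swap12.
  by apply: (special_two_two hz (config_swap12 cfg) (j := j.+2)); rewrite -?NE.
- have [] := h2 (x2 + x3) (x0 + x1).
  + by rewrite -rel; rewrite /x0 /x1 /x2 /x3; ring.
  + by rewrite -E; rewrite /x0 /x1 /x2 /x3; ring.
  move=> E23 E01.
  by apply: (special_two_two hz cfg (j := j.+2)); rewrite -?NE.
have [j0|/prednK jE] := posnP j.
  have i2 : zeta 4 ^+ 2 = -1 := prim4_sqr (hz (isT : 0 < 4)%N).
  have M6 : M = 6%N by rewrite /M j0.
  by apply: (special_imu6 (hz (isT : 0 < 6)%N) i2 cfg); rewrite -M6.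
by apply: (special_all_odd (j := j.-1) cfg); rewrite jE -?NE.
Qed.

End TwoThree.

(** * Sums over the classes of a prime *)

Lemma sum_geometric_unity (F : fieldType) (p : nat) (z : F) :
  z ^+ p = 1 -> \sum_(t < p) z ^+ t = (z == 1)%:R * p%:R.
Proof.
move=> zp; have [->|z1] := eqVneq z 1.
  by rewrite mul1r; under eq_bigr do rewrite expr1n; rewrite sumr_const card_ord.
apply: (mulfI (_ : z - 1 != 0)); first by rewrite subr_eq0.
by rewrite mul0r mulr0 -subrX1 zp subrr.
Qed.

Section OddPrime.

Variables (F : numFieldType) (p M : nat).
Hypothesis p_odd : odd p.
Implicit Types t : rat * F.

Definition conj_sum t0 t1 t2 t3 (k : nat) : F :=
  ratr t0.1 * trace (t0.2 ^+ k) + ratr t1.1 * trace (t1.2 ^+ k)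
  + ratr t2.1 * trace (t2.2 ^+ k) + ratr t3.1 * trace (t3.2 ^+ k).

(** The contribution of t to the class rho.  A point t contributes w to the class
    of its p-th root of unity t.2^M and 1/w to the inverse class. *)
Definition class_term t (rho w : F) : F :=
  (t.2 ^+ M == rho)%:R * (ratr t.1 * w) + (t.2 ^+ M == rho^-1)%:R * (ratr t.1 * w^-1).

Lemma class_term_sum t (k : nat) (rho : F) :
  t.2 ^+ (p * M) = 1 -> t.2 != 0 -> rho ^+ p = 1 -> rho != 0 ->
  \sum_(j < p) (rho^-1) ^+ j * (ratr t.1 * trace (t.2 ^+ (k + M * j)))
  = p%:R * class_term t rho (t.2 ^+ k).
Proof.
move=> tN t0 rp r0; have mu0 : t.2 ^+ M != 0 by rewrite expf_neq0.
have mup : (t.2 ^+ M) ^+ p = 1 by rewrite -exprM mulnC.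
have s1 : \sum_(j < p) (t.2 ^+ M / rho) ^+ j = (t.2 ^+ M == rho)%:R * p%:R.
  rewrite sum_geometric_unity; last by rewrite exprMn exprVn mup rp divr1.
  by rewrite -(inj_eq (mulIf r0)) divfK // mul1r.
have s2 : \sum_(j < p) ((t.2 ^+ M)^-1 / rho) ^+ j = (t.2 ^+ M == rho^-1)%:R * p%:R.
  rewrite sum_geometric_unity; last by rewrite exprMn !exprVn mup rp divr1 invr1.
  rewrite -(inj_eq (mulfI mu0)) mulr1 mulrA mulfV // mul1r.
  by rewrite eq_sym.
rewrite /class_term mulrDr.
transitivity (ratr t.1 * t.2 ^+ k * \sum_(j < p) (t.2 ^+ M / rho) ^+ j
   + ratr t.1 * (t.2 ^+ k)^-1 * \sum_(j < p) ((t.2 ^+ M)^-1 / rho) ^+ j); last first.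
  by rewrite s1 s2; ring.
rewrite !mulr_sumr -big_split /=; apply: eq_bigr => j _.
by rewrite /trace exprD exprM !exprMn !exprVn invfM; ring.
Qed.

(** Fourier inversion on the group of p-th roots of unity.  When only the
    conjugate with exponent k may fail to vanish, the sums over all classes have
    the same value. *)
Lemma class_sumE t0 t1 t2 t3 (k : nat) (rho : F) :
  [/\ t0.2 ^+ (p * M) = 1, t1.2 ^+ (p * M) = 1, t2.2 ^+ (p * M) = 1
    & t3.2 ^+ (p * M) = 1] ->
  [/\ t0.2 != 0, t1.2 != 0, t2.2 != 0 & t3.2 != 0] ->
  (forall j, (0 < j < p)%N -> conj_sum t0 t1 t2 t3 (k + M * j) = 0) ->
  rho ^+ p = 1 ->
  p%:R * (class_term t0 rho (t0.2 ^+ k) + class_term t1 rho (t1.2 ^+ k)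
        + class_term t2 rho (t2.2 ^+ k) + class_term t3 rho (t3.2 ^+ k))
  = conj_sum t0 t1 t2 t3 k.
Proof.
move=> [r0 r1 r2 r3] [w0 w1 w2 w3] conj0 rp.
have p0 : (0 < p)%N := odd_gt0 p_odd.
have rho0 := unity_neq0 p0 rp.
rewrite 3!mulrDr -!class_term_sum // -!big_split /=.
transitivity (\sum_(j < p) rho^-1 ^+ j * conj_sum t0 t1 t2 t3 (k + M * j)).
  by apply: eq_bigr => j _; rewrite /conj_sum; ring.
rewrite -(prednK p0) big_ord_recl big1 /= => [|j _].
  by rewrite muln0 addn0 expr0 mul1r addr0.
by rewrite conj0 ?mulr0 //= -[X in (_ < X)%N](prednK p0) ltnS ltn_ord.
Qed.

Definition vanishing t0 t1 t2 t3 : Prop := forall rho : F, rho ^+ p = 1 ->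
  class_term t0 rho t0.2 + class_term t1 rho t1.2 + class_term t2 rho t2.2
  + class_term t3 rho t3.2 = 0.

Lemma unity_odd (rho : F) : rho ^+ p = 1 -> rho != 1 -> rho != rho^-1.
Proof.
move=> rp; apply: contra_neq => e; have rho0 := unity_neq0 (odd_gt0 p_odd) rp.
have r2 : rho ^+ 2 = 1 by rewrite expr2 {2}e mulfV.
by rewrite -rp -(odd_double_half p) p_odd -mul2n exprD exprM r2 expr1n mulr1 expr1.
Qed.

Lemma class_term_in t (rho w : F) : rho != rho^-1 -> t.2 ^+ M = rho ->
  class_term t rho w = ratr t.1 * w.
Proof. by move=> r e; rewrite /class_term e eqxx (negPf r) mul0r addr0 mul1r. Qed.

Lemma class_term_inv t (rho w : F) : rho != rho^-1 -> t.2 ^+ M = rho^-1 ->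
  class_term t rho w = ratr t.1 * w^-1.
Proof.
by move=> r e; rewrite /class_term e eqxx eq_sym (negPf r) mul0r add0r mul1r.
Qed.

Lemma class_term_out t (rho w : F) : t.2 ^+ M != rho -> t.2 ^+ M != rho^-1 ->
  class_term t rho w = 0.
Proof. by move=> /negPf r /negPf r'; rewrite /class_term r r' !mul0r addr0. Qed.

Lemma class_term1 t (w : F) : t.2 ^+ M = 1 -> class_term t 1 w = ratr t.1 * trace w.
Proof. by move=> r; rewrite /class_term r invr1 eqxx !mul1r -mulrDr. Qed.

End OddPrime.

(** * Vanishing class sums *)

Section Vanishing.

Variables (F : numFieldType) (zeta : nat -> F) (p M : nat).
Hypothesis hz : forall m, (0 < m)%N -> m.-primitive_root (zeta m).
Hypotheses (p_odd : odd p) (M_gt0 : (0 < M)%N).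
Implicit Types t : rat * F.
Local Notation N := (p * M)%N.
Local Notation mu t := (t.2 ^+ M).

Let p_gt0 : (0 < p)%N := odd_gt0 p_odd.

Definition mu12_points t0 t1 t2 t3 : Prop :=
  [/\ t0.2 ^+ 12 = 1, t1.2 ^+ 12 = 1, t2.2 ^+ 12 = 1 & t3.2 ^+ 12 = 1].

Definition vanishing_config t0 t1 t2 t3 : Prop :=
  [/\ config t0 t1 t2 t3,
      [/\ t0.2 ^+ N = 1, t1.2 ^+ N = 1, t2.2 ^+ N = 1 & t3.2 ^+ N = 1]
    & vanishing p M t0 t1 t2 t3].

Lemma vanishing_config_swap01 t0 t1 t2 t3 : vanishing_config t0 t1 t2 t3 ->
  vanishing_config t1 t0 t2 t3.
Proof.
move=> [cfg [? ? ? ?] van]; split=> //; first exact: config_swap01.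
by move=> rho rp; rewrite -(van rho rp); ring.
Qed.

Lemma vanishing_config_swap12 t0 t1 t2 t3 : vanishing_config t0 t1 t2 t3 ->
  vanishing_config t0 t2 t1 t3.
Proof.
move=> [cfg [? ? ? ?] van]; split=> //; first exact: config_swap12.
by move=> rho rp; rewrite -(van rho rp); ring.
Qed.

Lemma vanishing_config_swap23 t0 t1 t2 t3 : vanishing_config t0 t1 t2 t3 ->
  vanishing_config t0 t1 t3 t2.
Proof.
move=> [cfg [? ? ? ?] van]; split=> //; first exact: config_swap23.
by move=> rho rp; rewrite -(van rho rp); ring.
Qed.

Definition special_or_mu12 t0 t1 t2 t3 : Prop :=
  special t0 t1 t2 t3 \/ mu12_points t0 t1 t2 t3.

Lemma special_or_mu12_swap01 t0 t1 t2 t3 : special_or_mu12 t1 t0 t2 t3 ->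
  special_or_mu12 t0 t1 t2 t3.
Proof. by case=> [?|[? ? ? ?]]; [left; apply: special_swap01 | right]. Qed.

Lemma special_or_mu12_swap12 t0 t1 t2 t3 : special_or_mu12 t0 t2 t1 t3 ->
  special_or_mu12 t0 t1 t2 t3.
Proof. by case=> [?|[? ? ? ?]]; [left; apply: special_swap12 | right]. Qed.

Lemma special_or_mu12_swap23 t0 t1 t2 t3 : special_or_mu12 t0 t1 t3 t2 ->
  special_or_mu12 t0 t1 t2 t3.
Proof. by case=> [?|[? ? ? ?]]; [left; apply: special_swap23 | right]. Qed.

Definition paired t t' : bool := (mu t' == mu t) || (mu t' == (mu t)^-1).

Lemma mu_unity t : t.2 ^+ N = 1 -> mu t ^+ p = 1.
Proof. by move=> tN; rewrite -exprM mulnC. Qed.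

(** By genericity the two equalities would give opposite sums, both zero. *)
Lemma generic_pair t0 t1 t2 t3 : config t0 t1 t2 t3 ->
  t0.1 = t1.1 \/ t0.1 = - t1.1 -> t2.1 = t3.1 \/ t2.1 = - t3.1 -> False.
Proof.
move=> [[_ sum0 /and3P [s01 s02 _]] _ _ _]; move/eqP: s01; move/eqP: s02.
by move=> ? ? [?|?] [?|?]; lra.
Qed.

Lemma alone_contra t0 t1 t2 t3 : vanishing_config t0 t1 t2 t3 -> mu t0 != 1 ->
  ~~ paired t0 t1 -> ~~ paired t0 t2 -> ~~ paired t0 t3 -> False.
Proof.
move=> [cfg [r0 r1 r2 r3] van] m1; rewrite /paired !negb_or.
move=> /andP [a1 b1] /andP [a2 b2] /andP [a3 b3].
have rp := mu_unity r0; have rV := unity_odd p_odd rp m1.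
have [[/and4P [c0 _ _ _] _ _] _ _ _] := cfg; have [w0 _ _ _] := config_neq0 cfg.
have := van _ rp; rewrite (class_term_in _ rV) // !class_term_out // !addr0.
by move/eqP; rewrite mulf_eq0 fmorph_eq0 (negPf c0) (negPf w0).
Qed.

Lemma couple t0 t1 t2 t3 : vanishing_config t0 t1 t2 t3 -> mu t0 != 1 ->
  paired t0 t1 -> ~~ paired t0 t2 -> ~~ paired t0 t3 ->
  (mu t1 = mu t0 /\ ratr t0.1 * t0.2 + ratr t1.1 * t1.2 = 0) \/
  (mu t1 = (mu t0)^-1 /\ ratr t0.1 * t0.2 + ratr t1.1 * t1.2^-1 = 0).
Proof.
move=> [cfg [r0 r1 r2 r3] van] m1; rewrite /paired !negb_or => e1.
move=> /andP [a2 b2] /andP [a3 b3].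
have rp := mu_unity r0; have rV := unity_odd p_odd rp m1.
have := van _ rp; rewrite (class_term_in _ rV) //.
rewrite (@class_term_out _ _ t2) // (@class_term_out _ _ t3) // !addr0.
case/orP: e1 => /eqP e1.
  by rewrite class_term_in // => e; left.
by rewrite class_term_inv // => e; right.
Qed.

Lemma couple_coef t0 t1 t2 t3 : vanishing_config t0 t1 t2 t3 -> mu t0 != 1 ->
  paired t0 t1 -> ~~ paired t0 t2 -> ~~ paired t0 t3 ->
  t0.1 = t1.1 \/ t0.1 = - t1.1.
Proof.
move=> vc m1 e1 e2 e3; have [_ [r0 r1 _ _] _] := vc.
have N0 : (0 < N)%N by rewrite muln_gt0 p_gt0.
have r1V : t1.2^-1 ^+ N = 1 by rewrite exprVn r1 invr1.
case: (couple vc m1 e1 e2 e3) => -[_].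
  exact: opposite_coef N0 r0 r1.
exact: opposite_coef N0 r0 r1V.
Qed.

(** Otherwise the other two points would form a couple as well, and the coefficients
    would be equal in pairs. *)
Lemma outside_couple t0 t1 t2 t3 : vanishing_config t0 t1 t2 t3 -> mu t0 != 1 ->
  paired t0 t1 -> ~~ paired t0 t2 -> ~~ paired t0 t3 -> mu t2 = 1.
Proof.
move=> vc m1 e1 e2 e3; apply/eqP/negPn/negP => m2.
have [cfg [r0 r1 r2 r3] _] := vc.
have [w0 w1 w2 w3] := config_neq0 cfg.
have pairedC t t' : mu t != 0 -> ~~ paired t t' -> ~~ paired t' t.
  move=> mt; rewrite /paired !negb_or => /andP [a b]; rewrite eq_sym a /=.
  by apply: contra b => /eqP ->; rewrite invrK.
have e20 : ~~ paired t2 t0 by apply: pairedC; rewrite ?expf_neq0.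
have e21 : ~~ paired t2 t1.
  apply: contra e2; rewrite /paired => /orP [] /eqP e; move: e1;
    rewrite /paired e ?invr_eq1 => /orP [] /eqP e1.
  - by rewrite e1 eqxx.
  - by rewrite e1 eqxx orbT.
  - by rewrite -e1 invrK eqxx orbT.
  - by rewrite (invr_inj e1) eqxx.
have vc2 : vanishing_config t2 t3 t0 t1.
  by do [apply: vanishing_config_swap12; apply: vanishing_config_swap23;
    apply: vanishing_config_swap01;
    apply: vanishing_config_swap12].
have [e23|e23] := boolP (paired t2 t3); last exact: alone_contra vc2 m2 e23 e20 e21.
apply: (generic_pair cfg); first exact: couple_coef vc m1 e1 e2 e3.
exact: couple_coef vc2 m2 e23 e20 e21.
Qed.

(** The product of the classes is 1, so the couple consists of inverse classes, and
    then w0 w1 = -1 = w2 w3.  In the trivial class t2.1 trace w2 + t3.1 trace w3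
    vanishes with opposite traces, so both traces are zero. *)
Lemma special_or_mu12_couple t0 t1 t2 t3 : vanishing_config t0 t1 t2 t3 -> mu t0 != 1 ->
  paired t0 t1 -> ~~ paired t0 t2 -> ~~ paired t0 t3 -> special_or_mu12 t0 t1 t2 t3.
Proof.
move=> vc m1 e1 e2 e3.
have m2 := outside_couple vc m1 e1 e2 e3.
have m3 := outside_couple (vanishing_config_swap23 vc) m1 e1 e3 e2.
have cc := couple_coef vc m1 e1 e2 e3.
have [cfg [r0 r1 r2 r3] van] := vc.
have [[_ sum0 /and3P [s01 s02 s03]] _ pr _] := cfg.
have [w0 w1 w2 w3] := config_neq0 cfg.
have rp := mu_unity r0; have rV := unity_odd p_odd rp m1.
have prM : mu t0 * mu t1 * mu t2 * mu t3 = 1 by rewrite -!exprMn pr expr1n.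
have c01 : t0.1 = t1.1.
  by case: cc => // e; case/eqP: s01; rewrite e addNr.
have cF : ratr t1.1 != 0 :> F.
  by rewrite fmorph_eq0; have [[/and4P [_ ? _ _] _ _] _ _ _] := cfg.
case: (couple vc m1 e1 e2 e3) => -[mu1 rel].
  case/eqP: rV; apply: (mulfI (expf_neq0 M w0)); rewrite mulfV ?expf_neq0 //.
  by rewrite -prM m2 m3 mu1 !mulr1.
have w01 : t0.2 * t1.2 = -1.
  apply: (mulfI cF); move: rel; rewrite c01 => rel.
  apply/eqP; rewrite -subr_eq0 -(mulr0 t1.2) -rel; apply/eqP.
  by field; rewrite w1.
have w23 : t2.2 * t3.2 = -1.
  transitivity (- (t0.2 * t1.2 * t2.2 * t3.2)); first by rewrite w01; ring.
  by rewrite pr.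
have tr23 : trace t3.2 = - trace t2.2.
  have w3E : t3.2 = - t2.2^-1 by apply: (mulfI w2); rewrite w23 mulrN mulfV.
  by rewrite w3E /trace invrN invrK; ring.
have cls1 := van 1 (expr1n _ _).
have mu0V : mu t0 != 1^-1 by rewrite invr1.
have mu1N : mu t1 != 1 by rewrite mu1 invr_eq1.
have mu1NV : mu t1 != 1^-1 by rewrite invr1.
move: cls1; rewrite (class_term_out _ m1 mu0V) (class_term_out _ mu1N mu1NV).
rewrite !class_term1 // tr23 mulrN add0r add0r -mulrBl => /eqP.
rewrite mulf_eq0 -rmorphB fmorph_eq0 => /orP [/eqP e|/eqP tr0].
  by case: (generic_pair cfg cc); left; apply/eqP; rewrite -subr_eq0 e.
have sq (w : F) : w != 0 -> trace w = 0 -> w ^+ 2 = -1.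
  move=> wn tr0'; apply/eqP; rewrite -addr_eq0 -(mulr0 w) -tr0' /trace.
  by apply/eqP; field.
by left; apply: special_of_opposite_pair => //; apply: sq; rewrite ?tr23 ?tr0 ?oppr0.
Qed.

(** The fourth point lies in the trivial class, where its trace is zero.  The others
    form a three-term relation, which confines all points to the twelfth roots of
    unity. *)
Lemma special_or_mu12_triple t0 t1 t2 t3 : vanishing_config t0 t1 t2 t3 -> mu t0 != 1 ->
  paired t0 t1 -> paired t0 t2 -> ~~ paired t0 t3 -> special_or_mu12 t0 t1 t2 t3.
Proof.
move=> vc m1 e1 e2 e3.
have [cfg [r0 r1 r2 r3] van] := vc.
have [[/and4P [c0 c1 c2 c3] _ _] _ pr _] := cfg.
have [w0 w1 w2 w3] := config_neq0 cfg.
have mu0 : mu t0 != 0 by rewrite expf_neq0.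
have rp := mu_unity r0; have rV := unity_odd p_odd rp m1.
have prM : mu t0 * mu t1 * mu t2 * mu t3 = 1 by rewrite -!exprMn pr expr1n.
have m3 : mu t3 = 1.
  apply/eqP/negPn/negP => m3.
  have vc3 : vanishing_config t3 t0 t1 t2.
    by do [apply: vanishing_config_swap01; apply: vanishing_config_swap12;
      apply: vanishing_config_swap23].
  have rp3 := mu_unity r3; have rV3 := unity_odd p_odd rp3 m3.
  have sep t : paired t0 t -> ~~ paired t3 t.
    move=> e; apply: contra e3; rewrite /paired => /orP [] /eqP e'; move: e;
      rewrite /paired e' => /orP [] /eqP e.
    - by rewrite e eqxx.
    - by rewrite e eqxx orbT.
    - by rewrite -e invrK eqxx orbT.
    - by rewrite (invr_inj e) eqxx.
  by apply: alone_contra vc3 m3 _ (sep _ e1) (sep _ e2); apply: sep;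
    rewrite /paired eqxx.
have [mu1 mu2] : mu t1 = mu t0 /\ mu t2 = mu t0.
  move: prM; rewrite m3 mulr1.
  case/orP: e1 => /eqP ->; case/orP: e2 => /eqP -> // e; exfalso; move/eqP: m1; apply.
  - by rewrite -e mulfK.
  - by rewrite -e mulfV // mul1r.
  - by apply: invr_inj; rewrite invr1 -e mulfV // mul1r.
have rel : ratr t0.1 * t0.2 + ratr t1.1 * t1.2 + ratr t2.1 * t2.2 = 0.
  move: e3; rewrite /paired negb_or => /andP [a b].
  have := van _ rp; rewrite (class_term_in _ rV erefl) (class_term_in _ rV mu1).
  by rewrite (class_term_in _ rV mu2) (class_term_out _ a b) addr0.
have w3sq : t3.2 ^+ 2 = -1.
  have muV : mu t0 != 1^-1 by rewrite invr1.
  have := van 1 (expr1n _ _).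
  rewrite (class_term_out _ m1 muV) (@class_term_out _ _ t1) ?mu1 //.
  rewrite (@class_term_out _ _ t2) ?mu2 // class_term1 // !add0r => /eqP;
    rewrite mulf_eq0 fmorph_eq0 (negPf c3) /= => /eqP tr0.
  apply/eqP; rewrite -addr_eq0 -(mulr0 t3.2) -tr0 /trace.
  by apply/eqP; field.
have N0 : (0 < N)%N by rewrite muln_gt0 p_gt0.
have quotN (w : F) : w ^+ N = 1 -> (w / t0.2) ^+ N = 1.
  by move=> wN; rewrite exprMn exprVn wN r0 divr1.
have rel' : ratr t0.1 + ratr t1.1 * (t1.2 / t0.2) + ratr t2.1 * (t2.2 / t0.2) = 0.
  by apply: (mulfI w0); rewrite mulr0 -rel; field.
have [u6 v6 uv2 _] := three_term_relation (hz N0) c0 c1 c2 (quotN _ r1) (quotN _ r2) rel'.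
have w12 : t0.2 ^+ 12 = 1.
  transitivity ((t0.2 * t1.2 * t2.2 * t3.2) ^+ 4); last by rewrite pr expr1n.
  transitivity (t0.2 ^+ 12 * ((t1.2 / t0.2 * (t2.2 / t0.2)) ^+ 2) ^+ 2 * (t3.2 ^+ 2) ^+ 2).
    by rewrite uv2 w3sq expr1n sqrrN expr1n !mulr1.
  by field.
have near (w : F) : (w / t0.2) ^+ 6 = 1 -> w ^+ 12 = 1.
  move=> w6; transitivity (t0.2 ^+ 12 * ((w / t0.2) ^+ 6) ^+ 2).
    by field.
  by rewrite w6 w12 expr1n mulr1.
by right; split; [|exact: near|exact: near|ring: w3sq].
Qed.

(** The product of the classes is 1 and p is odd, so two of the points must be
    inverted with respect to the others. *)
Lemma special_or_mu12_all t0 t1 t2 t3 : vanishing_config t0 t1 t2 t3 -> mu t0 != 1 ->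
  paired t0 t1 -> paired t0 t2 -> paired t0 t3 -> special_or_mu12 t0 t1 t2 t3.
Proof.
move=> vc m1 e1 e2 e3; left.
have [cfg [r0 r1 r2 r3] van] := vc.
have [_ _ pr _] := cfg; have [w0 w1 w2 w3] := config_neq0 cfg.
have mu0 : mu t0 != 0 by rewrite expf_neq0.
have rp := mu_unity r0; have rV := unity_odd p_odd rp m1.
have prM : mu t0 * mu t1 * mu t2 * mu t3 = 1 by rewrite -!exprMn pr expr1n.
have m4 : mu t0 ^+ 2 <> 1.
  by move=> e; case/eqP: rV; apply: (mulfI mu0); rewrite mulfV // -expr2.
have m4' : mu t0 ^+ 4 <> 1.
  move=> e; have rp2 : (mu t0 ^+ 2) ^+ p = 1 by rewrite exprAC rp expr1n.
  have [|m2] := eqVneq (mu t0 ^+ 2) 1; first exact: m4.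
  case/eqP: (unity_odd p_odd rp2 m2); apply: (mulfI (expf_neq0 2 mu0)).
  by rewrite mulfV ?expf_neq0 // -exprD.
have := van _ rp; rewrite (class_term_in _ rV) //.
case/orP: e1 => /eqP e1; case/orP: e2 => /eqP e2; case/orP: e3 => /eqP e3;
  rewrite e1 e2 e3 in prM;
  rewrite ?(class_term_in _ rV e1) ?(class_term_inv _ rV e1);
  rewrite ?(class_term_in _ rV e2) ?(class_term_inv _ rV e2);
  rewrite ?(class_term_in _ rV e3) ?(class_term_inv _ rV e3) => rel.
- by case: m4'; rewrite -prM; ring.
- by case: m4; rewrite -prM; field.
- by case: m4; rewrite -prM; field.
- exact: special_of_inverted_pair.
- by case: m4; rewrite -prM; field.
- apply: special_swap12; apply: special_of_inverted_pair; first exact: config_swap12.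
  by rewrite -rel; ring.
- apply: special_swap23; apply: special_swap12; apply: special_of_inverted_pair.
    by apply: config_swap12; apply: config_swap23.
  by rewrite -rel; ring.
- case: m4; apply: invr_inj; rewrite invr1 -prM; field.
  by rewrite mu0.
Qed.

Lemma special_or_mu12_vanishing t0 t1 t2 t3 : vanishing_config t0 t1 t2 t3 ->
  mu t0 != 1 ->
  special_or_mu12 t0 t1 t2 t3.
Proof.
move=> vc m1; have [cfg _ _] := vc.
have vc12 := vanishing_config_swap12 vc; have vc23 := vanishing_config_swap23 vc.
have [e1|e1] := boolP (paired t0 t1); have [e2|e2] := boolP (paired t0 t2);
  have [e3|e3] := boolP (paired t0 t3).
- exact: special_or_mu12_all.
- exact: special_or_mu12_triple.
- by apply: special_or_mu12_swap23; apply: special_or_mu12_triple.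
- exact: special_or_mu12_couple.
- apply: special_or_mu12_swap12; apply: special_or_mu12_swap23.
  by apply: special_or_mu12_triple => //; apply: vanishing_config_swap23.
- by apply: special_or_mu12_swap12; apply: special_or_mu12_couple.
- apply: special_or_mu12_swap23; apply: special_or_mu12_swap12.
  by apply: special_or_mu12_couple => //; apply: vanishing_config_swap12.
- by case: (alone_contra vc m1 e1 e2 e3).
Qed.

Lemma special_of_vanishing t0 t1 t2 t3 : vanishing_config t0 t1 t2 t3 ->
  [|| mu t0 != 1, mu t1 != 1, mu t2 != 1 | mu t3 != 1] -> special_or_mu12 t0 t1 t2 t3.
Proof.
move=> vc; case/or4P => m.
- exact: special_or_mu12_vanishing.
- apply: special_or_mu12_swap01; apply: special_or_mu12_vanishing => //;
    exact: vanishing_config_swap01.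
- apply: special_or_mu12_swap12; apply: special_or_mu12_swap01;
    apply: special_or_mu12_vanishing => //.
  by apply: vanishing_config_swap01; apply: vanishing_config_swap12.
- apply: special_or_mu12_swap23; apply: special_or_mu12_swap12;
    apply: special_or_mu12_swap01.
  apply: special_or_mu12_vanishing => //.
  by apply: vanishing_config_swap01; apply: vanishing_config_swap12;
    apply: vanishing_config_swap23.
Qed.

End Vanishing.

(** * Class sums with a common nonzero value *)

Lemma third_not_small (q : rat) :
  (3 * q == 1) || (3 * q == -1) -> q \in [:: 0; 1; -1; 2; -2] -> False.
Proof.
rewrite !inE => q3 q5; move: q5 q3.
by case/or4P => [||| /orP []] /eqP -> /orP [] /eqP; lra.
Qed.

(** The linear system that is left in special_five, where e, e1, e2 are the signs
    u3, u1, u2. *)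
Lemma five_coefficients (c0 c1 c2 c3 e e1 e2 : rat) :
  (e == 1) || (e == -1) -> (e1 == 1) || (e1 == -1) -> (e2 == 1) || (e2 == -1) ->
  c0 + c1 + c2 + c3 = 0 -> c3 != 0 ->
  c0 * (2 * (e * e1 * e2)) = e * c3 -> c1 * e1 + c2 * e2 = e * c3 ->
  [/\ e1 = e, e2 = - e, c0 = - c3 / 2, c1 = c3 / 4 & c2 = - 3 * c3 / 4] \/
  [/\ e2 = e, e1 = - e, c0 = - c3 / 2, c2 = c3 / 4 & c1 = - 3 * c3 / 4].
Proof.
case/orP => /eqP ->; case/orP => /eqP ->; case/orP => /eqP -> sum0 c3n R0 R1;
  first [ by case/eqP: c3n; lra | by left; split; lra | by right; split; lra ].
Qed.

(** By genericity c1 = c2 = c3, so c0 = -3 c1, and the trace would be 1/3 or -1/3. *)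
Lemma trace_third (F : numFieldType) (N : nat) (c0 c1 c2 c3 : rat) (w : F) (s : rat) :
  generic c0 c1 c2 c3 -> c1 ^+ 2 = c2 ^+ 2 -> c1 ^+ 2 = c3 ^+ 2 ->
  (0 < N)%N -> w ^+ N = 1 -> s ^+ 2 = c1 ^+ 2 -> ratr c0 * trace w = ratr s ->
  False.
Proof.
move=> gen e12 e13 N0 wN s2 rel.
have [/and4P [c0n c1n c2n c3n] sum0 /and3P [s01 s02 s03]] := gen.
have c12 : c1 = c2.
  move/eqP: e12; rewrite eqf_sqr => /orP [] /eqP // e.
  by case/eqP: s03; lra.
have c13 : c1 = c3.
  move/eqP: e13; rewrite eqf_sqr => /orP [] /eqP // e.
  by case/eqP: s02; lra.
have c0E : c0 = - 3 * c1 by lra.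
have c0F : ratr c0 != 0 :> F by rewrite fmorph_eq0.
have trE : trace w = ratr (s / c0).
  by apply: (mulfI c0F); rewrite rel fmorph_div mulrCA mulfV // mulr1.
apply: (@third_not_small (s / c0)); last exact: rational_trace N0 wN trE.
rewrite c0E; move/eqP: s2; rewrite eqf_sqr => /orP [] /eqP ->.
  by apply/orP; right; apply/eqP; field; rewrite c1n.
by apply/orP; left; apply/eqP; field; rewrite c1n.
Qed.

Lemma prim10_root (F : fieldType) (x : F) :
  (-1 : F) != 1 -> x ^+ 5 = 1 -> x != 1 -> 10.-primitive_root (- x ^+ 3).
Proof.
move=> n1 x5 x1; set g := - x ^+ 3.
have g10 : g ^+ 10 = 1 by rewrite /g; ring: x5.
have [m pm m10] := prim_order_exists (isT : 0 < 10)%N g10.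
have : ~~ (m %| 5)%N.
  by rewrite (prim_order_dvd pm) (_ : g ^+ 5 = -1) // /g; ring: x5.
have : ~~ (m %| 2)%N.
  rewrite (prim_order_dvd pm) (_ : g ^+ 2 = x) // /g.
  by ring: x5.
move: m10 pm; rewrite dvdn_divisors // => m10.
by move: m10; rewrite !inE => /or4P [] /eqP ->.
Qed.

(** The case p = 5 with classes 1, rho, rho, rho^3.  The class of t3 makes u3 equal
    to 1 or -1, and then t1.1 u1 + t2.1 u2 is a rational three-term relation. *)
Lemma special_five (F : numFieldType) (N : nat) (zeta : nat -> F) (xi v : F)
    (u0 u1 u2 u3 : F) (t0 t1 t2 t3 : rat * F) :
  (forall m, (0 < m)%N -> m.-primitive_root (zeta m)) ->
  config t0 t1 t2 t3 -> (0 < N)%N ->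
  [/\ u0 ^+ N = 1, u1 ^+ N = 1, u2 ^+ N = 1 & u3 ^+ N = 1] ->
  u0 * u1 * u2 * u3 = 1 -> xi ^+ 5 = 1 -> xi != 1 ->
  [/\ t0.2 = u0, t1.2 = u1 * xi, t2.2 = u2 * xi & t3.2 = u3 * xi ^+ 3] ->
  [/\ ratr t0.1 * trace u0 = v, ratr t1.1 * u1 + ratr t2.1 * u2 = v,
      ratr t3.1 * u3 = v & ratr t3.1 * u3^-1 = v] ->
  special t0 t1 t2 t3.
Proof.
move=> hz cfg N0 [r0 r1 r2 r3] pr xi5 xi1 [E0 E1 E2 E3] [V0 V1 V3 V3'].
have [gen _ _ _] := cfg.
have [/and4P [c0n c1n c2n c3n] sum0 /and3P [s01 s02 s03]] := gen.
have c3F : ratr t3.1 != 0 :> F by rewrite fmorph_eq0.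
have u0n := unity_neq0 N0 r0; have u3n := unity_neq0 N0 r3.
have [e e2 u3E] : exists2 e : rat, e ^+ 2 = 1 & u3 = ratr e.
  have : u3 = u3^-1 by apply: (mulfI c3F); rewrite V3 V3'.
  move=> e; have /eqP : u3 ^+ 2 = 1 by rewrite expr2 {2}e mulfV.
  rewrite sqrf_eq1 => /orP [] /eqP ->.
    by exists 1; rewrite ?expr1n ?rmorph1.
  by exists (-1); rewrite ?sqrrN ?expr1n ?rmorphN ?rmorph1.
have eF : (ratr e : F) ^+ 2 = 1 by rewrite -rmorphXn e2 rmorph1.
have en : e != 0 by apply: contra_eq_neq e2 => ->; rewrite expr0n eq_sym oner_eq0.
have vE : v = ratr (e * t3.1) by rewrite -V3 u3E rmorphM mulrC.
have rel : ratr (- (e * t3.1)) + ratr t1.1 * u1 + ratr t2.1 * u2 = 0.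
  by rewrite rmorphN /= -vE -V1; ring.
have an : - (e * t3.1) != 0 by rewrite oppr_eq0 mulf_neq0.
have [_ _ _ dich] := three_term_relation (hz N N0) an c1n c2n r1 r2 rel.
case: dich => [[u1s u2s]|[q1 q2]]; last first.
  rewrite sqrrN exprMn e2 mul1r in q1 q2.
  case: (@trace_third _ N _ _ _ _ u0 (e * t3.1) gen _ _ N0 r0).
  - by rewrite q1 q2.
  - exact: q1.
  - by rewrite exprMn e2 mul1r q1.
  - by rewrite V0 vE.
have n1 : (-1 : F) != 1.
  by rewrite eq_sym -subr_eq0 opprK -(natrD _ 1 1) pnatr_eq0.
have rat_sign (w : F) : w ^+ 2 = 1 ->
    exists2 f : rat, (f == 1) || (f == -1) & w = ratr f.
  move/eqP; rewrite sqrf_eq1 => /orP [] /eqP ->.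
    by exists 1; rewrite ?eqxx ?rmorph1.
  by exists (-1); rewrite ?eqxx ?orbT ?rmorphN ?rmorph1.
have [e1 e1s u1E] := rat_sign _ u1s; have [e2' e2s u2E] := rat_sign _ u2s.
have es : (e == 1) || (e == -1) by move/eqP: e2; rewrite sqrf_eq1.
have sqs (f : rat) : (f == 1) || (f == -1) -> (ratr f : F) ^+ 2 = 1.
  by case/orP => /eqP ->; rewrite ?rmorphN rmorph1 ?sqrrN expr1n.
have u0E : u0 = ratr (e * e1 * e2').
  rewrite -[LHS]mulr1 -(sqs _ e1s) -(mulr1 (u0 * _)) -(sqs _ e2s).
  rewrite -[LHS]mulr1 -eF !rmorphM -[RHS]mulr1 -pr u1E u2E u3E.
  by ring: eF (sqs _ e1s) (sqs _ e2s).
have fin (a b : rat * F) : config t0 a b t3 -> u0 = - ratr e ->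
    a.2 = ratr e * xi -> b.2 = - (ratr e * xi) ->
    t0.1 = - t3.1 / 2 -> a.1 = t3.1 / 4 -> b.1 = - 3 * t3.1 / 4 ->
    special t0 a b t3.
  move=> cfgab u0e aE bE c0 ca cb; apply: special_swap01; apply: special_swap23.
  apply: (special10 (k := t3.1 / 4) (prim10_root n1 xi5 xi1)).
  - by rewrite E0 E3 u0e u3E; ring: eF.
  - by rewrite E0 bE u0e; ring: eF xi5.
  - by rewrite E3 bE u3E; ring: eF xi5.
  - exact: ca.
  - by rewrite c0; field.
  - by field.
  - by rewrite cb; field.
have R0 : t0.1 * (2 * (e * e1 * e2')) = e * t3.1.
  apply: (fmorph_inj (ratr : {rmorphism rat -> F})); rewrite /= -vE -V0.
  rewrite rmorphM rmorphM rmorph_nat /= -u0E; congr (_ * _).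
  apply: (mulfI u0n); rewrite /trace mulrDr mulfV // u0E !rmorphM.
  by ring: eF (sqs _ e1s) (sqs _ e2s).
have R1 : t1.1 * e1 + t2.1 * e2' = e * t3.1.
  apply: (fmorph_inj (ratr : {rmorphism rat -> F})).
  by rewrite /= -vE -V1 rmorphD !rmorphM u1E u2E.
case: (five_coefficients es e1s e2s sum0 c3n R0 R1) => -[ea eb c0 ca cb].
  apply: fin => //.
  - by rewrite u0E ea eb !rmorphM rmorphN; ring: eF.
  - by rewrite E1 u1E ea.
  - by rewrite E2 u2E eb rmorphN mulNr.
apply: special_swap12; apply: fin => //; first exact: config_swap12.
- by rewrite u0E ea eb !rmorphM rmorphN; ring: eF.
- by rewrite E2 u2E ea.
- by rewrite E1 u1E eb rmorphN mulNr.
Qed.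

Section Exceptional.

Variables (F : numFieldType) (zeta : nat -> F) (p M k : nat) (v : F).
Hypothesis hz : forall m, (0 < m)%N -> m.-primitive_root (zeta m).
Hypotheses (p_odd : odd p) (M_gt0 : (0 < M)%N) (v_neq0 : v != 0).
Implicit Types t : rat * F.
Local Notation N := (p * M)%N.
Local Notation mu t := (t.2 ^+ M).

Let p_gt0 : (0 < p)%N := odd_gt0 p_odd.
Let N_gt0 : (0 < N)%N. Proof. by rewrite muln_gt0 p_gt0. Qed.

Definition equal_classes t0 t1 t2 t3 : Prop :=
  [/\ config t0 t1 t2 t3,
      [/\ t0.2 ^+ N = 1, t1.2 ^+ N = 1, t2.2 ^+ N = 1 & t3.2 ^+ N = 1]
    & forall rho : F, rho ^+ p = 1 ->
      class_term M t0 rho (t0.2 ^+ k) + class_term M t1 rho (t1.2 ^+ k)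
      + class_term M t2 rho (t2.2 ^+ k) + class_term M t3 rho (t3.2 ^+ k) = v].

Lemma equal_classes_swap01 t0 t1 t2 t3 : equal_classes t0 t1 t2 t3 ->
  equal_classes t1 t0 t2 t3.
Proof.
move=> [cfg [? ? ? ?] bal]; split=> //; first exact: config_swap01.
by move=> rho rp; rewrite -(bal rho rp); ring.
Qed.

Lemma equal_classes_swap12 t0 t1 t2 t3 : equal_classes t0 t1 t2 t3 ->
  equal_classes t0 t2 t1 t3.
Proof.
move=> [cfg [? ? ? ?] bal]; split=> //; first exact: config_swap12.
by move=> rho rp; rewrite -(bal rho rp); ring.
Qed.

Lemma equal_classes_swap23 t0 t1 t2 t3 : equal_classes t0 t1 t2 t3 ->
  equal_classes t0 t1 t3 t2.
Proof.
move=> [cfg [? ? ? ?] bal]; split=> //; first exact: config_swap23.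
by move=> rho rp; rewrite -(bal rho rp); ring.
Qed.

(** A class without points would have sum zero. *)
Lemma equal_classes_cover t0 t1 t2 t3 (rho : F) : equal_classes t0 t1 t2 t3 ->
  rho ^+ p = 1 ->
  rho \in [:: mu t0; (mu t0)^-1; mu t1; (mu t1)^-1; mu t2; (mu t2)^-1;
              mu t3; (mu t3)^-1].
Proof.
move=> [cfg _ bal] rp; apply: contraT; rewrite !inE !negb_or.
case/and5P => a0 b0 a1 b1 /and4P [a2 b2 a3 b3].
have flip (x y : F) : x != y^-1 -> y != x^-1.
  by apply: contra => /eqP ->; rewrite invrK.
case/eqP: v_neq0; rewrite -(bal rho rp) !class_term_out ?addr0 //;
  by [rewrite eq_sym | exact: flip].
Qed.

Lemma equal_classes_trivial t0 t1 t2 t3 : equal_classes t0 t1 t2 t3 ->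
  [|| mu t0 == 1, mu t1 == 1, mu t2 == 1 | mu t3 == 1].
Proof.
move=> /equal_classes_cover /(_ (expr1n _ p)); rewrite !inE.
rewrite ![_ == _^-1]eq_sym !invr_eq1 ![1 == _]eq_sym.
by do 7?[case/orP]; move=> ->; rewrite ?orbT.
Qed.

(** One point is in the trivial class, and each other point meets at most two
    classes. *)
Lemma equal_classes_size t0 t1 t2 t3 : equal_classes t0 t1 t2 t3 -> mu t0 = 1 ->
  (p <= 7)%N /\ (p = 7%N ->
    uniq [:: 1; mu t1; (mu t1)^-1; mu t2; (mu t2)^-1; mu t3; (mu t3)^-1]).
Proof.
move=> bal m0; pose s := [:: 1; mu t1; (mu t1)^-1; mu t2; (mu t2)^-1; mu t3;
  (mu t3)^-1].
have pz := hz p_gt0.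
pose r := [seq zeta p ^+ i | i <- iota 0 p].
have uniq_r : uniq r.
  rewrite map_inj_in_uniq ?iota_uniq // => i j; rewrite !mem_iota !add0n /= => ip jp.
  by move/eqP; rewrite (eq_prim_root_expr pz) !modn_small // => /eqP.
have sub : {subset r <= s}.
  move=> rho /mapP [i _ rhoE]; have rp : rho ^+ p = 1.
    by rewrite rhoE exprAC (prim_expr_order pz) expr1n.
  have := equal_classes_cover bal rp; rewrite m0 invr1 !inE.
  by rewrite orbA orbb.
have size_r : size r = p by rewrite size_map size_iota.
split; first by rewrite -size_r (uniq_leq_size uniq_r sub).
by move=> p7; apply: (leq_size_uniq uniq_r sub); rewrite size_r p7.
Qed.

(** The class of t1 and the inverse class consist of a single term each, so c w^k
    and c/w^k are both equal to v, and w^k is 1 or -1. *)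
Lemma equal_classes_isolated t0 t1 t2 t3 : equal_classes t0 t1 t2 t3 ->
  mu t0 = 1 -> mu t1 != 1 ->
  [&& mu t2 != mu t1, mu t2 != (mu t1)^-1, mu t3 != mu t1 & mu t3 != (mu t1)^-1] ->
  ratr t1.1 * t1.2 ^+ k = v /\ ratr t1.1 * (t1.2 ^+ k)^-1 = v.
Proof.
move=> [cfg [r0 r1 r2 r3] bal] m0 m1 /and4P [n2 n2V n3 n3V].
have rp : mu t1 ^+ p = 1 by rewrite -exprM mulnC.
have rV := unity_odd p_odd rp m1.
have rVp : (mu t1)^-1 ^+ p = 1 by rewrite exprVn rp invr1.
have rVV : (mu t1)^-1 != (mu t1)^-1^-1 by rewrite invrK eq_sym.
have m1V : (mu t1)^-1 != 1 by rewrite invr_eq1.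
have a0 : mu t0 != mu t1 by rewrite m0 eq_sym.
have b0 : mu t0 != (mu t1)^-1 by rewrite m0 eq_sym.
split.
  rewrite -(bal _ rp) (class_term_in _ rV erefl) (class_term_out _ a0 b0).
  by rewrite (class_term_out _ n2 n2V) (class_term_out _ n3 n3V) add0r !addr0.
have m1VV : mu t1 = (mu t1)^-1^-1 by rewrite invrK.
rewrite -(bal _ rVp) (class_term_inv _ rVV m1VV).
rewrite (class_term_out _ b0) ?invrK // (class_term_out _ n2V) ?invrK //.
by rewrite (class_term_out _ n3V) ?invrK // add0r !addr0.
Qed.

Lemma root_sqr (c d : rat) (w w' : F) : w != 0 -> w' != 0 ->
  ratr c * w = v -> ratr c * w^-1 = v -> ratr d * w' = v -> ratr d * w'^-1 = v ->
  c ^+ 2 = d ^+ 2.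
Proof.
move=> w0 w0' e1 e2 e3 e4; apply: (fmorph_inj (ratr : {rmorphism rat -> F})).
rewrite /= !rmorphXn /=.
transitivity ((ratr c * w) * (ratr c * w^-1)); first by field.
by rewrite e1 e2 -{1}e3 -e4; field.
Qed.

(** With seven classes the three nontrivial points are isolated, so their
    coefficients have the same absolute value, and trace_third applies. *)
Lemma equal_classes7_contra t0 t1 t2 t3 : equal_classes t0 t1 t2 t3 -> mu t0 = 1 ->
  p = 7%N -> False.
Proof.
move=> bal m0 p7; have [_ /(_ p7)] := equal_classes_size bal m0.
rewrite /= !inE !negb_or.
case/andP=> /and5P [n01 _ n03 _ /andP [n05 _]].
case/andP=> /and5P [_ n13 n14 n15 n16].
case/andP=> /and4P [n23 n24 n25 n26].
case/andP=> /and3P [_ n35 n36]; case/andP=> /andP [n45 n46] _.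
have bal2 := equal_classes_swap12 bal; have bal3 := equal_classes_swap12 (equal_classes_swap23 bal).
have flip (x y : F) : x != y^-1 -> y != x^-1.
  by apply: contra => /eqP ->; rewrite invrK.
have [cfg [r0 r1 r2 r3] cls] := bal.
have [gen _ _ _] := cfg.
have [w0 w1 w2 w3] := config_neq0 cfg.
have [e1 e1'] : ratr t1.1 * t1.2 ^+ k = v /\ ratr t1.1 * (t1.2 ^+ k)^-1 = v.
  apply: (equal_classes_isolated bal m0); first by rewrite eq_sym.
  by apply/and4P; split; rewrite 1?eq_sym.
have [e2 e2'] : ratr t2.1 * t2.2 ^+ k = v /\ ratr t2.1 * (t2.2 ^+ k)^-1 = v.
  apply: (equal_classes_isolated bal2 m0); first by rewrite eq_sym.
  by apply/and4P; split; rewrite 1?eq_sym // eq_sym.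
have [e3 e3'] : ratr t3.1 * t3.2 ^+ k = v /\ ratr t3.1 * (t3.2 ^+ k)^-1 = v.
  apply: (equal_classes_isolated bal3 m0); first by rewrite eq_sym.
  by apply/and4P; split; rewrite 1?eq_sym // eq_sym.
have w1k := expf_neq0 k w1; have w2k := expf_neq0 k w2; have w3k := expf_neq0 k w3.
have n1 := eq_sym 1 (mu t1); have n2 := eq_sym 1 (mu t2).
have n3 := eq_sym 1 (mu t3).
have := cls 1 (expr1n _ _); rewrite (class_term1 _ m0).
rewrite !class_term_out ?invr1 -?n1 -?n2 -?n3 // !addr0 => e0.
have [s s2 w1E] : exists2 s : rat, s ^+ 2 = 1 & t1.2 ^+ k = ratr s.
  have c1F : ratr t1.1 != 0 :> F.
    by rewrite fmorph_eq0; have [/and4P [_ ? _ _] _ _] := gen.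
  have /eqP : (t1.2 ^+ k) ^+ 2 = 1.
    have e : t1.2 ^+ k = (t1.2 ^+ k)^-1 by apply: (mulfI c1F); rewrite e1 e1'.
    by rewrite expr2 {2}e mulfV.
  rewrite sqrf_eq1 => /orP [] /eqP ->.
    by exists 1; rewrite ?expr1n ?rmorph1.
  by exists (-1); rewrite ?sqrrN ?expr1n ?rmorphN ?rmorph1.
have r0k : (t0.2 ^+ k) ^+ N = 1 by rewrite exprAC r0 expr1n.
apply: (@trace_third _ N _ _ _ _ _ (t1.1 * s) gen _ _ N_gt0 r0k).
- exact: root_sqr e1 e1' e2 e2'.
- exact: root_sqr e1 e1' e3 e3'.
- by rewrite exprMn s2 mulr1.
- by rewrite e0 -e1 w1E rmorphM.
Qed.

(** Passing from w to w^k, where k = 1 + M ts is divisible by 5, removes the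
    factor of order 5; xi restores it. *)
Lemma equal_classes5_core (ts : nat) (rho : F) t0 t1 t2 t3 :
  p = 5%N -> k = (M * ts).+1 -> (5 %| k)%N -> equal_classes t0 t1 t2 t3 ->
  rho ^+ 5 = 1 -> rho != 1 ->
  [/\ mu t0 = 1, mu t1 = rho, mu t2 = rho & mu t3 = rho ^+ 3] ->
  special t0 t1 t2 t3.
Proof.
move=> p5 kE k5 [cfg [r0 r1 r2 r3] bal] rho5 rho1 [m0 m1 m2 m3].
have [_ _ pr _] := cfg.
have rhon : rho != 0 by apply: unity_neq0 rho5.
have p5' : 5.-primitive_root rho.
  have [m pm m5] := prim_order_exists (isT : 0 < 5)%N rho5.
  have m1' : m != 1%N.
    by apply: contra_neq rho1 => mE; have := prim_expr_order pm; rewrite mE.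
  by move: m5 pm; rewrite dvdn_divisors // !inE (negPf m1') => /eqP ->.
have pw i j : (rho ^+ i == rho ^+ j) = (i == j %[mod 5]) := eq_prim_root_expr p5' i j.
have inv j : (j <= 5)%N -> (rho ^+ j)^-1 = rho ^+ (5 - j).
  move=> j5; apply: (mulfI (expf_neq0 j rhon)).
  by rewrite mulfV ?expf_neq0 // -exprD subnKC.
have out t i j w : mu t = rho ^+ i -> (j <= 5)%N -> i != j %[mod 5] ->
    i != (5 - j)%N %[mod 5] -> class_term M t (rho ^+ j) w = 0.
  by move=> mt j5 ij ij'; rewrite class_term_out // mt ?inv // pw.
have self t j w : mu t = rho ^+ j -> (0 < j < 5)%N ->
    class_term M t (rho ^+ j) w = ratr t.1 * w.
  move=> mt; case: j mt => [|[|[|[|[|j]]]]] // mt _;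
  by rewrite (class_term_in _ _ mt) // inv // pw.
have cls j : class_term M t0 (rho ^+ j) (t0.2 ^+ k)
    + class_term M t1 (rho ^+ j) (t1.2 ^+ k)
    + class_term M t2 (rho ^+ j) (t2.2 ^+ k)
    + class_term M t3 (rho ^+ j) (t3.2 ^+ k) = v.
  by apply: bal; rewrite p5 exprAC rho5 expr1n.
rewrite -[rho]expr1 in m1 m2.
have m0' : mu t0 = rho ^+ 0 by rewrite expr0.
have V0 : ratr t0.1 * trace (t0.2 ^+ k) = v.
  rewrite -(cls 0%N) (out t1 1%N) // (out t2 1%N) // (out t3 3%N) //.
  by rewrite expr0 class_term1 // !addr0.
have V1 : ratr t1.1 * t1.2 ^+ k + ratr t2.1 * t2.2 ^+ k = v.
  rewrite -(cls 1%N) (out t0 0%N) // (self t1) // (self t2) // (out t3 3%N) //.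
  by rewrite add0r addr0.
have V3 : ratr t3.1 * t3.2 ^+ k = v.
  rewrite -(cls 3%N) (out t0 0%N) // (self t3) // (out t1 1%N) // (out t2 1%N) //.
  by rewrite !add0r.
have V3' : ratr t3.1 * (t3.2 ^+ k)^-1 = v.
  rewrite -(cls 2%N) (out t0 0%N) // (out t1 1%N) // (out t2 1%N) //.
  by rewrite (class_term_inv _ _ (_ : _ = (rho ^+ 2)^-1)) ?inv ?pw // !add0r.
pose xi := (rho ^+ ts)^-1.
have kth (w x : F) : w != 0 -> w ^+ M = x -> x != 0 -> w = w ^+ k * (x ^+ ts)^-1.
  move=> w0 wM x0; rewrite kE exprS exprM wM mulfK // expf_neq0 //.
have xi5 : xi ^+ 5 = 1 by rewrite exprVn exprAC rho5 expr1n invr1.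
have xi1 : xi != 1.
  rewrite invr_eq1; apply: contra_neq rho1 => e.
  transitivity (rho ^+ k); first by rewrite kE exprS mulnC exprM e expr1n mulr1.
  by case/dvdnP: k5 => q ->; rewrite mulnC exprM rho5 expr1n.
have [w0 w1 w2 w3] := config_neq0 cfg.
apply: (special_five (xi := xi) (v := v) (u0 := t0.2 ^+ k) (u1 := t1.2 ^+ k)
  (u2 := t2.2 ^+ k) (u3 := t3.2 ^+ k) hz cfg N_gt0) => //.
- by split; rewrite exprAC (r0, r1, r2, r3) expr1n.
- by rewrite -!exprMn pr expr1n.
split.
- by rewrite {1}(kth _ 1 w0 m0) ?oner_neq0 // expr1n divr1.
- by rewrite {1}(kth _ _ w1 m1) ?expf_neq0 // expr1.
- by rewrite {1}(kth _ _ w2 m2) ?expf_neq0 // expr1.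
- by rewrite {1}(kth _ _ w3 m3) ?expf_neq0 // /xi exprVn -!exprM mulnC.
Qed.

(** The exponents of four fifth roots of unity with product 1 which, with their
    inverses, exhaust the fifth roots of unity.  The four patterns are the multiples
    of the first one. *)
Lemma five_patterns (k0 k1 k2 k3 : nat) :
  [&& k0 <= k1, k1 <= k2, k2 <= k3, k3 < 5 & 5 %| k0 + k1 + k2 + k3]%N ->
  all (fun r => has (fun j => (r == j) || (5 %| r + j)%N) [:: k0; k1; k2; k3])
    (iota 0 5) ->
  [:: k0; k1; k2; k3] \in
    [:: [:: 0; 1; 1; 3]; [:: 0; 1; 2; 2]; [:: 0; 2; 4; 4]; [:: 0; 3; 3; 4]]%N.
Proof.
case/and5P.
by case: k3 => [|[|[|[|[|k3]]]]] //; case: k2 => [|[|[|[|[|k2]]]]] //;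
   case: k1 => [|[|[|[|[|k1]]]]] //; case: k0 => [|[|[|[|[|k0]]]]] //.
Qed.

Lemma special_equal_classes5 (ts : nat) t0 t1 t2 t3 :
  p = 5%N -> k = (M * ts).+1 -> (5 %| k)%N -> equal_classes t0 t1 t2 t3 ->
  special t0 t1 t2 t3.
Proof.
move=> p5 kE k5; have p5' := hz (isT : 0 < 5)%N; set eta := zeta 5 in p5'.
pose key t := unity_log 5 eta (mu t).
have keyP t : t.2 ^+ N = 1 -> (key t < 5)%N /\ mu t = eta ^+ key t.
  by move=> tN; apply: (unity_logP p5'); rewrite -exprM mulnC -p5.
apply: (@wlog_sorted _ key (fun t0 t1 t2 t3 =>
  equal_classes t0 t1 t2 t3 -> special t0 t1 t2 t3)) => {}t0 {}t1 {}t2 {}t3.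
- by move=> IH /equal_classes_swap01 /IH; apply: special_swap01.
- by move=> IH /equal_classes_swap12 /IH; apply: special_swap12.
- by move=> IH /equal_classes_swap23 /IH; apply: special_swap23.
move=> le01 le12 le23 bal.
have [cfg [/keyP [l0 m0] /keyP [l1 m1] /keyP [l2 m2] /keyP [l3 m3]] _] := bal.
have [_ _ pr _] := cfg.
have pw i j : (eta ^+ i == eta ^+ j) = (i == j %[mod 5]) := eq_prim_root_expr p5' i j.
have etan : eta != 0 by rewrite (prim_root_eq0 p5').
have srt : [&& key t0 <= key t1, key t1 <= key t2, key t2 <= key t3, key t3 < 5
    & 5 %| key t0 + key t1 + key t2 + key t3]%N.
  rewrite le01 le12 le23 l3 /= (prim_order_dvd p5') !exprD -m0 -m1 -m2 -m3.
  by rewrite -!exprMn pr expr1n.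
have cov : all (fun r => has (fun j => (r == j) || (5 %| r + j)%N)
    [:: key t0; key t1; key t2; key t3]) (iota 0 5).
  apply/allP => r; rewrite mem_iota add0n /= => r5.
  have rp : (eta ^+ r) ^+ p = 1 by rewrite p5 exprAC (prim_expr_order p5') expr1n.
  have same j : (j < 5)%N -> eta ^+ r = eta ^+ j -> r == j.
    by move=> j5 /eqP; rewrite pw !modn_small.
  have opp j : eta ^+ r = (eta ^+ j)^-1 -> (5 %| r + j)%N.
    by move=> e; rewrite (prim_order_dvd p5') exprD e mulVf ?expf_neq0.
  have := equal_classes_cover bal rp; rewrite !inE m0 m1 m2 m3 orbF.
  do 7?[case/orP]; move=> /eqP;
    by [move/same=> -> //; rewrite ?orbT | move/opp=> ->; rewrite ?orbT].
have core rho s0 s1 s2 s3 := @equal_classes5_core ts rho s0 s1 s2 s3 p5 kE k5.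
have bal' : equal_classes t0 t2 t3 t1 := equal_classes_swap23 (equal_classes_swap12 bal).
have rp i : (eta ^+ i) ^+ 5 = 1 by rewrite exprAC (prim_expr_order p5') expr1n.
have pw1 i : (eta ^+ i == 1) = (5 %| i)%N by rewrite (prim_order_dvd p5').
have mod5 i j : i = j %[mod 5] -> eta ^+ i = eta ^+ j.
  by move/eqP; rewrite -pw => /eqP.
have := five_patterns srt cov; rewrite !inE.
do ?case/orP; move=> /eqP [q0 q1 q2 q3]; rewrite q0 q1 q2 q3 in m0 m1 m2 m3.
- by apply: (core (eta ^+ 1) _ _ _ _ bal); rewrite ?pw1 //; split;
    rewrite ?m0 ?m1 ?m2 ?m3 -?exprM.
- do [apply: special_swap12; apply: special_swap23].
  apply: (core (eta ^+ 2) _ _ _ _ bal'); rewrite ?pw1 //; split;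
    rewrite ?m0 ?m1 ?m2 ?m3 -?exprM //.
  exact: mod5.
- do [apply: special_swap12; apply: special_swap23].
  apply: (core (eta ^+ 4) _ _ _ _ bal'); rewrite ?pw1 //; split;
    rewrite ?m0 ?m1 ?m2 ?m3 -?exprM //.
  exact: mod5.
- apply: (core (eta ^+ 3) _ _ _ _ bal); rewrite ?pw1 //; split;
    rewrite ?m0 ?m1 ?m2 ?m3 -?exprM //.
  exact: mod5.
Qed.

End Exceptional.

(** * The classification *)

Section Classification.

Variables (F : numFieldType) (zeta : nat -> F).
Hypothesis hz : forall m, (0 < m)%N -> m.-primitive_root (zeta m).
Implicit Types t : rat * F.

Definition unity4 (m : nat) t0 t1 t2 t3 : Prop :=
  [/\ t0.2 ^+ m = 1, t1.2 ^+ m = 1, t2.2 ^+ m = 1 & t3.2 ^+ m = 1].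

Definition minimal_order (N : nat) t0 t1 t2 t3 : Prop :=
  [/\ (0 < N)%N, unity4 N t0 t1 t2 t3
    & forall m, unity4 m t0 t1 t2 t3 -> (N %| m)%N].

Lemma minimal_order_exists t0 t1 t2 t3 : config t0 t1 t2 t3 ->
  exists N, minimal_order N t0 t1 t2 t3.
Proof.
move=> [_ [m m0 [r0 r1 r2 r3]] _ _].
have [n0 p0 _] := prim_order_exists m0 r0; have [n1 p1 _] := prim_order_exists m0 r1.
have [n2 p2 _] := prim_order_exists m0 r2; have [n3 p3 _] := prim_order_exists m0 r3.
exists (lcmn (lcmn n0 n1) (lcmn n2 n3)); split.
- by rewrite !lcmn_gt0 (prim_order_gt0 p0) (prim_order_gt0 p1)
    (prim_order_gt0 p2) (prim_order_gt0 p3).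
- split; apply/eqP.
  + rewrite -(prim_order_dvd p0); apply: dvdn_trans (dvdn_lcml _ _); exact: dvdn_lcml.
  + rewrite -(prim_order_dvd p1); apply: dvdn_trans (dvdn_lcml _ _); exact: dvdn_lcmr.
  + rewrite -(prim_order_dvd p2); apply: dvdn_trans (dvdn_lcmr _ _); exact: dvdn_lcml.
  + rewrite -(prim_order_dvd p3); apply: dvdn_trans (dvdn_lcmr _ _); exact: dvdn_lcmr.
move=> j [/eqP j0 /eqP j1 /eqP j2 /eqP j3].
by rewrite !dvdn_lcm (prim_order_dvd p0) (prim_order_dvd p1)
    (prim_order_dvd p2) (prim_order_dvd p3) j0 j1 j2 j3.
Qed.

(** By minimality of the order some point is outside the trivial class, so
    special_of_vanishing applies; its second alternative would make the order a
    divisor of 12. *)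
Lemma special_of_conj_sums (p M : nat) t0 t1 t2 t3 :
  odd p -> prime p -> config t0 t1 t2 t3 ->
  minimal_order (p * M) t0 t1 t2 t3 -> ~~ (p * M %| 12)%N ->
  (forall j, (0 < j < p)%N -> conj_sum t0 t1 t2 t3 (1 + M * j) = 0) ->
  special t0 t1 t2 t3.
Proof.
move=> p_odd p_pr cfg [N0 rN min] N12 conj0.
have M0 : (0 < M)%N by move: N0; rewrite muln_gt0 => /andP [].
have wn := config_neq0 cfg.
have van : vanishing p M t0 t1 t2 t3.
  move=> rho rp; have := class_sumE (k := 1) p_odd rN wn conj0 rp.
  have [_ _ _ rel] := cfg; rewrite /conj_sum !expr1 rel => /eqP.
  rewrite mulf_eq0 pnatr_eq0 -leqn0 leqNgt odd_gt0 //=.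
  by move/eqP.
have vc : vanishing_config p M t0 t1 t2 t3 by [].
case: (special_of_vanishing hz p_odd M0 vc) => //.
- apply: contraT; rewrite !negb_or !negbK => /and4P [/eqP e0 /eqP e1 /eqP e2 /eqP e3].
  have : (p * M %| M)%N by apply: min; split.
  move/(dvdn_leq M0); rewrite leqNgt ltn_Pmull ?prime_gt1 //.
- by move/min; rewrite (negPf N12).
Qed.

(** The exponents 1 + M j are prime to M.  If p divides M all of them give
    conjugations.  Otherwise there is exactly one exception modulo p, the multiple
    k of p.  If the sum at k vanishes too, the first case applies; if not, all
    class sums are equal and nonzero, and every p-th root of unity must be a
    class.  Four points do not suffice for this unless p is 5 or 7. *)
Lemma special_odd_prime (p M : nat) t0 t1 t2 t3 :
  odd p -> prime p -> config t0 t1 t2 t3 ->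
  minimal_order (p * M) t0 t1 t2 t3 -> (p %| M)%N || (p != 3)%N ->
  special t0 t1 t2 t3.
Proof.
move=> p_odd p_pr cfg min side; have [N0 rN _] := min.
have M0 : (0 < M)%N by move: N0; rewrite muln_gt0 => /andP [].
have N12 : ~~ (p * M %| 12)%N.
  have p12 : (p %| 12)%N -> p = 3%N.
    rewrite dvdn_divisors // => p_in; move: p_odd p_pr; move: p_in.
    by rewrite !inE => /or4P [||| /or3P []] /eqP ->.
  apply/negP => d12; have p3 := p12 (dvdn_trans (dvdn_mulr M (dvdnn p)) d12).
  move: side; rewrite p3 orbF => /dvdnP [q qE]; move: d12.
  by rewrite p3 qE mulnCA => /(dvdn_trans (dvdn_mull q (dvdnn 9))).
have p0 := prime_gt0 p_pr.
have conj0 j : coprime (1 + M * j) (p * M) -> conj_sum t0 t1 t2 t3 (1 + M * j) = 0.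
  by move=> co; have [] := config_pow (hz N0) co cfg rN.
have coM j : coprime (1 + M * j) M.
  by apply: coprime_dvdr (dvdn_mulr j (dvdnn M)) _; rewrite add1n coprimeSn.
have coN j : coprime (1 + M * j) p -> coprime (1 + M * j) (p * M).
  by move=> co; rewrite coprimeMr co coM.
have [pM|pNM] := boolP (p %| M)%N.
  apply: (special_of_conj_sums p_odd p_pr cfg min N12) => j _.
  by apply/conj0/coN; apply: coprime_dvdr pM _.
have p3 : (p != 3)%N by move: side; rewrite (negPf pNM).
have coMp : coprime M p by rewrite coprime_sym prime_coprime.
have [ts ts_p kp] : exists2 ts, (ts < p)%N & (p %| 1 + M * ts)%N.
  have g1 : gcdn p M = 1%N by apply/eqP; rewrite -[_ == _]/(coprime p M) coprime_sym.
  by have [ts ts_p] := Bezoutl M p0; rewrite g1 mulnC => kp; exists ts.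
have shift j j' : (0 < j' < p)%N -> ~~ ((p %| 1 + M * j) && (p %| 1 + M * (j + j')))%N.
  move=> /andP [j'0 j'p]; apply/negP => /andP [d d'].
  have : (p %| M * j')%N by rewrite -(dvdn_addr _ d) -addnA -mulnDr.
  rewrite Euclid_dvdM // (negPf pNM) /= => /(dvdn_leq j'0).
  by rewrite leqNgt j'p.
have [V0|Vn] := eqVneq (conj_sum t0 t1 t2 t3 (1 + M * ts)) 0.
  apply: (special_of_conj_sums p_odd p_pr cfg min N12) => j /andP [j0 jp].
  have [-> //|jts] := eqVneq j ts.
  apply/conj0/coN; rewrite coprime_sym prime_coprime //; apply/negP => dj.
  have [lt|le] := ltnP j ts.
    have := shift j (ts - j)%N; rewrite subnKC ?(ltnW lt) // dj kp subn_gt0 lt.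
    by rewrite (leq_ltn_trans (leq_subr _ _) ts_p) => /(_ isT).
  have lt : (ts < j)%N by rewrite ltn_neqAle eq_sym jts le.
  have := shift ts (j - ts)%N; rewrite subnKC // dj kp subn_gt0 lt.
  by rewrite (leq_ltn_trans (leq_subr _ _) jp) => /(_ isT).
have pF : (p%:R : F) != 0 by rewrite pnatr_eq0 -lt0n.
pose k := (1 + M * ts)%N; pose v := conj_sum t0 t1 t2 t3 k / p%:R.
have v0 : v != 0 by rewrite mulf_neq0 ?invr_neq0.
have bal : equal_classes p M k v t0 t1 t2 t3.
  split=> // rho rp; apply: (mulfI pF); rewrite [RHS]mulrCA mulfV // mulr1.
  apply: (class_sumE p_odd rN (config_neq0 cfg)) rp => j j_p.
  rewrite /k -addnA -mulnDr; apply/conj0/coN.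
  rewrite coprime_sym prime_coprime //.
  by have := shift ts j j_p; rewrite kp.
have [p5|p5] := eqVneq p 5%N.
  by apply: (special_equal_classes5 hz p_odd M0 v0 (ts := ts) p5 _ _ bal); rewrite -?p5.
have small s0 s1 s2 s3 : equal_classes p M k v s0 s1 s2 s3 -> s0.2 ^+ M = 1 -> False.
  move=> sbal m0; have [p7 _] := equal_classes_size hz p_odd v0 sbal m0.
  apply: (equal_classes7_contra hz p_odd M0 v0 sbal m0).
  move: p7 p_odd p_pr p3 p5; clear; case: p => [|[|[|[|[|[|[|[|p]]]]]]]] //.
exfalso; case/or4P: (equal_classes_trivial v0 bal) => /eqP m.
- exact: small bal m.
- exact: small (equal_classes_swap01 bal) m.
- exact: small (equal_classes_swap01 (equal_classes_swap12 bal)) m.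
- exact: small (equal_classes_swap01 (equal_classes_swap12 (equal_classes_swap23 bal))) m.
Qed.

Lemma special_config t0 t1 t2 t3 : config t0 t1 t2 t3 -> special t0 t1 t2 t3.
Proof.
move=> cfg; have [N min] := minimal_order_exists cfg; have [N0 rN _] := min.
have [big|small] := boolP (has (fun p => odd p && ((p ^ 2 %| N)%N || (p != 3)%N)) (primes N)).
  case/hasP: big => p; rewrite mem_primes => /and3P [p_pr _ /dvdnP [M NE]].
  rewrite NE mulnC in min * => /andP [p_odd side].
  apply: (special_odd_prime p_odd p_pr cfg min).
  by move: side; rewrite -mulnn dvdn_pmul2l ?prime_gt0.
apply: (special_order_2j3 hz (j := logn 2 N) cfg).
have dvd : (N %| 2 ^ logn 2 N * 3)%N.
  apply/dvdn_partP => // p; rewrite mem_primes => /and3P [p_pr _ pN].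
  have [->|p2] := eqVneq p 2%N; first by rewrite p_part dvdn_mulr.
  have p_odd : odd p by case: (even_prime p_pr) => // e; rewrite e in p2.
  have := hasPn small p; rewrite mem_primes p_pr N0 pN p_odd /= negb_or negbK.
  move=> /(_ isT) /andP [p2N /eqP p3].
  have l3 : logn p N = 1%N.
    apply/eqP; rewrite eqn_leq logn_gt0 mem_primes p_pr N0 pN andbT leqNgt.
    by rewrite -pfactor_dvdn // p2N.
  by rewrite p_part l3 p3 dvdn_mull.
have lift (w : F) : w ^+ N = 1 -> w ^+ (2 ^ logn 2 N * 3) = 1.
  by case/dvdnP: dvd => q -> wN; rewrite mulnC exprM wN expr1n.
by have [r0 r1 r2 r3] := rN; split; apply: lift.
Qed.

End Classification.

(** * Automorphisms of the algebraic numbers *)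

(** The graph of an isomorphism between two subfields of L.  The last condition
    makes it functional, and injective by field_graph_flip0. *)
Definition field_graph (L : fieldType) (G : set (L * L)) : Prop :=
  [/\ G (1, 1),
      forall x y, G x -> G y -> G (x - y),
      forall x y, G x -> G y -> G (x * y),
      forall u v, G (u, v) -> G (u^-1, v^-1)
    & forall v, G (0, v) -> v = 0].

Lemma field_graph_flip0 (L : fieldType) (G : set (L * L)) (u : L) :
  field_graph G -> G (u, 0) -> u = 0.
Proof.
move=> [g1 gB gM gV g0] gu; apply/eqP/negPn/negP => u0.
have := gB _ _ (gM _ _ gu (gV _ _ gu)) g1.
rewrite [X in G X](_ : _ = (0, -1)); last first.
  by apply: injective_projections; rewrite /= ?mul0r ?sub0r // mulfV ?subrr.
by move/g0/eqP; rewrite oppr_eq0 oner_eq0.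
Qed.

(** The inverse isomorphism. *)
Lemma field_graph_flip (L : fieldType) (G : set (L * L)) : field_graph G ->
  field_graph (fun x => G (x.2, x.1)).
Proof.
move=> gG; have [g1 gB gM gV g0] := gG; split=> //=.
- by move=> x y gx gy; exact: gB gx gy.
- by move=> x y gx gy; exact: gM gx gy.
- by move=> u v gx; exact: gV gx.
- by move=> v gv; exact: field_graph_flip0 gG gv.
Qed.

(** The hypothesis on p says that it is the minimal polynomial of u over the field
    embedded by i1.  An inverse of q(u) is b(u) for a Bezout relation
    a p + b q = 1, which serves at v as well. *)
Lemma field_graph_adjoin (K L : fieldType) (i1 i2 : {rmorphism K -> L})
    (p : {poly K}) (u v : L) :
  p != 0 -> root (map_poly i2 p) v ->
  (forall q, root (map_poly i1 q) u = (p %| q)) ->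
  field_graph (fun x => exists q, x = ((map_poly i1 q).[u], (map_poly i2 q).[v])).
Proof.
move=> p0 rv ru.
have coprime_p q : ~~ (p %| q) -> coprimep p q.
  move=> pq; rewrite /coprimep; have /dvdpP [e pE] := dvdp_gcdl p q.
  have : root (map_poly i1 p) u by rewrite ru.
  have g0 : gcdp p q != 0 by rewrite gcdp_eq0 negb_and p0.
  rewrite {1}pE rmorphM rootM !ru => /orP [pe|pg]; last first.
    by move: pq; rewrite (dvdp_trans pg) ?dvdp_gcdr.
  have e0 : e != 0 by apply: contraNneq p0 => e0; rewrite pE e0 mul0r.
  have := dvdp_leq e0 pe; rewrite {1}pE size_mul //.
  have : (0 < size (gcdp p q))%N by rewrite size_poly_gt0.
  case: (size (gcdp p q)) => [|[|m]] // _.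
  by rewrite addnS /= -[X in (_ <= X)%N]addn0 leq_add2l.
have zero q : root (map_poly i1 q) u -> root (map_poly i2 q) v.
  by rewrite ru => /dvdpP [r ->]; rewrite rmorphM rootM rv orbT.
split.
- by exists 1; rewrite !rmorph1 !hornerC.
- by move=> x y [q ->] [r ->]; exists (q - r); rewrite !rmorphB !hornerD !hornerN.
- by move=> x y [q ->] [r ->]; exists (q * r); rewrite !rmorphM !hornerM.
- move=> _ _ [q [-> ->]]; have [pq|pq] := boolP (p %| q).
    have rq : root (map_poly i1 q) u by rewrite ru.
    have rq' := zero _ rq; exists 0.
    by rewrite (rootP rq) (rootP rq') !invr0 !rmorph0 !horner0.
  have /Bezout_eq1_coprimepP [[a b] /= ab] := coprime_p _ pq.
  have inv (i : {rmorphism K -> L}) (x : L) : root (map_poly i p) x ->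
      (map_poly i q).[x]^-1 = (map_poly i b).[x].
    move=> rx; have e : (map_poly i b).[x] * (map_poly i q).[x] = 1.
      have := congr1 (fun f => (map_poly i f).[x]) ab.
      rewrite rmorphD !rmorphM /= hornerD !hornerM (rootP rx) mulr0 add0r.
      by rewrite rmorph1 hornerC.
    have q0 : (map_poly i q).[x] != 0.
      by apply: contra_eq_neq e => ->; rewrite mulr0 eq_sym oner_eq0.
    by apply: (mulIf q0); rewrite mulVf.
  by exists b; rewrite !inv // ru.
- move=> w [q [e ->]]; apply/rootP/zero/rootP; exact: esym.
Qed.

Section GraphField.

Variables (L : closedFieldType) (G : set (L * L)).
Hypothesis gG : field_graph G.

Definition in_graph : {pred L * L} := fun x => `[< G x >].

Lemma in_graph_divring : divring_closed in_graph.
Proof.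
have [g1 gB gM gV g0] := gG; split; rewrite ?unfold_in /=.
- exact/asboolP.
- by move=> x y /asboolP gx /asboolP gy; apply/asboolP; exact: gB.
move=> x y /asboolP gx /asboolP gy; apply/asboolP; apply: gM => //.
rewrite /GRing.inv /= /pair_invr; case: ifP => // _.
by case: y gy => u v; exact: gV.
Qed.

HB.instance Definition _ := GRing.isDivringClosed.Build _ in_graph in_graph_divring.

(** The pairs in G form a subfield of the ring L * L; its two projections are the
    two embeddings. *)
Record graph_field := GraphField { graph_val : L * L; _ : graph_val \in in_graph }.

HB.instance Definition _ := [isSub for graph_val].
HB.instance Definition _ := [Choice of graph_field by <:].
HB.instance Definition _ := [SubChoice_isSubComUnitRing of graph_field by <:].

Lemma graph_fieldP (x : graph_field) : G (val x).
Proof. by apply/asboolP; exact: (valP x). Qed.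

Lemma graph_field_axiom : GRing.field_axiom graph_field.
Proof.
move=> x x0; have gx := graph_fieldP x; have [g1 gB gM gV g0] := gG.
case xE : (val x) gx => [u v] gx.
have u0 : u != 0.
  apply: contra_neq x0 => u0; apply: val_inj; rewrite xE u0 in gx *.
  by rewrite (g0 _ gx) rmorph0.
have v0 : v != 0.
  apply: contra_neq x0 => v0; apply: val_inj; rewrite xE v0 in gx *.
  by rewrite (field_graph_flip0 gG gx) rmorph0.
have yin : (u^-1, v^-1) \in in_graph by apply/asboolP; exact: gV.
apply/unitrP; exists (GraphField yin); split; apply: val_inj;
  rewrite rmorphM rmorph1 /= xE;
  by apply: injective_projections; rewrite /= ?mulfV ?mulVf.
Qed.

HB.instance Definition _ := GRing.ComUnitRing_isField.Build graph_field graph_field_axiom.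

Definition graph_fst : {rmorphism graph_field -> L} :=
  GRing.RMorphism.clone graph_field L (fst \o val) _.
Definition graph_snd : {rmorphism graph_field -> L} :=
  GRing.RMorphism.clone graph_field L (snd \o val) _.

Lemma field_graph_extend (P : {poly int}) (u : L) :
  map_poly intr P != 0 :> {poly L} -> root (map_poly intr P) u ->
  exists G' : set (L * L), [/\ field_graph G', (G `<=` G')%classic & exists v, G' (u, v)].
Proof.
move=> P0 rPu; pose K := graph_field.
pose sized n := exists p : {poly K}, [/\ p != 0, size p = n & root (map_poly graph_fst p) u].
have ex : exists n, `[< sized n >].
  have mapP (i : {rmorphism K -> L}) : map_poly i (map_poly intr P) = map_poly intr P.
    by rewrite -map_poly_comp; apply: eq_map_poly => k /=; rewrite rmorph_int.
  pose Q : {poly K} := map_poly intr P.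
  exists (size Q); apply/asboolP; exists Q; split=> //; rewrite ?mapP //.
  by rewrite -(map_poly_eq0 graph_fst) mapP.
have [_ /asboolP [p [p0 <- rp]] min] := ex_minnP ex.
have ru q : root (map_poly graph_fst q) u = (p %| q).
  apply/idP/idP => [rq|/dvdpP [r ->]]; last by rewrite rmorphM rootM rp orbT.
  apply/negPn/negP => pq; have := ltn_modp q p; rewrite p0 ltnNge => /negP; apply.
  apply: min; apply/asboolP; exists (q %% p); split=> //.
  have := rq; rewrite {1}(divp_eq q p) rmorphD rmorphM /= rootE hornerD hornerM.
  by rewrite (rootP rp) mulr0 add0r.
have [v rv] : exists v, root (map_poly graph_snd p) v.
  apply/closed_rootP; rewrite size_map_poly -(size_map_poly graph_fst).
  by rewrite gtn_eqF // (root_size_gt1 _ rp) // map_poly_eq0.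
exists (fun x => exists q, x = ((map_poly graph_fst q).[u], (map_poly graph_snd q).[v])).
split; first exact: field_graph_adjoin p0 rv ru.
  move=> x Gx; have xin : x \in in_graph by apply/asboolP.
  exists (GraphField xin)%:P; rewrite !map_polyC !hornerC /=.
  exact: surjective_pairing.
by exists v; exists 'X; rewrite !map_polyX !hornerX.
Qed.

End GraphField.

Section Automorphism.

Variable L : numClosedFieldType.
Implicit Types G : set (L * L).
Local Open Scope classical_set_scope.

Lemma field_graph_int G (k : int) : field_graph G -> G (k%:~R, k%:~R).
Proof.
move=> gG; have [g1 gB gM gV g0] := gG.
have gz : G (0, 0).
  by have := gB _ _ g1 g1; rewrite subrr.
have gn (x : L * L) : G x -> G (- x).
  by move=> gx; have := gB _ _ gz gx; rewrite sub0r.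
have nat n : G (n%:R, n%:R).
  elim: n => [|n IH] //; have := gB _ _ IH (gn _ g1); rewrite opprK.
  by rewrite -natr1.
by case: k => n; [exact: nat | have := gn _ (nat n.+1); rewrite NegzE mulrNz].
Qed.

Lemma field_graph_add G x y : field_graph G -> G x -> G y -> G (x + y).
Proof.
move=> gG gx gy; have [g1 gB _ _ _] := gG.
have gz : G 0 by have := gB _ _ g1 g1; rewrite subrr.
by have := gB _ _ gx (gB _ _ gz gy); rewrite sub0r opprK.
Qed.

Lemma field_graph_rat G (q : rat) : field_graph G -> G (ratr q, ratr q).
Proof.
move=> gG; have [g1 gB gM gV g0] := gG.
exact: gM (field_graph_int (numq q) gG) (gV _ _ (field_graph_int (denq q) gG)).
Qed.

Lemma field_graph_horner G (f : {poly rat}) (u v : L) : field_graph G ->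
  G (u, v) -> G ((map_poly ratr f).[u], (map_poly ratr f).[v]).
Proof.
move=> gG guv; have [g1 gB gM gV g0] := gG.
elim/poly_ind: f => [|f c IH]; first by rewrite rmorph0 !horner0; have := gB _ _ g1 g1;
  rewrite subrr.
rewrite rmorphD rmorphM /= map_polyX map_polyC !hornerE /=.
exact: field_graph_add (gM _ _ IH guv) (field_graph_rat c gG).
Qed.

Lemma algebraic_int_poly (u : L) : algebraicOver (ratr : rat -> L) u ->
  exists2 P : {poly int}, map_poly intr P != 0 :> {poly L} & root (map_poly intr P) u.
Proof.
case=> p p0 rp; have [P [a a0 pE]] := rat_poly_scale p; exists P.
  rewrite -size_poly_eq0 size_map_inj_poly ?size_poly_eq0 //; last exact: intr_inj.
  by apply: contraNneq p0 => P0; rewrite pE P0 rmorph0 scaler0.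
move: rp; rewrite pE map_polyZ /= rootZ ?fmorph_eq0 ?invr_eq0 ?intr_eq0 //.
by rewrite -map_poly_comp; congr (root _ u); apply: eq_map_poly => k /=;
  rewrite rmorph_int.
Qed.

Lemma field_graph_bigcup (F : set (set (L * L))) :
  F `<=` @field_graph L -> F !=set0 -> total_on F subset ->
  field_graph (\bigcup_(X in F) X).
Proof.
move=> gF [X0 FX0] tot.
have both x y : (\bigcup_(X in F) X) x -> (\bigcup_(X in F) X) y ->
    exists X, [/\ F X, X x & X y].
  move=> [X FX Xx] [Y FY Yy]; case: (tot _ _ FX FY) => sub.
    by exists Y; split=> //; exact: sub.
  by exists X; split=> //; exact: sub.
split.
- by exists X0 => //; have [] := gF _ FX0.
- move=> x y ux uy; have [X [FX Xx Xy]] := both _ _ ux uy.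
  by exists X => //; have [_ gB _ _ _] := gF _ FX; exact: gB.
- move=> x y ux uy; have [X [FX Xx Xy]] := both _ _ ux uy.
  by exists X => //; have [_ _ gM _ _] := gF _ FX; exact: gM.
- move=> u v [X FX Xx]; exists X => //.
  by have [_ _ _ gV _] := gF _ FX; exact: gV.
- by move=> v [X FX Xx]; have [_ _ _ _ g0] := gF _ FX; exact: g0.
Qed.

(** Zorn's lemma on the graphs that contain (g, h).  The base is the isomorphism
    Q(g) = Q(h) of irreducibility of the cyclotomic polynomial.  A maximal graph
    admits no extension, and neither does its inverse.  The empty set is admitted
    because it is the union of the empty chain. *)
Lemma field_graph_maximal (n : nat) (g h : L) :
  n.-primitive_root g -> n.-primitive_root h ->
  exists A, [/\ field_graph A, A (g, h),
    forall u, algebraicOver (ratr : rat -> L) u -> exists v, A (u, v)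
  & forall v, algebraicOver (ratr : rat -> L) v -> exists u, A (u, v)].
Proof.
move=> pg ph.
pose P G := G = set0 \/ (field_graph G /\ G (g, h)).
have chain (F : set (set (L * L))) : F `<=` P -> total_on F subset ->
    P (\bigcup_(X in F) X).
  move=> FP tot; have [[X [FX [x Xx]]]|no] :=
    pselect (exists X, F X /\ X !=set0); last first.
    left; apply/seteqP; split=> // x [X FX Xx]; case: no; exists X.
    by split=> //; exists x.
  right; pose F' : set (set (L * L)) := [set Y | F Y /\ Y !=set0].
  have nonempty Y : F' Y -> field_graph Y /\ Y (g, h).
    by case=> FY [y Yy]; case: (FP _ FY) => // Y0; rewrite Y0 in Yy.
  have -> : \bigcup_(Y in F) Y = \bigcup_(Y in F') Y.
    apply/seteqP; split=> [y [Y FY Yy]|y [Y [FY _] Yy]]; last by exists Y.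
    by exists Y => //; split=> //; exists y.
  split; last first.
    have F'X : F' X by split=> //; exists x.
    by exists X => //; have [] := nonempty _ F'X.
  apply: field_graph_bigcup => [Y /nonempty []//||Y Z [FY _] [FZ _]].
  - by exists X; split=> //; exists x.
  - exact: tot.
have [A [PA max]] := Zorn_bigcup chain.
pose rid : {rmorphism rat -> L} := ratr.
pose base : set (L * L) := fun x =>
  exists q : {poly rat}, x = ((map_poly rid q).[g], (map_poly rid q).[h]).
have gbase : field_graph base.
  apply: (@field_graph_adjoin _ _ rid rid (map_poly intr 'Phi_n)).
  - rewrite -size_poly_eq0 size_map_inj_poly ?size_Cyclotomic //.
    exact: intr_inj.
  - by rewrite (Cyclotomic_dvdP _ ph) dvdpp.
  - by move=> q; rewrite (Cyclotomic_dvdP _ pg).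
have base_gh : base (g, h) by exists 'X; rewrite !map_polyX !hornerX.
have [gA Agh] : field_graph A /\ A (g, h).
  case: PA => // A0; exfalso; apply: (max base); last by right.
  by rewrite A0; split=> [x //|]; move/(_ _ base_gh).
have extend G : field_graph G -> A `<=` G -> G `<=` A.
  move=> gG AG; apply: contrapT => nGA; apply: (max G) => //.
  by right; split=> //; apply: AG.
exists A; split=> // [u|v] /algebraic_int_poly [Q Q0 rQ].
  have [G' [gG' AG' [v G'uv]]] := field_graph_extend gA Q0 rQ.
  by exists v; apply: extend G'uv.
have [G' [gG' AG' [u G'uv]]] := field_graph_extend (field_graph_flip gA) Q0 rQ.
exists u; apply: (extend _ (field_graph_flip gG')) => //= -[x y] Axy.
exact: AG'.
Qed.

(** A maximal graph is the graph of an automorphism: sigma sends u to the unique v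
    related to it, and u and v are roots of the same rational polynomials. *)
Lemma algebraic_automorphism (n : nat) (g h : L) :
  n.-primitive_root g -> n.-primitive_root h ->
  let Q := [set u | algebraicOver (ratr : rat -> L) u] in
  exists sigma : L -> L,
    [/\ [/\ set_bij Q Q sigma,
      forall q : rat, sigma (ratr q) = ratr q,
      forall u v, Q u -> Q v -> sigma (u + v) = sigma u + sigma v
    & forall u v, Q u -> Q v -> sigma (u * v) = sigma u * sigma v] & sigma g = h].
Proof.
move=> pg ph Q; have [A [gA Agh dom img]] := field_graph_maximal pg ph.
have [g1 gB gM gV g0] := gA.
have uniq u v v' : A (u, v) -> A (u, v') -> v = v'.
  move=> a a'; apply/eqP; rewrite -subr_eq0; apply/eqP; apply: g0.
  by have := gB _ _ a a'; rewrite [X in A X](_ : _ = (0, v - v')) //;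
     apply: injective_projections; rewrite /= ?subrr.
have inj u u' v : A (u, v) -> A (u', v) -> u = u'.
  move=> a a'; apply/eqP; rewrite -subr_eq0; apply/eqP; apply: (field_graph_flip0 gA).
  by have := gB _ _ a a'; rewrite [X in A X](_ : _ = (u - u', 0)) //;
     apply: injective_projections; rewrite /= ?subrr.
pose sigma u := xget 0 [set v | A (u, v)].
have sE u v : A (u, v) -> sigma u = v.
  by move=> a; rewrite /sigma; case: xgetP => [w _ /= a'|/(_ v)//]; exact: uniq a' a.
have sA u : Q u -> A (u, sigma u) by move=> /dom [v a]; rewrite (sE _ _ a).
have Qim u v : A (u, v) -> Q u -> Q v.
  move=> a [p p0 rp]; exists p => //; apply/rootP/g0.
  by have := field_graph_horner p gA a; rewrite (rootP rp).
have Qpre u v : A (u, v) -> Q v -> Q u.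
  move=> a [p p0 rp]; exists p => //; apply/rootP/(field_graph_flip0 gA).
  by have := field_graph_horner p gA a; rewrite (rootP rp).
exists sigma; split; last exact: sE.
split.
- split.
  + by move=> u Qu; exact: Qim (sA _ Qu) Qu.
  + move=> u u' /set_mem Qu /set_mem Qu' e; apply: inj (sA _ Qu) _.
    by rewrite e; exact: sA.
  + move=> v Qv; have [u a] := img _ Qv; exists u; first exact: Qpre a Qv.
    exact: sE.
- by move=> q; apply: sE; exact: field_graph_rat.
- by move=> u v Qu Qv; apply: sE; exact: field_graph_add gA (sA _ Qu) (sA _ Qv).
- by move=> u v Qu Qv; apply: sE; exact: gM (sA _ Qu) (sA _ Qv).
Qed.

End Automorphism.

(** * Symmetries of the equation *)

Section Symmetries.

Variable R : realType.
Local Notation C := R[i].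
Implicit Types (t : rat * C) (s : septuple R).

Lemma common_orderP (x y z : C) (n : nat) : common_order x y z n <->
  (0 < n)%N /\ forall k, (n %| k)%N = [&& x ^+ k == 1, y ^+ k == 1 & z ^+ k == 1].
Proof.
split=> [[nx [ny [nz [px py pz ->]]]]|[n0 nk]].
  rewrite !lcmn_gt0 (prim_order_gt0 px) (prim_order_gt0 py) (prim_order_gt0 pz).
  split=> // k; rewrite !dvdn_lcm (prim_order_dvd px) (prim_order_dvd py).
  by rewrite (prim_order_dvd pz).
have /and3P [/eqP x1 /eqP y1 /eqP z1] : [&& x ^+ n == 1, y ^+ n == 1 & z ^+ n == 1].
  by rewrite -nk dvdnn.
have [nx px _] := prim_order_exists n0 x1.
have [ny py _] := prim_order_exists n0 y1.
have [nz pz _] := prim_order_exists n0 z1.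
exists nx, ny, nz; split=> //.
have e k : (n %| k)%N = (lcmn nx (lcmn ny nz) %| k)%N.
  by rewrite !dvdn_lcm (prim_order_dvd px) (prim_order_dvd py) (prim_order_dvd pz).
by apply/eqP; rewrite eqn_dvd e dvdnn -e dvdnn.
Qed.

Lemma common_order_uniq (x y z : C) (n m : nat) :
  common_order x y z n -> common_order x y z m -> n = m.
Proof.
move=> /common_orderP [_ n0] /common_orderP [_ m0]; apply/eqP.
by rewrite eqn_dvd n0 -m0 dvdnn m0 -n0 dvdnn.
Qed.

Lemma common_order_unity (x y z : C) (n : nat) : common_order x y z n ->
  [/\ (0 < n)%N, x ^+ n = 1, y ^+ n = 1 & z ^+ n = 1].
Proof.
move=> /common_orderP [n0 nk]; have := nk n; rewrite dvdnn.
by move=> /esym /and3P [/eqP ? /eqP ? /eqP ?].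
Qed.

Lemma common_order_exists (x y z : C) (m : nat) : (0 < m)%N ->
  x ^+ m = 1 -> y ^+ m = 1 -> z ^+ m = 1 -> exists n, common_order x y z n.
Proof.
move=> m0 x1 y1 z1.
have [nx px _] := prim_order_exists m0 x1.
have [ny py _] := prim_order_exists m0 y1.
have [nz pz _] := prim_order_exists m0 z1.
by exists (lcmn nx (lcmn ny nz)), nx, ny, nz.
Qed.

Lemma unity_Qbar (x : C) (n : nat) : (0 < n)%N -> x ^+ n = 1 -> Qbar R x.
Proof.
move=> n0 xn; exists ('X^n - 1).
  by rewrite -size_poly_eq0 size_XnsubC.
by rewrite rmorphB /= map_polyXn rmorph1 rootE !hornerE xn subrr.
Qed.

Lemma galois_expr (sigma : C -> C) (x : C) (n k : nat) : galois_aut sigma ->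
  (0 < n)%N -> x ^+ n = 1 -> sigma (x ^+ k) = sigma x ^+ k.
Proof.
move=> [_ sQ _ sM] n0 xn; elim: k => [|k IH].
  by have := sQ 1; rewrite rmorph1.
rewrite !exprS sM ?IH //; apply: (unity_Qbar n0) => //.
by rewrite exprAC xn expr1n.
Qed.

Lemma galois_expr1 (sigma : C -> C) (x : C) (n k : nat) : galois_aut sigma ->
  (0 < n)%N -> x ^+ n = 1 -> (sigma x ^+ k == 1) = (x ^+ k == 1).
Proof.
move=> gs n0 xn; rewrite -(galois_expr k gs n0 xn).
have [[_ inj _] sQ _ _] := gs; have s1 : sigma 1 = 1 by have := sQ 1; rewrite rmorph1.
apply/eqP/eqP => [e|->//]; apply: inj; rewrite ?inE ?s1 //.
  by apply: (unity_Qbar n0); rewrite exprAC xn expr1n.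
by apply: (unity_Qbar n0); rewrite expr1n.
Qed.

Lemma symmetry_order s s' (n : nat) : symmetry s s' ->
  common_order (sx s) (sy s) (sz s) n -> common_order (sx s') (sy s') (sz s') n.
Proof.
move=> sym /[dup] /common_order_unity [n0 xn yn zn].
move=> /common_orderP [_ nk]; apply/common_orderP; split=> // k; rewrite nk.
case: {s s'} sym xn yn zn {nk} => //=.
- by move=> sigma _ _ _ _ x y z gs xn yn zn; rewrite !(galois_expr1 _ gs n0).
- by move=> _ _ _ _ x y z _ _ _; rewrite exprVn invr_eq1.
- by move=> _ _ _ _ x y z _ _ _; rewrite exprVn invr_eq1.
- by move=> _ _ _ _ x y z _ _ _ _; rewrite exprVn invr_eq1.
- by move=> _ _ _ _ x y z _ _ _; rewrite [(y ^+ k == 1) && _]andbC.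
- by move=> _ _ _ _ x y z _ _ _; rewrite andbCA.
Qed.

Lemma symmetric_order s s' (n : nat) : symmetry_equivalent s s' ->
  common_order (sx s) (sy s) (sz s) n <-> common_order (sx s') (sy s') (sz s') n.
Proof.
elim=> {s s'} [s s' [sol sol' sym]|s|s s' _ IH|s s' s'' _ IH _ IH'] //.
- split; first exact: symmetry_order.
  move=> ord; have [_ _ [m om] _] := sol.
  by rewrite (common_order_uniq ord (symmetry_order sym om)).
- by split=> [/IH|/IH].
- by split=> [/IH /IH'|/IH' /IH].
Qed.

Lemma solution_rescale (q a b c d : rat) (x y z : C) : q != 0 ->
  solution (Septuple a b c d x y z) ->
  solution (Septuple (q * a) (q * b) (q * c) (q * d) x y z).
Proof.
move=> q0 [/= nz ab ord st]; split=> //=.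
- by rewrite !mulf_eq0 (negPf q0).
- by transitivity (q ^+ 2 * (a * b)); [ring | rewrite ab; ring].
- move: st; rewrite /star /star_lhs /= => st.
  by rewrite -(mulr0 (ratr q)) -st !rmorphM; ring.
Qed.

Lemma equivalent_rescale (q : rat) s (a b c d : rat) : q != 0 -> solution s ->
  a = q * sa s -> b = q * sb s -> c = q * sc s -> d = q * sd s ->
  symmetry_equivalent s (Septuple a b c d (sx s) (sy s) (sz s)).
Proof.
case: s => a' b' c' d' x y z /= q0 sol -> -> -> ->.
apply: rst_step; split=> //; first exact: solution_rescale.
exact: rescale.
Qed.

End Symmetries.

Section Configurations.

Variable R : realType.
Local Notation C := R[i].
Implicit Types (t : rat * C) (s : septuple R).

(** The solutions of ab = cd with differences d - b, b - c, a - d, c - a equal to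
    p, q, r, s are proportional to (r s : p q : - s q : - r p) when p + s <> 0. *)
Definition septuple_of t0 t1 t2 t3 : septuple R :=
  Septuple (t2.1 * t3.1) (t0.1 * t1.1) (- (t3.1 * t1.1)) (- (t2.1 * t0.1))
    (t1.2 * t2.2) (t1.2 * t3.2) (t2.2 * t3.2).

Lemma star_trace (a b c d : rat) (w0 w1 w2 w3 : C) :
  w0 * w1 * w2 * w3 = 1 ->
  star_lhs (ratr a) (ratr b) (ratr c) (ratr d) (w1 * w2) (w1 * w3) (w2 * w3)
  = w0^-1 * (ratr (d - b) * trace w0 + ratr (b - c) * trace w1
      + ratr (a - d) * trace w2 + ratr (c - a) * trace w3).
Proof.
move=> pr; have pr0 : w0 * w1 * w2 * w3 != 0 by rewrite pr oner_eq0.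
move: pr0; rewrite !mulf_eq0 !negb_or => /andP [/andP [/andP [n0 n1] n2] n3].
have w0E : w0 = (w1 * w2 * w3)^-1.
  by apply: (mulIf (mulf_neq0 (mulf_neq0 n1 n2) n3)); rewrite mulVf ?mulf_neq0 // -pr;
    ring.
rewrite w0E /star_lhs /trace !rmorphB /=; field.
by rewrite n1 n2 n3.
Qed.

Lemma config_pair03 t0 t1 t2 t3 : config t0 t1 t2 t3 -> t0.1 + t3.1 != 0.
Proof. by case=> [[_ _ /and3P []]]. Qed.

Lemma solution_config t0 t1 t2 t3 :
  config t0 t1 t2 t3 -> solution (septuple_of t0 t1 t2 t3).
Proof.
move=> cfg; have [[/and4P [c0 c1 c2 c3] sum0 _] [m m0 [r0 r1 r2 r3]] pr rel] := cfg.
have cs : t3.1 = - (t0.1 + t1.1 + t2.1) by lra.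
split=> /=.
- by rewrite mulf_neq0.
- by ring.
- by apply: (common_order_exists m0); rewrite exprMn ?r1 ?r2 ?r3 mulr1.
rewrite /star /= (star_trace _ _ _ _ pr).
set p := t0.1 in rel cs *; set q := t1.1 in rel cs *; set r := t2.1 in rel cs *.
have -> : - (r * p) - p * q = (p + t3.1) * p by rewrite cs; ring.
have -> : p * q - - (t3.1 * q) = (p + t3.1) * q by ring.
have -> : r * t3.1 - - (r * p) = (p + t3.1) * r by ring.
have -> : - (t3.1 * q) - r * t3.1 = (p + t3.1) * t3.1 by rewrite cs; ring.
transitivity (t0.2^-1 * (ratr (p + t3.1) * (ratr p * trace t0.2
    + ratr q * trace t1.2 + ratr r * trace t2.2 + ratr t3.1 * trace t3.2))).
  by rewrite !rmorphM /=; ring.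
by rewrite rel !mulr0.
Qed.

Lemma solution_inv_y (a b c d : rat) (x y z : C) : y != 0 ->
  solution (Septuple a b c d x y z) -> solution (Septuple b a c d x y^-1 z).
Proof.
move=> y0 [/= nz ab [n ord] st]; split=> /=.
- by rewrite orbCA.
- by rewrite mulrC.
- by exists n; apply: (symmetry_order (invert_y _ _ _ _ _ _ _) ord).
rewrite /star /= /star_lhs; apply: (mulfI y0); rewrite mulr0 -[RHS]oppr0 -st.
by rewrite /= /star_lhs; field.
Qed.

Lemma equivalent_swap12 t0 t1 t2 t3 : config t0 t1 t2 t3 ->
  symmetry_equivalent (septuple_of t0 t1 t2 t3) (septuple_of t0 t2 t1 t3).
Proof.
move=> cfg; have sol := solution_config cfg.
have sol' := solution_config (config_swap12 cfg).
have n1 : (-1 : rat) != 0 by rewrite oppr_eq0 oner_eq0.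
pose s : septuple R := Septuple (- (t3.1 * t1.1)) (- (t2.1 * t0.1)) (t2.1 * t3.1)
  (t0.1 * t1.1) (t1.2 * t2.2) (t2.2 * t3.2) (t1.2 * t3.2).
have sE : s = Septuple (-1 * (t1.1 * t3.1)) (-1 * (t0.1 * t2.1))
    (-1 * - (t3.1 * t2.1)) (-1 * - (t1.1 * t0.1)) (t2.2 * t1.2) (t2.2 * t3.2) (t1.2 * t3.2).
  by rewrite /s [t1.2 * t2.2]mulrC; congr (Septuple _ _ _ _ _ _ _); ring.
have sol_s : solution s by rewrite sE; exact: (solution_rescale n1 sol').
apply: (@rst_trans _ _ _ s).
  by apply: rst_step; split=> //; exact: swap_yz.
apply: rst_sym; rewrite sE.
exact: (@equivalent_rescale R (-1) (septuple_of t0 t2 t1 t3) _ _ _ _ n1 sol' erefl erefl erefl erefl).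
Qed.

(** The exchange of x and y, after removal of a common factor of the coefficients;
    the factor is nonzero because no t_i.1 and no t_i.1 + t_j.1 is. *)
Lemma equivalent_swap23 t0 t1 t2 t3 : config t0 t1 t2 t3 ->
  symmetry_equivalent (septuple_of t0 t1 t2 t3) (septuple_of t0 t1 t3 t2).
Proof.
move=> cfg; have sol := solution_config cfg.
have sol' := solution_config (config_swap23 cfg).
have [[/and4P [c0 c1 c2 c3] sum0 _] _ _ _] := cfg.
have c03 := config_pair03 cfg.
have cs : t3.1 = - (t0.1 + t1.1 + t2.1) by lra.
pose q : rat := - (t0.1 + t3.1) ^+ 2 * t0.1 * t1.1.
have q0 : q != 0 by rewrite /q mulNr !mulf_neq0 // oppr_eq0 mulf_neq0 // expf_neq0.
pose a := t2.1 * t3.1; pose b := t0.1 * t1.1.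
pose c := - (t3.1 * t1.1); pose d := - (t2.1 * t0.1).
pose s : septuple R := Septuple (a * (b - c) * (b - d)) (b * (b - c) * (b - d))
  (b * (b - c) * (a - d)) (b * (a - c) * (b - d))
  (t1.2 * t3.2) (t1.2 * t2.2) (t2.2 * t3.2).
have sE : s = Septuple (q * (t3.1 * t2.1)) (q * (t0.1 * t1.1))
    (q * - (t2.1 * t1.1)) (q * - (t3.1 * t0.1)) (t1.2 * t3.2) (t1.2 * t2.2) (t3.2 * t2.2).
  by rewrite /s /a /b /c /d /q; congr (Septuple _ _ _ _ _ _ _);
    [rewrite cs; ring..|rewrite mulrC].
have sol_s : solution s by rewrite sE; exact: (solution_rescale q0 sol').
apply: (@rst_trans _ _ _ s).
  by apply: rst_step; split=> //; exact: swap_xy.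
apply: rst_sym; rewrite sE.
exact: (@equivalent_rescale R q (septuple_of t0 t1 t3 t2) _ _ _ _ q0 sol' erefl erefl erefl erefl).
Qed.

(** Exchange x and y by a swap of t2 and t3, then invert both. *)
Lemma equivalent_swap01 t0 t1 t2 t3 : config t0 t1 t2 t3 ->
  symmetry_equivalent (septuple_of t0 t1 t2 t3) (septuple_of t1 t0 t2 t3).
Proof.
move=> cfg; have cfg' := config_swap01 cfg; have sol' := solution_config cfg'.
have cfg3 := config_swap23 cfg; have sol3 := solution_config cfg3.
apply: rst_trans (equivalent_swap23 cfg) _.
have [[/and4P [c0 c1 c2 c3] sum0 _] _ pr _] := cfg.
have [w0 w1 w2 w3] := config_neq0 cfg.
pose a := t3.1 * t2.1; pose b := t0.1 * t1.1.
pose c := - (t2.1 * t1.1); pose d := - (t3.1 * t0.1).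
have nz : [&& a != 0, b != 0, c != 0 & d != 0].
  by rewrite /c /d !oppr_eq0 !mulf_neq0.
pose q : rat := (t0.1 * t1.1 * t2.1 * t3.1)^-1.
have q0 : q != 0 by rewrite invr_eq0 !mulf_neq0.
have xE : (t1.2 * t3.2)^-1 = t0.2 * t2.2.
  by apply: (mulIf (mulf_neq0 w1 w3)); rewrite mulVf ?mulf_neq0 // -pr; ring.
have yE : (t1.2 * t2.2)^-1 = t0.2 * t3.2.
  by apply: (mulIf (mulf_neq0 w1 w2)); rewrite mulVf ?mulf_neq0 // -pr; ring.
pose s1 : septuple R := Septuple a^-1 b^-1 c^-1 d^-1
  (t1.2 * t3.2)^-1 (t1.2 * t2.2) (t3.2 * t2.2).
pose s2 : septuple R := Septuple b^-1 a^-1 c^-1 d^-1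
  (t1.2 * t3.2)^-1 (t1.2 * t2.2)^-1 (t3.2 * t2.2).
have s2E : s2 = Septuple (q * (t2.1 * t3.1)) (q * (t1.1 * t0.1))
    (q * - (t3.1 * t0.1)) (q * - (t2.1 * t1.1))
    (t0.2 * t2.2) (t0.2 * t3.2) (t2.2 * t3.2).
  rewrite /s2 /a /b /c /d /q xE yE.
  by congr (Septuple _ _ _ _ _ _ _); [field; rewrite c0 c1 c2 c3..|rewrite mulrC].
have sol2 : solution s2 by rewrite s2E; exact: (solution_rescale q0 sol').
have sol1 : solution s1.
  have := solution_inv_y _ sol2; rewrite /s1 invrK; apply.
  by rewrite invr_neq0 // mulf_neq0.
apply: (@rst_trans _ _ _ s1).
  by apply: rst_step; split=> //; exact: invert_x.
apply: (@rst_trans _ _ _ s2).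
  by apply: rst_step; split=> //; exact: invert_y.
apply: rst_sym; rewrite s2E.
exact: (@equivalent_rescale R q (septuple_of t1 t0 t2 t3) _ _ _ _ q0 sol' erefl erefl erefl erefl).
Qed.

End Configurations.

(** * From special configurations to the statement *)

Lemma star_lhs_conj (F : numFieldType) (a b c d : rat) (m : nat) (g h : F)
    (i j k : nat) : m.-primitive_root g -> m.-primitive_root h ->
  star_lhs (ratr a) (ratr b) (ratr c) (ratr d) (g ^+ i) (g ^+ j) (g ^+ k) = 0 ->
  star_lhs (ratr a) (ratr b) (ratr c) (ratr d) (h ^+ i) (h ^+ j) (h ^+ k) = 0.
Proof.
move=> pg ph; pose f : {poly rat} := star_lhs a%:P b%:P c%:P d%:P 'X^i 'X^j 'X^k.
have fE (z : F) : (map_poly ratr f).[z]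
    = star_lhs (ratr a) (ratr b) (ratr c) (ratr d) (z ^+ i) (z ^+ j) (z ^+ k).
  rewrite /f /star_lhs !(rmorphD, rmorphN, rmorphM) /= !map_polyC !map_polyXn /=.
  by rewrite !(hornerD, hornerN, hornerM, hornerC, hornerXn).
move=> st; rewrite -fE; apply/rootP; rewrite -(root_primitive_conj f pg ph).
by apply/rootP; rewrite fE.
Qed.

Section Outcome.

Variables (R : realType) (zeta : nat -> R[i]).
Hypothesis hz : forall m, (0 < m)%N -> m.-primitive_root (zeta m).
Local Notation C := R[i].
Implicit Types (t : rat * C) (s : septuple R).

Definition powers_septuple (a b c d : rat) (g : C) (i j k : nat) : septuple R :=
  Septuple a b c d (g ^+ i) (g ^+ j) (g ^+ k).

Lemma equivalent_conj (a b c d : rat) (m : nat) (g h : C) (i j k : nat) :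
  m.-primitive_root g -> m.-primitive_root h ->
  solution (powers_septuple a b c d g i j k) ->
  symmetry_equivalent (powers_septuple a b c d g i j k)
                      (powers_septuple a b c d h i j k).
Proof.
move=> pg ph sol; have [nz ab _ st] := sol.
have m0 := prim_order_gt0 pg; have gm := prim_expr_order pg.
have hm := prim_expr_order ph.
have sol' : solution (powers_septuple a b c d h i j k).
  split; [exact: nz | exact: ab | | exact: (star_lhs_conj pg ph st)].
  by apply: (common_order_exists m0); rewrite exprAC hm expr1n.
have [sigma [[bij rat_fix add mul] sg]] := algebraic_automorphism pg ph.
have gs : galois_aut sigma by [].
apply: rst_step; split=> //.
have E n : h ^+ n = sigma (g ^+ n) by rewrite (galois_expr n gs m0 gm) sg.
by rewrite /powers_septuple !E; exact: galois_action.
Qed.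

Lemma equivalent_powers (a b c d q : rat) (m : nat) (g : C) (i j k : nat) t0 t1 t2 t3 :
  (0 < m)%N -> m.-primitive_root g -> config t0 t1 t2 t3 ->
  t1.2 * t2.2 = g ^+ i -> t1.2 * t3.2 = g ^+ j -> t2.2 * t3.2 = g ^+ k ->
  q != 0 -> t2.1 * t3.1 = q * a -> t0.1 * t1.1 = q * b ->
  - (t3.1 * t1.1) = q * c -> - (t2.1 * t0.1) = q * d ->
  symmetry_equivalent (septuple_of t0 t1 t2 t3) (powers_septuple a b c d (zeta m) i j k).
Proof.
move=> m0 pg cfg xE yE zE q0 aE bE cE dE.
have sol := solution_config cfg.
have E : septuple_of t0 t1 t2 t3
    = Septuple (q * a) (q * b) (q * c) (q * d) (g ^+ i) (g ^+ j) (g ^+ k).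
  by rewrite /septuple_of xE yE zE aE bE cE dE.
rewrite E in sol *.
have qV : q^-1 != 0 by rewrite invr_neq0.
have solg : solution (powers_septuple a b c d g i j k).
  by have := solution_rescale qV sol; rewrite !mulKf.
apply: rst_trans (equivalent_conj pg (hz m0) solg).
apply: rst_sym.
exact: (@equivalent_rescale R q (powers_septuple a b c d g i j k) _ _ _ _ q0 solg erefl erefl erefl erefl).
Qed.

Definition target (n : nat) s : Prop :=
  (n = 10%N /\ s = powers_septuple 3 (1 / 2) (3 / 2) 1 (zeta 10) 1 2 3)
  \/ (n = 12%N /\
      (s = powers_septuple 2 (2 / 3) (4 / 3) 1 (zeta 12) 1 3 5
       \/ s = powers_septuple (4 / 3) (2 / 3) (8 / 9) 1 (zeta 12) 1 4 5))
  \/ (n = 6%N /\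
      ((exists c d : rat, c + 2 * d != 0 /\
          s = powers_septuple (3 * c * d / (c + 2 * d)) ((c + 2 * d) / 3) c d
                (zeta 6) 1 1 2)
       \/ (exists c d : rat,
          s = powers_septuple (2 * d) (1 / 2 * c) c d (zeta 6) 1 2 2)
       \/ (exists b d : rat, 2 * d - 3 * b != 0 /\
          s = powers_septuple ((3 * d ^+ 2 - 4 * b * d) / (2 * d - 3 * b)) b
                ((3 * b * d - 4 * b ^+ 2) / (2 * d - 3 * b)) d
                (zeta 6) 1 2 3))).

Lemma target_order (n : nat) s : target n s -> common_order (sx s) (sy s) (sz s) n.
Proof.
have ord m a b c d j k : (0 < m)%N ->
    common_order (sx (powers_septuple a b c d (zeta m) 1 j k))
      (sy (powers_septuple a b c d (zeta m) 1 j k))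
      (sz (powers_septuple a b c d (zeta m) 1 j k)) m.
  move=> m0; apply/common_orderP; split=> // i /=.
  rewrite -!exprM -!(prim_order_dvd (hz m0)) mul1n.
  by case: (boolP (m %| i)%N) => // mi; rewrite !(dvdn_mull _ mi).
case=> [[-> ->]|[[-> [->|->]]|[-> [[c [d [_ ->]]]|[[c [d ->]]|[b [d [_ ->]]]]]]]];
  exact: ord.
Qed.

Definition outcome t0 t1 t2 t3 : Prop :=
  [\/ exists l0 l1 l2 l3 : int,
        [/\ [|| l0 != 0, l1 != 0, l2 != 0 | l3 != 0], l0 + l1 + l2 + l3 = 0
          & forall u : C, u != 0 ->
            ratr t0.1 * trace (t0.2 * u ^ l0) + ratr t1.1 * trace (t1.2 * u ^ l1)
            + ratr t2.1 * trace (t2.2 * u ^ l2) + ratr t3.1 * trace (t3.2 * u ^ l3)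
            = 0],
      [/\ t1.2 = t0.2, t2.2 = t0.2, t3.2 = t0.2 & t0.2 ^+ 2 = -1]
    | exists n s, target n s /\ symmetry_equivalent (septuple_of t0 t1 t2 t3) s].

Lemma special_outcome t0 t1 t2 t3 :
  special t0 t1 t2 t3 -> config t0 t1 t2 t3 -> outcome t0 t1 t2 t3.
Proof.
elim=> {t0 t1 t2 t3} t0 t1 t2 t3.
- by move=> l0 l1 l2 l3 nz l_sum van cfg; constructor 1; exists l0, l1, l2, l3.
- by move=> e1 e2 e3 sq cfg; constructor 2.
- move=> g k pg xE yE zE c0 c1 c2 c3 cfg; constructor 3.
  have [[/and4P [n0 _ _ _] _ _] _ _ _] := cfg; rewrite c0 in n0.
  exists 10%N, (powers_septuple 3 (1 / 2) (3 / 2) 1 (zeta 10) 1 2 3).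
  split; first by left.
  apply: (equivalent_powers (q := - 4 * k ^+ 2) (i := 1%N) (j := 2%N) (k := 3%N)
    (isT : 0 < 10)%N pg cfg xE yE zE).
  + by rewrite mulf_neq0 // expf_neq0.
  + by rewrite c2 c3; field.
  + by rewrite c0 c1; field.
  + by rewrite c1 c3; field.
  + by rewrite c0 c2; field.
- move=> g k pg xE yE zE c0 c1 c2 c3 cfg; constructor 3.
  have [[/and4P [n0 _ _ _] _ _] _ _ _] := cfg; rewrite c0 in n0.
  exists 12%N, (powers_septuple 2 (2 / 3) (4 / 3) 1 (zeta 12) 1 3 5).
  split; first by right; left; split=> //; left.
  apply: (equivalent_powers (q := - 3 * k ^+ 2) (i := 1%N) (j := 3%N) (k := 5%N)
    (isT : 0 < 12)%N pg cfg xE yE zE).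
  + by rewrite mulf_neq0 // expf_neq0.
  + by rewrite c2 c3; field.
  + by rewrite c0 c1; field.
  + by rewrite c1 c3; field.
  + by rewrite c0 c2; field.
- move=> g k pg xE yE zE c0 c1 c2 c3 cfg; constructor 3.
  have [[/and4P [n0 _ _ _] _ _] _ _ _] := cfg; rewrite c0 mulf_eq0 negb_or in n0.
  case/andP: n0 => _ n0.
  exists 12%N, (powers_septuple (4 / 3) (2 / 3) (8 / 9) 1 (zeta 12) 1 4 5).
  split; first by right; left; split=> //; right.
  apply: (equivalent_powers (q := - 9 * k ^+ 2) (i := 1%N) (j := 4%N) (k := 5%N)
    (isT : 0 < 12)%N pg cfg xE yE zE).
  + by rewrite mulf_neq0 // expf_neq0.
  + by rewrite c2 c3; field.
  + by rewrite c0 c1; field.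
  + by rewrite c1 c3; field.
  + by rewrite c0 c2; field.
- move=> g pg xE yE zE c1 cfg; constructor 3.
  have [[/and4P [n0 _ _ _] sum0 _] _ _ _] := cfg.
  pose c := - (t3.1 * t1.1); pose d := - (t2.1 * t0.1).
  have c3 : t3.1 = - 3 * t0.1 - t2.1 by lra.
  have cdE : c + 2 * d = 6 * t0.1 ^+ 2 by rewrite /c /d c1 c3; ring.
  have cd0 : c + 2 * d != 0 by rewrite cdE mulf_neq0 // expf_neq0.
  exists 6%N, (powers_septuple (3 * c * d / (c + 2 * d)) ((c + 2 * d) / 3) c d
    (zeta 6) 1 1 2).
  split; first by right; right; split=> //; left; exists c, d.
  apply: (equivalent_powers (q := 1) (i := 1%N) (j := 1%N) (k := 2%N)
    (isT : 0 < 6)%N pg cfg xE yE zE);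
    rewrite ?mul1r ?oner_neq0 //.
  + by rewrite cdE /c /d c1; field; rewrite n0.
  + by rewrite cdE c1; field.
- move=> g pg xE yE zE c3 cfg; constructor 3.
  pose c := - (t3.1 * t1.1); pose d := - (t2.1 * t0.1).
  exists 6%N, (powers_septuple (2 * d) (1 / 2 * c) c d (zeta 6) 1 2 2).
  split; first by right; right; split=> //; right; left; exists c, d.
  apply: (equivalent_powers (q := 1) (i := 1%N) (j := 2%N) (k := 2%N)
    (isT : 0 < 6)%N pg cfg xE yE zE);
    rewrite ?mul1r ?oner_neq0 //.
  + by rewrite /d c3; ring.
  + by rewrite /c c3; field.
- move=> g pg xE yE zE c2 cfg; constructor 3.
  have [[/and4P [n0 n1 _ _] sum0 _] _ _ _] := cfg.
  pose b := t0.1 * t1.1; pose d := - (t2.1 * t0.1).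
  have c2' : t2.1 = (t0.1 - 3 * t1.1) / 2 by lra.
  have c3 : t3.1 = (t1.1 - 3 * t0.1) / 2 by lra.
  have bdE : 2 * d - 3 * b = - t0.1 ^+ 2 by rewrite /b /d c2'; field.
  have bd0 : 2 * d - 3 * b != 0 by rewrite bdE oppr_eq0 expf_neq0.
  exists 6%N, (powers_septuple ((3 * d ^+ 2 - 4 * b * d) / (2 * d - 3 * b)) b
    ((3 * b * d - 4 * b ^+ 2) / (2 * d - 3 * b)) d (zeta 6) 1 2 3).
  split; first by right; right; split=> //; right; right; exists b, d.
  apply: (equivalent_powers (q := 1) (i := 1%N) (j := 2%N) (k := 3%N)
    (isT : 0 < 6)%N pg cfg xE yE zE);
    rewrite ?mul1r ?oner_neq0 //.
  + by rewrite bdE /b /d c2' c3; field.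
  + by rewrite bdE /b /d c2' c3; field.
- move=> _ IH cfg; case: (IH (config_swap01 cfg)).
  + case=> l0 [l1 [l2 [l3 [nz l_sum van]]]]; constructor 1; exists l1, l0, l2, l3.
    split; first by rewrite orbCA.
      by rewrite -l_sum; ring.
    by move=> u u0; rewrite -(van u u0); ring.
  + by case=> e1 e2 e3 sq; constructor 2; split; rewrite ?e1 ?e2 ?e3.
  + case=> n [s [tgt eqv]]; constructor 3; exists n, s; split=> //.
    exact: rst_trans (equivalent_swap01 cfg) eqv.
- move=> _ IH cfg; case: (IH (config_swap12 cfg)).
  + case=> l0 [l1 [l2 [l3 [nz l_sum van]]]]; constructor 1; exists l0, l2, l1, l3.
    split; first by rewrite [(l2 != 0) || _]orbCA.
      by rewrite -l_sum; ring.
    by move=> u u0; rewrite -(van u u0); ring.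
  + by case=> e1 e2 e3 sq; constructor 2; split; rewrite ?e1 ?e2 ?e3.
  + case=> n [s [tgt eqv]]; constructor 3; exists n, s; split=> //.
    exact: rst_trans (equivalent_swap12 cfg) eqv.
- move=> _ IH cfg; case: (IH (config_swap23 cfg)).
  + case=> l0 [l1 [l2 [l3 [nz l_sum van]]]]; constructor 1; exists l0, l1, l3, l2.
    split; first by rewrite [(l3 != 0) || _]orbC.
      by rewrite -l_sum; ring.
    by move=> u u0; rewrite -(van u u0); ring.
  + by case=> e1 e2 e3 sq; constructor 2; split; rewrite ?e1 ?e2 ?e3.
  + case=> n [s [tgt eqv]]; constructor 3; exists n, s; split=> //.
    exact: rst_trans (equivalent_swap23 cfg) eqv.
Qed.

(** A factor u^(l_i) on w_i becomes u^(l1 + l2), u^(l1 + l3), u^(l2 + l3) on x, y,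
    z; these exponents are zero only if all l_i are. *)
Lemma unbounded_star (a b c d : rat) (l0 l1 l2 l3 : int) (w0 w1 w2 w3 : C) :
  w0 * w1 * w2 * w3 = 1 ->
  [|| l0 != 0, l1 != 0, l2 != 0 | l3 != 0] -> l0 + l1 + l2 + l3 = 0 ->
  (forall u : C, u != 0 ->
     ratr (d - b) * trace (w0 * u ^ l0) + ratr (b - c) * trace (w1 * u ^ l1)
     + ratr (a - d) * trace (w2 * u ^ l2) + ratr (c - a) * trace (w3 * u ^ l3) = 0) ->
  in_unbounded_family (Septuple a b c d (w1 * w2) (w1 * w3) (w2 * w3)).
Proof.
move=> pr nz l_sum van; exists (l1 + l2), (l1 + l3), (l2 + l3); split.
  apply: contraT; rewrite !negb_or !negbK => /and3P [/eqP e12 /eqP e13 /eqP e23].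
  have e1 : l1 = 0 by lia.
  have e2 : l2 = 0 by lia.
  have e3 : l3 = 0 by lia.
  by move: nz; rewrite e1 e2 e3 !orbF => /eqP; lia.
move=> u u0; rewrite /star /= !expfzDr //.
have pr' : (w0 * u ^ l0) * (w1 * u ^ l1) * (w2 * u ^ l2) * (w3 * u ^ l3) = 1.
  transitivity (w0 * w1 * w2 * w3 * u ^ (l0 + l1 + l2 + l3)).
    by rewrite !expfzDr //; ring.
  by rewrite pr l_sum expr0z mulr1.
have := star_trace a b c d pr'; rewrite (van u u0) mulr0 => st.
have E v w m k : v * w * (u ^ m * u ^ k) = v * u ^ m * (w * u ^ k) := mulrACA _ _ _ _.
by rewrite !E.
Qed.

End Outcome.

Section Degenerate.

Variable R : realType.
Local Notation C := R[i].
Implicit Types (a b c d : rat) (x y z : C).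

(** When two of a, b, c, d coincide the left-hand side factors, and each factor
    vanishes along a one-parameter family. *)
Lemma star_factor_ac (F : comNzRingType) (a b x y z : F) :
  star_lhs a b a b x y z = (b - a) * (x - 1) * (y - z).
Proof. by rewrite /star_lhs; ring. Qed.

Lemma star_factor_ad (F : comNzRingType) (a b x y z : F) :
  star_lhs a b b a x y z = (a - b) * (x - 1) * (y * z - 1).
Proof. by rewrite /star_lhs; ring. Qed.

Lemma star_factor_ab (F : comNzRingType) (a c d x y z : F) :
  star_lhs a a c d x y z = (y - 1) * ((d - a) * (x * z - 1) + (a - c) * (x - z)).
Proof. by rewrite /star_lhs; ring. Qed.

Lemma star_factor_cd (F : comNzRingType) (a b c x y z : F) :
  star_lhs a b c c x y z = (z - 1) * ((c - b) * (x * y - 1) + (a - c) * (x - y)).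
Proof. by rewrite /star_lhs; ring. Qed.

Lemma unbounded_ac a b x y z : star (Septuple a b a b x y z) ->
  in_unbounded_family (Septuple a b a b x y z).
Proof.
rewrite /star /= star_factor_ac => /eqP; rewrite !mulf_eq0 -orbA => /or3P [] /eqP e.
- exists 1, 0, 0; split=> // u u0; rewrite /star /= star_factor_ac e; ring.
- exists 0, 1, 0; split=> // u u0; rewrite /star /= star_factor_ac expr0z mulr1 e; ring.
- exists 0, 1, 1; split=> // u u0; rewrite /star /= star_factor_ac -mulrBl e; ring.
Qed.

Lemma unbounded_ad a b x y z : star (Septuple a b b a x y z) ->
  in_unbounded_family (Septuple a b b a x y z).
Proof.
rewrite /star /= star_factor_ad => /eqP; rewrite !mulf_eq0 -orbA => /or3P [] /eqP e.
- exists 1, 0, 0; split=> // u u0; rewrite /star /= star_factor_ad e; ring.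
- exists 0, 1, 0; split=> // u u0; rewrite /star /= star_factor_ad expr0z mulr1 e; ring.
- exists 0, 1, (-1); split=> // u u0; rewrite /star /= star_factor_ad.
  by rewrite mulrACA -expfzDr // addrN expr0z !mulr1 e mulr0.
Qed.

Lemma unbounded_ab a c d x y z : star (Septuple a a c d x y z) ->
  in_unbounded_family (Septuple a a c d x y z).
Proof.
rewrite /star /= star_factor_ab => /eqP; rewrite mulf_eq0 => /orP [] /eqP e.
- exists 1, 0, 0; split=> // u u0.
  by rewrite /star /= star_factor_ab expr0z (mulr1 y) e mul0r.
- exists 0, 1, 0; split=> // u u0.
  by rewrite /star /= star_factor_ab expr0z !(mulr1 x) (mulr1 z) e mulr0.
Qed.

Lemma unbounded_cd a b c x y z : star (Septuple a b c c x y z) ->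
  in_unbounded_family (Septuple a b c c x y z).
Proof.
rewrite /star /= star_factor_cd => /eqP; rewrite mulf_eq0 => /orP [] /eqP e.
- exists 1, 0, 0; split=> // u u0.
  by rewrite /star /= star_factor_cd expr0z (mulr1 z) e mul0r.
- exists 0, 0, 1; split=> // u u0.
  by rewrite /star /= star_factor_cd expr0z !(mulr1 x) (mulr1 y) e mulr0.
Qed.

(** For the last condition, a (d - b + c - a) = (a - c) (d - a) on the quadric. *)
Lemma quadric_generic a b c d : a * b = c * d ->
  [&& a != 0, b != 0, c != 0 & d != 0] ->
  [&& a != b, a != c, a != d & c != d] ->
  generic (d - b) (b - c) (a - d) (c - a).
Proof.
move=> ab /and4P [a0 b0 c0 d0] /and4P [nab nac nad ncd].
split; last 1 first.
- apply/and3P; split.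
  + by apply: contra_neq ncd => e; lra.
  + by apply: contra_neq nab => e; lra.
  + have : (a - c) * (d - a) != 0 by rewrite mulf_neq0 ?subr_eq0 // eq_sym.
    apply: contra_neq => e; transitivity (a * (d - b + (c - a)));
      last by rewrite e mulr0.
    by transitivity (a * (c + d - a) - c * d); [ring | rewrite -ab; ring].
- rewrite !subr_eq0 nad [c == a]eq_sym nac /= andbT; apply/andP; split.
    apply: contra_neq nac => db; apply: (mulIf b0); rewrite ab db.
    by [].
  apply: contra_neq nad => bc; apply: (mulIf b0); rewrite ab bc.
  by rewrite mulrC.
- by ring.
Qed.

(** With square roots X, Y, Z of x, y, z: w1 = X Y / Z, w2 = X Z / Y, w3 = Y Z / X
    and w0 = 1 / (X Y Z). *)
Lemma half_angles x y z (m : nat) : (0 < m)%N ->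
  x ^+ m = 1 -> y ^+ m = 1 -> z ^+ m = 1 ->
  exists w0 w1 w2 w3 : C,
    [/\ w0 * w1 * w2 * w3 = 1, w1 * w2 = x, w1 * w3 = y & w2 * w3 = z] /\
    [/\ w0 ^+ (2 * m) = 1, w1 ^+ (2 * m) = 1, w2 ^+ (2 * m) = 1
      & w3 ^+ (2 * m) = 1].
Proof.
move=> m0 xm ym zm.
have root (u : C) : u ^+ m = 1 -> exists2 v, v ^+ 2 = u & v ^+ (2 * m) = 1.
  by move=> um; exists (sqrtC u); rewrite ?exprM sqrtCK.
have [X Xx XN] := root _ xm; have [Y Yy YN] := root _ ym; have [Z Zz ZN] := root _ zm.
have N0 : (0 < 2 * m)%N by rewrite muln_gt0.
have X0 := unity_neq0 N0 XN; have Y0 := unity_neq0 N0 YN.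
have Z0 := unity_neq0 N0 ZN.
exists (X * Y * Z)^-1, (X * Y / Z), (X * Z / Y), (Y * Z / X); split; split.
- by field; rewrite X0 Y0 Z0.
- by rewrite -Xx; field; rewrite Y0 Z0.
- by rewrite -Yy; field; rewrite X0 Z0.
- by rewrite -Zz; field; rewrite X0 Y0.
- by rewrite exprVn !exprMn XN YN ZN !mulr1 invr1.
- by rewrite !exprMn exprVn XN YN ZN mulr1 invr1 mulr1.
- by rewrite !exprMn exprVn XN YN ZN mulr1 invr1 mulr1.
- by rewrite !exprMn exprVn XN YN ZN mulr1 invr1 mulr1.
Qed.

End Degenerate.

Theorem theorem6p3 (R : realType) (zeta : nat -> R[i])
  (hzeta : forall m : nat, (0 < m)%N -> m.-primitive_root (zeta m))
  (a b c d : rat) (x y z : R[i]) (n : nat)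
  (hP3 : [|| a != 0, b != 0, c != 0 | d != 0])
  (hquad : a * b = c * d)
  (hn : common_order x y z n)
  (hstar : star (Septuple a b c d x y z)) :
  in_unbounded_family (Septuple a b c d x y z)
  \/ (2 <= count (pred1 (0 : rat)) [:: a; b; c; d])%N
  \/ [/\ x = -1, y = -1 & z = -1]
  \/ (n = 10%N /\
      symmetry_equivalent (Septuple a b c d x y z)
        (Septuple 3 (1 / 2) (3 / 2) 1 (zeta 10%N) (zeta 10%N ^+ 2) (zeta 10%N ^+ 3)))
  \/ (n = 12%N /\
      (symmetry_equivalent (Septuple a b c d x y z)
         (Septuple 2 (2 / 3) (4 / 3) 1
            (zeta 12%N) (zeta 12%N ^+ 3) (zeta 12%N ^+ 5))
       \/ symmetry_equivalent (Septuple a b c d x y z)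
            (Septuple (4 / 3) (2 / 3) (8 / 9) 1
               (zeta 12%N) (zeta 12%N ^+ 4) (zeta 12%N ^+ 5))))
  \/ (n = 6%N /\
      ((exists c' d' : rat, c' + 2 * d' != 0 /\
          symmetry_equivalent (Septuple a b c d x y z)
            (Septuple (3 * c' * d' / (c' + 2 * d')) ((c' + 2 * d') / 3) c' d'
               (zeta 6%N) (zeta 6%N) (zeta 6%N ^+ 2)))
       \/ (exists c' d' : rat,
          symmetry_equivalent (Septuple a b c d x y z)
            (Septuple (2 * d') (1 / 2 * c') c' d'
               (zeta 6%N) (zeta 6%N ^+ 2) (zeta 6%N ^+ 2)))
       \/ (exists b' d' : rat, 2 * d' - 3 * b' != 0 /\
          symmetry_equivalent (Septuple a b c d x y z)
            (Septuple ((3 * d' ^+ 2 - 4 * b' * d') / (2 * d' - 3 * b')) b'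
               ((3 * b' * d' - 4 * b' ^+ 2) / (2 * d' - 3 * b')) d'
               (zeta 6%N) (zeta 6%N ^+ 2) (zeta 6%N ^+ 3))))).
Proof.
have [n0 xn yn zn] := common_order_unity hn.
have [nz|] := boolP [&& a != 0, b != 0, c != 0 & d != 0]; last first.
  move=> z0; right; left; rewrite /=.
  have [cd0|cdn] := eqVneq (c * d) 0; last first.
    have abn : a * b != 0 by rewrite hquad.
    move: cdn abn; rewrite !mulf_eq0 !negb_or => /andP [c0 d0] /andP [a0 b0].
    by rewrite a0 b0 c0 d0 in z0.
  have := cd0; rewrite -hquad; move/eqP: cd0.
  move=> /[swap] /eqP; rewrite !mulf_eq0.
  by do 2 case/orP => ->; rewrite ?addnS.
have [a0 b0 c0 d0] := and4P nz.
have [ab|nab] := eqVneq a b.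
  by left; move: hstar; rewrite ab; exact: unbounded_ab.
have [cd|ncd] := eqVneq c d.
  by left; move: hstar; rewrite cd; exact: unbounded_cd.
have [ac|nac] := eqVneq a c.
  left; have bd : b = d by apply: (mulfI a0); rewrite hquad ac.
  by move: hstar; rewrite ac bd; exact: unbounded_ac.
have [ad|nad] := eqVneq a d.
  left; have bc : b = c by apply: (mulfI a0); rewrite hquad ad mulrC.
  by move: hstar; rewrite ad bc; exact: unbounded_ad.
have gen : generic (d - b) (b - c) (a - d) (c - a).
  by apply: quadric_generic; rewrite ?nab ?nac ?nad ?ncd.
have [w0 [w1 [w2 [w3 [[pr xE yE zE] unity]]]]] := half_angles n0 xn yn zn.
have [/and4P [p0 q0 r0 s0] _ /and3P [_ _ ps0]] := gen.
have w0n : w0 != 0.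
  by apply: contra_eq_neq pr => ->; rewrite !mul0r eq_sym oner_eq0.
have cfg : config (d - b, w0) (b - c, w1) (a - d, w2) (c - a, w3).
  split=> //; first by exists (2 * n)%N; rewrite ?muln_gt0.
  move: hstar; rewrite /star /= -xE -yE -zE (star_trace _ _ _ _ pr) => /eqP.
  by rewrite mulf_eq0 invr_eq0 (negPf w0n) => /eqP.
have sol : solution (Septuple a b c d x y z) by split=> //; exists n.
case: (special_outcome hzeta (special_config hzeta cfg) cfg).
- case=> l0 [l1 [l2 [l3 [lnz l_sum van]]]]; left; rewrite -xE -yE -zE.
  exact: unbounded_star pr lnz l_sum van.
- move=> /= [e1 e2 e3 sq]; right; right; left.
  by rewrite -xE -yE -zE e1 e2 e3 -expr2 sq.
case=> m [s [tgt eqv]]; right; right; right.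
have {}eqv : symmetry_equivalent (Septuple a b c d x y z) s.
  apply: rst_trans eqv; rewrite /septuple_of /= xE yE zE.
  apply: (@equivalent_rescale _ (d - b + (c - a)) (Septuple a b c d x y z)) => //=.
  + transitivity (a * (c + d - a) - c * d); first by ring.
    by rewrite -hquad; ring.
  + transitivity (b * (c + d - b) - c * d); first by ring.
    by rewrite -hquad; ring.
  + transitivity (a * b - c * (a + b - c)); first by ring.
    by rewrite hquad; ring.
  + transitivity (a * b - d * (a + b - d)); first by ring.
    by rewrite hquad; ring.
have nm : n = m.
  apply: (common_order_uniq hn); apply/(symmetric_order m eqv).
  exact: target_order hzeta _ _ tgt.
rewrite nm; move: tgt.
case=> [[-> sE]|[[-> sE]|[-> sE]]]; rewrite ?sE in eqv.
- by left.
- by right; left; split=> //; case: sE => sE; rewrite sE in eqv; [left|right].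
- right; right; split=> //.
  case: sE => [[c' [d' [nz' sE]]]|[[c' [d' sE]]|[b' [d' [nz' sE]]]]]; rewrite sE in eqv.
  + by left; exists c', d'.
  + by right; left; exists c', d'.
  + by right; right; exists b', d'.
Qed.
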